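(* Let $g\in H^\infty(\mathbb{D})$ satisfy: $g(\mathbb{D})\cap\mathbb{D}=\varnothing$; $|g|>1$ almost everywhere on $\mathbb{T}$; there is a bounded holomorphic function $u:\mathbb{D}\to\mathbb{C}$ with $g=e^u$; and the intersection of the closure $\overline{u(\mathbb{D})}$ with the imaginary axis $i\mathbb{R}$ is a single point. Let $f\in H^2(\mathbb{D})$, $f\neq 0$. Then for every $k>0$, $\limsup_{n\to\infty}n^{-k}\|(T_g^* )^nf\|=+\infty$.
   Context: $\mathbb{D}$ is the open unit disk, $\mathbb{T}$ the unit circle; $H^\infty$ functions are identified with their boundary values on $\mathbb{T}$. $H^2(\mathbb{D})\subseteq L^2(\mathbb{T})$; for $g\in L^\infty(\mathbb{T})$, $T_g=PM_g$ with $M_g$ multiplication by $g$ and $P$ the orthogonal projection of $L^2(\mathbb{T})$ onto $H^2(\mathbb{D})$; $T_g^*$ is the Hilbert space adjoint. *)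

(* Defs.v *)
From Stdlib Require Import Reals.
From mathcomp Require Import all_boot all_algebra all_classical all_reals all_analysis Rstruct Rstruct_topology.

Definition leb_negligible (S : R -> Prop) : Prop :=
  (@lebesgue_measure R).-negligible S.

From Coquelicot Require Import Coquelicot.
Open Scope R_scope.

Definition cexp (w : C) : C := (Rtrigo_def.exp (Re w) * Rtrigo_def.cos (Im w), Rtrigo_def.exp (Re w) * Rtrigo_def.sin (Im w)).

(* F is holomorphic on the open unit disk D, with Taylor coefficients a at 0:
   F z = sum_n a_n z^n for every z in D. *)
Definition taylor_on_disk (a : nat -> C) (F : C -> C) : Prop :=
  forall z : C, Cmod z < 1 -> is_series (fun n => (a n * pow_n z n)%C) (F z).

Definition bounded_on_disk (F : C -> C) : Prop :=
  exists M : R, forall z : C, Cmod z < 1 -> Cmod (F z) <= M.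

Definition in_closure_of_image (F : C -> C) (w : C) : Prop :=
  forall eps : R, 0 < eps -> exists z : C, Cmod z < 1 /\ Cmod (F z - w)%C < eps.

Definition radial_limit (F : C -> C) (t : R) (L : C) : Prop :=
  filterlim (fun r : R => F (r * Rtrigo_def.cos t, r * Rtrigo_def.sin t)) (at_left 1) (locally L).

(* H^2(D), identified with Taylor-coefficient sequences: f in H^2 iff
   sum |f_n|^2 < oo; norm = L^2(T, dtheta/2pi) norm = (sum |f_n|^2)^{1/2}. *)
Definition is_H2 (f : nat -> C) : Prop := ex_series (fun n => Cmod (f n) ^ 2).

Definition H2_norm (f : nat -> C) : R := sqrt (Series (fun n => Cmod (f n) ^ 2)).

Definition H2_inner (f h : nat -> C) : C :=
  (Series (fun n => Re (f n * Cconj (h n))%C), Series (fun n => Im (f n * Cconj (h n))%C)).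

(* For g in H^infinity with Taylor coefficients ghat, T_g = P M_g acts on H^2
   as multiplication by g, i.e. Cauchy product of coefficient sequences. *)
Definition toeplitz_analytic (ghat : nat -> C) (f : nat -> C) : nat -> C :=
  fun n => sum_n (fun k => (ghat k * f (n - k)%nat)%C) n.

Definition is_H2_adjoint (T A : (nat -> C) -> (nat -> C)) : Prop :=
  forall f h : nat -> C, is_H2 f -> is_H2 h ->
    is_H2 (A h) /\ H2_inner (T f) h = H2_inner f (A h).

(* Main.v *)
Require Import Defs.
From Stdlib Require Import Reals Lra Lia ZArith Psatz FunctionalExtensionality ClassicalEpsilon.
From Coquelicot Require Import Coquelicot.
From mathcomp Require all_boot all_order all_algebra all_classical all_reals all_analysis Rstruct Rstruct_topology.
Open Scope R_scope.

(* Suppose [|(T_g^* )^n f|] grows at most polynomially. Put [v = e^(i y0) / g], so [|v| <= 1],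
   and for [h] in [H^2] let [b n = <(e^(-i y0) g)^n h, f>] for [n] in [Z]. Then [b] has polynomial
   growth. The values of [v] stay away from every unimodular [z <> 1], hence [(1 + conj z v) / 2]
   has sup norm [< 1]; this makes the Abel means of the Fourier series [sum_n b n e^(i n x)] tend
   to [0] locally uniformly off [x = 0]. Smoothing the series by box averages of small width
   turns it into a bounded function concentrated near [0], and multiplying by a power of
   [e^(i x) - 1] shows that a power of the difference operator kills [b], that is,
   [<(v - 1)^m h, f> = 0] for all [h]. Finally [v - 1] is outer: with [y = (1 + v) / 2], the powers
   [y^j] tend weakly to [0] while [1 - y] is a multiple of [v - 1]. So [f = 0]. *)

(** * Lebesgue measure *)

(** Formally, the Fourier series of [b] at x does not change when [b n] is replaced by (b n +
    e^(-ix) b (n-1)) / 2, because the factor e^(-ix) undoes the shift. On h this replacement acts as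
    (1 + e^(-ix) v) / 2, whose sup norm k < 1 shrinks the coefficients by k each time; an invariant
    sum with shrinking terms must vanish. Abel means make this rigorous at the price of an error of
    order 1 - r.

    The difference order K + 3 is a count of powers of the box width: K + 2 averages turn growth
    |n|^K into the summable decay |n|^(-2) and cost width^(-(K+2)), and K + 3 factors e^(ix) - 1,
    each of the order of the width near 0, leave one power to spare.

    Integrals over the circle are replaced by means over N-th roots of unity, exact for
    trigonometric polynomials of low degree; the Hardy space is handled through coefficients and
    values inside the disk. The condition |g| > 1 almost everywhere enters by excluding that |g| is
    identically 1, which keeps v from being the constant 1. *)

Module LebesgueInterval.
Import all_boot all_order all_algebra all_classical all_reals all_analysis Rstruct Rstruct_topology.
Import Order.TTheory GRing.Theory Num.Theory.
Local Open Scope classical_set_scope.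

(** The interval [0, 1] stands for an arc of the circle, since it lies within the parameter range
    [0, 2 pi]. *)
Lemma interval_not_negligible (S : R -> Prop) :
  (forall t : R, Rle (IZR 0) t -> Rle t (IZR 1) -> S t) -> ~ leb_negligible S.
Proof.
move=> HS [B [mB B0 SB]].
have : (@lebesgue_measure R `[0%R, 1%R]%classic <= @lebesgue_measure R B)%E.
  apply: le_measure; rewrite ?inE.
  - by apply: measurable_itv.
  - by [].
  - move=> t /=; rewrite in_itv /= => /andP[/RleP t0 /RleP t1].
    by apply: SB; apply: HS.
by rewrite B0 lebesgue_measure_itv /= lte_fin ltr01 -EFinD subr0 lee_fin ler10.
Qed.

End LebesgueInterval.

(** * Finite sums *)

Fixpoint csum (u : nat -> C) (n : nat) : C :=
  match n with O => 0%C | S m => (csum u m + u m)%C end.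

Fixpoint rsum (u : nat -> R) (n : nat) : R :=
  match n with O => 0 | S m => rsum u m + u m end.

Lemma csum_ext (u v : nat -> C) n :
  (forall i, (i < n)%nat -> u i = v i) -> csum u n = csum v n.
Proof.
induction n as [|n IH]; intros H; [reflexivity|simpl].
rewrite IH, H; auto with arith.
Qed.

Lemma csum_plus (u v : nat -> C) n :
  csum (fun i => u i + v i)%C n = (csum u n + csum v n)%C.
Proof. induction n as [|n IH]; simpl; [|rewrite IH]; ring. Qed.

Lemma csum_scal (c : C) (u : nat -> C) n :
  csum (fun i => c * u i)%C n = (c * csum u n)%C.
Proof. induction n as [|n IH]; simpl; [|rewrite IH]; ring. Qed.

Lemma csum_minus (u v : nat -> C) n :
  csum (fun i => u i - v i)%C n = (csum u n - csum v n)%C.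
Proof. induction n as [|n IH]; simpl; [|rewrite IH]; ring. Qed.

Lemma csum_zero n : csum (fun _ => 0%C) n = 0%C.
Proof. induction n as [|n IH]; simpl; [|rewrite IH]; ring. Qed.

Lemma csum_const (c : C) n : csum (fun _ => c) n = (INR n * c)%C.
Proof.
induction n as [|n IH]; [simpl; ring|].
rewrite S_INR, RtoC_plus; cbn [csum]; rewrite IH; ring.
Qed.

Lemma csum_switch (u : nat -> nat -> C) n m :
  csum (fun i => csum (u i) m) n = csum (fun j => csum (fun i => u i j) n) m.
Proof.
induction n as [|n IH]; simpl; [now rewrite csum_zero|].
now rewrite IH, csum_plus.
Qed.

Lemma csum_conj (u : nat -> C) n :
  Cconj (csum u n) = csum (fun i => Cconj (u i)) n.
Proof.
induction n as [|n IH]; simpl; [apply injective_projections; simpl; ring|].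
rewrite <- IH; apply injective_projections; simpl; ring.
Qed.

Lemma csum_single (u : nat -> C) n m : (m < n)%nat ->
  (forall i, (i < n)%nat -> i <> m -> u i = 0%C) -> csum u n = u m.
Proof.
induction n as [|n IH]; intros Hm Hu; [lia|simpl].
destruct (Nat.eq_dec n m) as [->|Hn].
- rewrite (csum_ext _ (fun _ => 0%C)), csum_zero; [ring|].
  intros i Hi; apply Hu; lia.
- rewrite IH, (Hu n); [ring|lia|lia|lia|intros; apply Hu; lia].
Qed.

Lemma rsum_ext (u v : nat -> R) n :
  (forall i, (i < n)%nat -> u i = v i) -> rsum u n = rsum v n.
Proof.
induction n as [|n IH]; intros H; [reflexivity|simpl].
rewrite IH, H; auto with arith.
Qed.

Lemma rsum_scal (c : R) (u : nat -> R) n :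
  rsum (fun i => c * u i) n = c * rsum u n.
Proof. induction n as [|n IH]; simpl; [|rewrite IH]; ring. Qed.

Lemma rsum_plus (u v : nat -> R) n :
  rsum (fun i => u i + v i) n = rsum u n + rsum v n.
Proof. induction n as [|n IH]; simpl; [|rewrite IH]; ring. Qed.

Lemma rsum_const (c : R) n : rsum (fun _ => c) n = INR n * c.
Proof.
induction n as [|n IH]; [simpl; ring|].
rewrite S_INR; cbn [rsum]; rewrite IH; ring.
Qed.

Lemma rsum_le (u v : nat -> R) n :
  (forall i, (i < n)%nat -> u i <= v i) -> rsum u n <= rsum v n.
Proof.
induction n as [|n IH]; intros H; simpl; [lra|].
apply Rplus_le_compat; auto with arith.
Qed.

Lemma rsum_ge0 (u : nat -> R) n : (forall i, 0 <= u i) -> 0 <= rsum u n.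
Proof.
intros H; induction n as [|n IH]; simpl; [lra|specialize (H n); lra].
Qed.

Lemma rsum_incr (u : nat -> R) n m :
  (forall i, 0 <= u i) -> (n <= m)%nat -> rsum u n <= rsum u m.
Proof.
intros H Hnm; induction Hnm as [|m Hnm IH]; simpl; [lra|specialize (H m); lra].
Qed.

Lemma rsum_term (u : nat -> R) n m :
  (forall i, 0 <= u i) -> (m < n)%nat -> u m <= rsum u n.
Proof.
intros H Hm; apply Rle_trans with (rsum u (S m)); [simpl|now apply rsum_incr].
assert (X := rsum_ge0 u m H); lra.
Qed.

Lemma csum_RtoC (u : nat -> R) n :
  csum (fun i => RtoC (u i)) n = RtoC (rsum u n).
Proof.
induction n as [|n IH]; [reflexivity|simpl; now rewrite IH, RtoC_plus].
Qed.

Lemma Cmod_csum (u : nat -> C) n :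
  Cmod (csum u n) <= rsum (fun i => Cmod (u i)) n.
Proof.
induction n as [|n IH]; simpl; [rewrite Cmod_0; lra|].
eapply Rle_trans; [apply Cmod_triangle|lra].
Qed.

Lemma rsum_geom (q : R) n : 0 <= q < 1 -> rsum (fun i => q ^ i) n <= / (1 - q).
Proof.
intros Hq.
assert (H : (1 - q) * rsum (fun i => q ^ i) n = 1 - q ^ n)
  by (induction n as [|n IH]; simpl; [|rewrite Rmult_plus_distr_l, IH]; ring).
apply Rmult_le_reg_l with (1 - q); [lra|].
rewrite H, Rinv_r by lra.
assert (0 <= q ^ n) by (apply pow_le; lra); lra.
Qed.

Lemma Cmod_minus_sym (x y : C) : Cmod (x - y) = Cmod (y - x).
Proof. rewrite <- Cmod_opp; f_equal; ring. Qed.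

Lemma Cmod_minus_le (x y : C) : Cmod (x - y) <= Cmod x + Cmod y.
Proof. rewrite <- (Cmod_opp y); apply Cmod_triangle. Qed.

Lemma Cmod_triangle_sub (x y z : C) : Cmod (x - z) <= Cmod (x - y) + Cmod (y - z).
Proof.
replace (x - z)%C with ((x - y) + (y - z))%C by ring; apply Cmod_triangle.
Qed.

(** * Roots of unity *)

Definition expi (x : R) : C := (cos x, sin x).

Lemma expi_add x y : expi (x + y) = (expi x * expi y)%C.
Proof.
apply injective_projections; simpl; [rewrite cos_plus|rewrite sin_plus]; ring.
Qed.

Lemma expi_0 : expi 0 = 1%C.
Proof. unfold expi; now rewrite cos_0, sin_0. Qed.

Lemma Cmod_expi x : Cmod (expi x) = 1.
Proof.
unfold Cmod, expi; simpl fst; simpl snd.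
replace (cos x ^ 2 + sin x ^ 2) with 1; [apply sqrt_1|].
assert (H := sin2_cos2 x); unfold Rsqr in H; nra.
Qed.

Lemma expi_neq0 x : expi x <> 0%C.
Proof. apply Cmod_gt_0; rewrite Cmod_expi; lra. Qed.

Lemma expi_opp x : (expi x * expi (- x) = 1)%C.
Proof. now rewrite <- expi_add, Rplus_opp_r, expi_0. Qed.

Lemma expi_conj x : Cconj (expi x) = expi (- x).
Proof. unfold expi; rewrite cos_neg, sin_neg; reflexivity. Qed.

Lemma expi_period x (k : nat) : expi (x + 2 * PI * INR k) = expi x.
Proof.
unfold expi; replace (2 * PI * INR k) with (2 * INR k * PI) by ring.
now rewrite cos_period, sin_period.
Qed.

Lemma expi_pow x n : (expi x ^ n)%C = expi (INR n * x).
Proof.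
induction n as [|n IH]; [simpl; now rewrite Rmult_0_l, expi_0|].
rewrite S_INR; simpl Cpow; rewrite IH, <- expi_add; f_equal; ring.
Qed.

Lemma Cmod_expi_sub1 x : Cmod (expi x - 1) = 2 * Rabs (sin (x / 2)).
Proof.
unfold Cmod, expi; simpl fst; simpl snd.
replace ((cos x + - (1)) ^ 2 + (sin x + - 0) ^ 2)
  with (Rsqr (2 * sin (x / 2))).
- rewrite sqrt_Rsqr_abs, Rabs_mult, (Rabs_pos_eq 2); lra.
- assert (H := sin2_cos2 x); assert (H2 := sin2_cos2 (x / 2)).
  assert (H3 := cos_2a_sin (x / 2)); replace (2 * (x / 2)) with x in H3 by field.
  unfold Rsqr in *; nra.
Qed.

Lemma Rabs_sin_le x : Rabs (sin x) <= Rabs x.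
Proof.
assert (P : forall y, 0 <= y -> Rabs (sin y) <= y).
{ intros y Hy; destruct (Req_dec y 0) as [->|Hn].
  - rewrite sin_0, Rabs_R0; lra.
  - destruct (Rle_lt_dec y 1) as [H1|H1].
    + assert (B := PI2_1); rewrite Rabs_pos_eq by (apply sin_ge_0; lra).
      left; apply sin_lt_x; lra.
    + assert (B := SIN_bound y); apply Rabs_le; lra. }
destruct (Rle_lt_dec 0 x) as [H|H].
- rewrite (Rabs_pos_eq x) by lra; now apply P.
- rewrite (Rabs_left x), <- Rabs_Ropp, <- sin_neg by lra; apply P; lra.
Qed.

Lemma Cmod_expi_sub1_le x : Cmod (expi x - 1) <= Rabs x.
Proof.
rewrite Cmod_expi_sub1; assert (H := Rabs_sin_le (x / 2)).
unfold Rdiv in *; rewrite Rabs_mult, (Rabs_pos_eq (/ 2)) in H; lra.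
Qed.

(** By the half-angle formula this comes down to [y / 2 <= sin y] on [0, 1], which follows from the
    Taylor polynomial of degree 7, a lower bound for the sine. *)
Lemma Cmod_expi_sub1_ge x : Rabs x <= 1 -> Rabs x / 2 <= Cmod (expi x - 1).
Proof.
intros Hx; rewrite Cmod_expi_sub1.
assert (P : forall y, 0 <= y <= 1 -> y / 2 <= Rabs (sin y)).
{ intros y Hy; assert (B := PI2_1).
  rewrite Rabs_pos_eq by (apply sin_ge_0; lra).
  destruct (SIN y) as [H _]; [lra|lra|].
  replace (y / 2) with (y - y * (1 / 2)) by field.
  unfold sin_lb, sin_approx, sin_term in H; simpl in H.
  assert (0 <= y ^ 2 <= 1) by (simpl; nra).
  assert (0 <= y ^ 3 <= y) by (simpl; nra).
  assert (0 <= y ^ 5) by (apply pow_le; lra).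
  assert (0 <= y ^ 7 <= y ^ 5) by (replace (y ^ 7) with (y ^ 5 * y ^ 2) by ring; nra).
  simpl in *; nra. }
assert (X : Rabs (x / 2) = Rabs x / 2)
  by (unfold Rdiv; rewrite Rabs_mult, (Rabs_pos_eq (/ 2)); lra).
assert (Y : Rabs (sin (x / 2)) = Rabs (sin (Rabs x / 2))).
{ destruct (Rle_lt_dec 0 x) as [H|H].
  - now rewrite (Rabs_pos_eq x) by lra.
  - rewrite (Rabs_left x) by lra.
    replace (- x / 2) with (- (x / 2)) by field; now rewrite sin_neg, Rabs_Ropp. }
rewrite Y; assert (Z := P (Rabs x / 2)); assert (0 <= Rabs x) by apply Rabs_pos; lra.
Qed.

Lemma expi_geom x N :
  ((expi x - 1) * csum (fun j => expi (INR j * x)) N = expi (INR N * x) - 1)%C.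
Proof.
induction N as [|N IH]; [simpl; rewrite Rmult_0_l, expi_0; ring|].
cbn [csum]; rewrite Cmult_plus_distr_l, IH, S_INR.
replace ((INR N + 1) * x) with (INR N * x + x) by ring; rewrite expi_add; ring.
Qed.

(** Average over the N-th roots of unity, the substitute for the normalised integral over the
    circle. *)
Definition mean (N : nat) (F : R -> C) : C :=
  (/ INR N * csum (fun j => F (2 * PI * INR j / INR N)%R) N)%C.

Lemma mean_ext N (F H : R -> C) :
  (forall x, F x = H x) -> mean N F = mean N H.
Proof. intros E; unfold mean; f_equal; apply csum_ext; auto. Qed.

Lemma mean_scal N (c : C) (F : R -> C) : mean N (fun x => c * F x)%C = (c * mean N F)%C.
Proof. unfold mean; rewrite csum_scal; ring. Qed.

Lemma mean_minus N (F H : R -> C) :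
  mean N (fun x => F x - H x)%C = (mean N F - mean N H)%C.
Proof. unfold mean; rewrite csum_minus; ring. Qed.

Lemma mean_plus N (F H : R -> C) :
  mean N (fun x => F x + H x)%C = (mean N F + mean N H)%C.
Proof. unfold mean; rewrite csum_plus; ring. Qed.

Lemma mean_csum N (F : nat -> R -> C) n :
  mean N (fun x => csum (fun i => F i x) n) = csum (fun i => mean N (F i)) n.
Proof.
induction n as [|n IH].
- unfold mean; simpl; rewrite csum_zero; ring.
- simpl; now rewrite mean_plus, IH.
Qed.

Lemma Cmod_mean_le N (F : R -> C) B : (0 < N)%nat ->
  (forall x, 0 <= x < 2 * PI -> Cmod (F x) <= B) -> Cmod (mean N F) <= B.
Proof.
intros HN HF; assert (HN' : 0 < INR N) by now apply lt_0_INR.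
assert (B0 := PI_RGT_0).
assert (HI : 0 < / INR N) by now apply Rinv_0_lt_compat.
unfold mean; rewrite Cmod_mult, <- RtoC_inv, Cmod_R, Rabs_pos_eq by lra.
apply Rmult_le_reg_l with (INR N); [assumption|].
rewrite <- Rmult_assoc, Rinv_r, Rmult_1_l, <- rsum_const by lra.
eapply Rle_trans; [apply Cmod_csum|apply rsum_le].
intros i Hi; apply HF; split.
- apply Rmult_le_pos; [apply Rmult_le_pos; [lra|apply pos_INR]|].
  left; now apply Rinv_0_lt_compat.
- apply Rmult_lt_reg_r with (INR N); [assumption|].
  replace (2 * PI * INR i / INR N * INR N) with (2 * PI * INR i) by (field; lra).
  apply Rmult_lt_compat_l; [lra|now apply lt_INR].
Qed.

(** The values form a geometric progression with ratio e^(2 pi i l / N). It closes up after N steps,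
    and for l other than 0 the ratio is not 1 because 0 < |l| / N < 1. *)
Lemma mean_expi N (l : Z) : (Z.abs l < Z.of_nat N)%Z ->
  mean N (fun x => expi (IZR l * x)) = if Z.eqb l 0 then 1%C else 0%C.
Proof.
intros Hl.
assert (HN' : 0 < INR N) by (apply lt_0_INR; lia).
assert (HC : RtoC (INR N) <> 0%C) by (intros H; apply RtoC_inj in H; lra).
assert (B0 := PI_RGT_0).
unfold mean; destruct (Z.eqb_spec l 0) as [->|Hn].
- rewrite (csum_ext _ (fun _ => 1%C)), csum_const.
  + field; assumption.
  + intros; now rewrite Rmult_0_l, expi_0.
- set (y := 2 * PI * IZR l / INR N).
  assert (G := expi_geom y N).
  assert (E1 : expi (INR N * y) = 1%C).
  { replace (INR N * y) with (2 * PI * IZR l) by (unfold y; field; lra).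
    destruct (Z.abs_eq_or_opp l) as [Ha|Ha].
    - rewrite <- (Z2Nat.id l), <- INR_IZR_INZ, <- (expi_0) by lia.
      rewrite <- (expi_period 0 (Z.to_nat l)); f_equal; ring.
    - assert (H := expi_opp (2 * PI * IZR l)).
      replace (- (2 * PI * IZR l)) with (0 + 2 * PI * INR (Z.to_nat (- l))) in H.
      + rewrite expi_period, expi_0 in H; rewrite <- H; ring.
      + rewrite INR_IZR_INZ, Z2Nat.id, opp_IZR by lia; ring. }
  rewrite E1 in G.
  assert (Hy : (expi y - 1)%C <> 0%C).
  { apply Cmod_gt_0; rewrite Cmod_expi_sub1.
    assert (Hs : sin (Rabs (y / 2)) > 0).
    { assert (Y : Rabs (y / 2) = PI * (IZR (Z.abs l) / INR N)).
      { unfold y; replace (2 * PI * IZR l / INR N / 2) with (PI * / INR N * IZR l)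
          by (field; lra).
        rewrite Rabs_mult, (Rabs_pos_eq (PI * / INR N)), abs_IZR; [field; lra|].
        apply Rmult_le_pos; [lra|left; now apply Rinv_0_lt_compat]. }
      assert (0 < IZR (Z.abs l) / INR N).
      { apply Rdiv_lt_0_compat; [apply IZR_lt; lia|assumption]. }
      assert (IZR (Z.abs l) / INR N < 1).
      { apply Rmult_lt_reg_r with (INR N); [assumption|].
        unfold Rdiv; rewrite Rmult_assoc, Rinv_l, Rmult_1_r, Rmult_1_l by lra.
        rewrite INR_IZR_INZ; apply IZR_lt; lia. }
      apply sin_gt_0; rewrite Y; nra. }
    revert Hs; unfold Rabs; destruct (Rcase_abs (y / 2)); intros Hs.
    - rewrite sin_neg in Hs; destruct (Rcase_abs (sin (y / 2))); lra.
    - destruct (Rcase_abs (sin (y / 2))); lra. }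
  assert (S0 : csum (fun j => expi (INR j * y)) N = 0%C).
  { rewrite <- (Cmult_1_l (csum _ _)), <- (Cinv_l _ Hy), <- Cmult_assoc, G; ring. }
  rewrite (csum_ext _ (fun j => expi (INR j * y))), S0; [ring|].
  intros j _; f_equal; unfold y; field; lra.
Qed.

(** * Polynomially bounded sequences with spectrum at one point *)

(** The second sum starts at -1, so the range is -L <= n < L and 0 is counted once. *)
Definition Zsum (u : Z -> C) (L : nat) : C :=
  (csum (fun n => u (Z.of_nat n)) L + csum (fun n => u (- Z.of_nat n - 1)%Z) L)%C.

Definition trig (t : Z -> C) (L : nat) (x : R) : C :=
  Zsum (fun n => t n * expi (IZR n * x))%C L.

Definition abel (r : R) (b : Z -> C) : Z -> C :=
  fun n => (RtoC (r ^ Z.abs_nat n) * b n)%C.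

Definition twist (x : R) (b : Z -> C) : Z -> C :=
  fun n => ((b n + expi (- x) * b (n - 1)%Z) / 2)%C.

(** With this sign, [diff] multiplies the Fourier series by e^(ix) - 1 and acts on the orbits below
    as multiplication by v - 1. *)
Definition diff (b : Z -> C) : Z -> C := fun n => (b (n - 1)%Z - b n)%C.

Lemma two_neq0 : RtoC 2 <> 0%C.
Proof. intros H; apply RtoC_inj in H; lra. Qed.

Lemma trig_abel (r : R) (b : Z -> C) L x :
  trig (abel r b) L x =
  (csum (fun n => (r * expi x) ^ n * b (Z.of_nat n)) L
   + csum (fun n => (r * expi (- x)) ^ (S n) * b (- Z.of_nat n - 1)%Z) L)%C.
Proof.
unfold trig, Zsum, abel; f_equal; apply csum_ext; intros n _.
- rewrite Cpow_mult_l, <- RtoC_pow, expi_pow, Zabs2Nat.id, <- INR_IZR_INZ; ring.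
- replace (Z.abs_nat (- Z.of_nat n - 1)) with (S n) by lia.
  rewrite Cpow_mult_l, <- RtoC_pow, expi_pow.
  replace (IZR (- Z.of_nat n - 1) * x) with (INR (S n) * - x); [ring|].
  rewrite S_INR, INR_IZR_INZ, minus_IZR, opp_IZR; ring.
Qed.

(** On negative indices one shift changes the Abel weight by the single factor [r], so the shifted
    sum is the same sum up to its two end terms, at -1 and at -L-1. *)
Lemma neg_part_twist (r : R) (b : Z -> C) L x :
  let S0 := fun b : Z -> C =>
    csum (fun n => (r * expi (- x)) ^ (S n) * b (- Z.of_nat n - 1)%Z)%C L in
  ((1 + r) * S0 b = 2 * r * S0 (twist x b) + r * expi (- x) * b (-1)%Z
     - (r * expi (- x)) ^ (S L) * b (- Z.of_nat L - 1)%Z)%C.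
Proof.
intros S0; unfold S0; clear S0; induction L as [|L IH].
- simpl; ring.
- cbn [csum]; rewrite !Cmult_plus_distr_l, IH.
  unfold twist; replace (- Z.of_nat (S L) - 1)%Z with (- Z.of_nat L - 1 - 1)%Z by lia.
  rewrite (Cpow_S _ (S L)); field; exact two_neq0.
Qed.

(** Under the shift the weight r^|n| gains a factor r for n >= 0 but 1/r for n < 0. The mismatch, of
    order 1 - r, is carried by the negative half alone; the last two terms come from the cut at
    [L]. *)
Lemma trig_abel_twist (r : R) (b : Z -> C) L x : r <> 0 ->
  ((1 + r) * trig (abel r b) L x - 2 * trig (abel r (twist x b)) L x
   = (r - / r) * csum (fun n => (r * expi (- x)) ^ (S n) * b (- Z.of_nat n - 1)%Z) L
     + (r * expi x) ^ L * expi (- x) * b (Z.of_nat L - 1)%Z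
     - / r * (r * expi (- x)) ^ (S L) * b (- Z.of_nat L - 1)%Z)%C.
Proof.
intros Hr.
assert (Hr' : RtoC r <> 0%C) by (intros H; apply Hr; now apply RtoC_inj).
assert (Hw := expi_neq0 (- x)).
assert (Hz : expi x = (/ expi (- x))%C).
{ rewrite <- (Cmult_1_r (/ _)), <- (expi_opp x); field; assumption. }
rewrite !trig_abel, Hz; unfold twist; generalize (expi (- x)) Hw; clear Hz Hw; intros w Hw.
set (w' := (/ w)%C).
assert (Hww : (w' * w = 1)%C) by (unfold w'; field; assumption).
induction L as [|L IH].
- simpl; field; auto.
- cbn [csum].
  (* The induction only compares the increments of the two sides, which differ by a multiple of 1 -
     w' w = 0. *)
  assert (aux : forall X Y X' Y' : C, X = Y -> (X' - X = Y' - Y)%C -> X' = Y').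
  { intros X Y X' Y' -> E; replace X' with (Y + (X' - Y))%C by ring; rewrite E; ring. }
  apply (aux _ _ _ _ IH); clear IH aux.
  replace (Z.of_nat (S L) - 1)%Z with (Z.of_nat L) by lia.
  replace (- Z.of_nat (S L) - 1)%Z with (- Z.of_nat L - 1 - 1)%Z by lia.
  rewrite (Cpow_S _ (S L)), (Cpow_S (r * w')).
  generalize ((r * w') ^ L)%C ((r * w) ^ (S L))%C; intros p q.
  match goal with |- (?X = ?Y)%C =>
    assert (HD : (X - Y = p * r * b (Z.of_nat L) * (1 - w' * w))%C);
      [field; assumption|] end.
  rewrite Hww in HD.
  match goal with |- (?X = ?Y)%C =>
    replace X with (X - Y + Y)%C by ring; rewrite HD; ring end.
Qed.

(** Unrolling the recursion N times leaves a remainder W (q k)^N k^i, which tends to 0. So the a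
    priori constant [W] may be arbitrarily bad without a trace in the conclusion; in the application
    it grows with the truncation. *)
Lemma recursive_bound (y : nat -> R) q k e W :
  0 <= q -> 0 <= k -> q * k < 1 ->
  (forall i, y i <= q * y (S i) + e * k ^ i) -> (forall i, y i <= W * k ^ i) ->
  forall i, y i <= e / (1 - q * k) * k ^ i.
Proof.
intros Hq Hk Hqk H1 H2 i.
assert (HN : forall N i, y i <= (e / (1 - q * k) + W * (q * k) ^ N - e / (1 - q * k) * (q * k) ^ N) * k ^ i).
{ induction N as [|N IH]; intros j.
  - simpl; eapply Rle_trans; [apply H2|right; ring].
  - eapply Rle_trans; [apply H1|].
    eapply Rle_trans; [apply Rplus_le_compat_r, Rmult_le_compat_l; [exact Hq|apply IH]|].
    right; simpl; field; lra. }
apply le_epsilon; intros eps Heps.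
set (V := Rabs W + Rabs (e / (1 - q * k))).
assert (HV : 0 <= V) by (apply Rplus_le_le_0_compat; apply Rabs_pos).
assert (Hki : 0 <= k ^ i) by now apply pow_le.
assert (Hd : 0 < eps / (V * k ^ i + 1)).
{ apply Rdiv_lt_0_compat; [assumption|]; assert (0 <= V * k ^ i) by (now apply Rmult_le_pos); lra. }
assert (Hqk0 : 0 <= q * k) by now apply Rmult_le_pos.
destruct (pow_lt_1_zero (q * k)) with (y := eps / (V * k ^ i + 1)) as [N HNN];
  [rewrite Rabs_pos_eq; assumption|assumption|].
specialize (HNN N (Nat.le_refl N)).
assert (Hp : 0 <= (q * k) ^ N) by now apply pow_le.
rewrite Rabs_pos_eq in HNN by assumption.
eapply Rle_trans; [apply (HN N)|].
assert (B : W * (q * k) ^ N - e / (1 - q * k) * (q * k) ^ N <= V * (q * k) ^ N).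
{ unfold V; assert (X := Rle_abs W); assert (Y := Rle_abs (- (e / (1 - q * k)))).
  rewrite Rabs_Ropp in Y; nra. }
assert (Z : (q * k) ^ N * (V * k ^ i) <= eps).
{ assert (0 <= V * k ^ i) by (now apply Rmult_le_pos).
  apply Rle_trans with (eps / (V * k ^ i + 1) * (V * k ^ i)).
  - apply Rmult_le_compat_r; lra.
  - apply Rmult_le_reg_r with (V * k ^ i + 1); [lra|].
    replace (eps / (V * k ^ i + 1) * (V * k ^ i) * (V * k ^ i + 1))
      with (eps * (V * k ^ i)) by (field; lra); nra. }
nra.
Qed.

(** Each power of the polynomial is paid for by a factorisation r = s q with r < s < 1: the product
    q^L (2 + L) stays bounded, and s takes care of the remaining powers by induction. *)
Lemma pow_mul_poly_small K : forall r eps, 0 < r < 1 -> 0 < eps ->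
  exists L0, forall L, (L0 <= L)%nat -> r ^ L * (2 + INR L) ^ K <= eps.
Proof.
induction K as [|K IH]; intros r eps Hr He.
- destruct (pow_lt_1_zero r) with (y := eps) as [L0 HL];
    [rewrite Rabs_pos_eq; lra|lra|].
  exists L0; intros L HL'; simpl; rewrite Rmult_1_r.
  left; eapply Rle_lt_trans; [apply Rle_abs|now apply HL].
- set (s := (1 + r) / 2); set (q := r / s).
  assert (Hs : 0 < s < 1) by (unfold s; lra).
  assert (Hq : 0 < q < 1).
  { unfold q; split; [apply Rdiv_lt_0_compat; lra|].
    apply Rmult_lt_reg_r with s; [lra|].
    unfold Rdiv; rewrite Rmult_assoc, Rinv_l, Rmult_1_r, Rmult_1_l by lra; unfold s; lra. }
  set (B := 2 + q / (1 - q)).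
  assert (HqB : 0 < q / (1 - q)) by (apply Rdiv_lt_0_compat; lra).
  assert (HB : forall L, q ^ L * (2 + INR L) <= B).
  { assert (H : forall L, q ^ L * INR L <= q / (1 - q) * (1 - q ^ L)).
    { induction L as [|L IHL]; [simpl; lra|].
      rewrite S_INR; simpl pow.
      assert (0 < q ^ L) by (apply pow_lt; lra).
      assert (X : q * (q ^ L * INR L) <= q * (q / (1 - q) * (1 - q ^ L)))
        by (apply Rmult_le_compat_l; lra).
      replace (q / (1 - q) * (1 - q * q ^ L))
        with (q * (q / (1 - q) * (1 - q ^ L)) + q * 1) by (field; lra).
      assert (q ^ L <= 1) by (rewrite <- (pow1 L); apply pow_incr; lra).
      nra. }
    intros L; specialize (H L).
    assert (0 < q ^ L) by (apply pow_lt; lra).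
    assert (q ^ L <= 1) by (rewrite <- (pow1 L); apply pow_incr; lra).
    unfold B; nra. }
  destruct (IH s (eps / B)) as [L0 HL];
    [assumption|apply Rdiv_lt_0_compat; unfold B; lra|].
  exists L0; intros L HL'; specialize (HL L HL'); specialize (HB L).
  replace (r ^ L * (2 + INR L) ^ S K)
    with ((s ^ L * (2 + INR L) ^ K) * (q ^ L * (2 + INR L))).
  + assert (0 <= INR L) by apply pos_INR.
    replace eps with (eps / B * B) by (field; unfold B; lra).
    apply Rmult_le_compat; try assumption.
    * apply Rmult_le_pos; apply pow_le; lra.
    * apply Rmult_le_pos; [apply pow_le|]; lra.
  + replace (r ^ L) with (s ^ L * q ^ L); [simpl; ring|].
    rewrite <- Rpow_mult_distr; f_equal; unfold q; field; lra.
Qed.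

Definition wt (K : nat) (n : Z) : R := (1 + Rabs (IZR n)) ^ K.

Lemma wt_le K n m : (Z.abs n <= m)%Z -> wt K n <= (1 + IZR m) ^ K.
Proof.
intros H; apply pow_incr; rewrite <- abs_IZR; split.
- assert (0 <= IZR (Z.abs n)) by (apply IZR_le; lia); lra.
- apply Rplus_le_compat_l, IZR_le, H.
Qed.

Lemma Cmod_abel_pow r x n : 0 <= r -> Cmod ((r * expi x) ^ n)%C = r ^ n.
Proof.
intros Hr; rewrite Cmod_pow, Cmod_mult, Cmod_expi, Cmod_R, Rabs_pos_eq, Rmult_1_r;
  [reflexivity|assumption].
Qed.

(* The recursions of [neg_part_twist] and [trig_abel_twist] express the sums for
   [b] by those for [twist x b] at a loss of [2 / (1 + r)], which the contraction
   factor of [twist x] beats. *)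
Lemma abel_small (C0 k eps : R) (K : nat) : 0 <= C0 -> 0 < k < 1 -> 0 < eps ->
  exists d, 0 < d < 1 /\ forall r, 1 - d <= r < 1 ->
  exists L0, forall L x b, (L0 <= L)%nat ->
  (forall i n, Cmod (Nat.iter i (twist x) b n) <= C0 * k ^ i * wt K n) ->
  Cmod (trig (abel r b) L x) <= eps.
Proof.
intros HC Hk He.
(* [D] bounds 1 - q k from below once r >= k, since then q k = 2k / (1+r) <= 2k / (1+k) <= (1+k) /
   2. [H0] is going to bound the negative half. *)
set (D := 1 - (1 + k) / 2); assert (HD : 0 < D) by (unfold D; lra).
set (H0 := C0 * (2 ^ K + 1) / D).
assert (H2K : 0 < 2 ^ K) by (apply pow_lt; lra).
assert (HH0 : 0 <= H0).
{ apply Rmult_le_pos; [apply Rmult_le_pos; lra|left; now apply Rinv_0_lt_compat]. }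
set (d := Rmin (Rmin (1 / 2) (1 - k)) (eps * D / (4 * (H0 + 1)))).
assert (Hd1 : 0 < eps * D / (4 * (H0 + 1))).
{ apply Rdiv_lt_0_compat; [now apply Rmult_lt_0_compat|lra]. }
assert (Hd : 0 < d) by (unfold d; repeat apply Rmin_glb_lt; lra).
assert (Hd2 : d <= 1 / 2) by (unfold d; eapply Rle_trans; apply Rmin_l).
assert (Hd3 : d <= 1 - k)
  by (unfold d; eapply Rle_trans; [apply Rmin_l|apply Rmin_r]).
assert (Hd4 : d <= eps * D / (4 * (H0 + 1))) by (unfold d; apply Rmin_r).
exists d; split; [lra|]; intros r Hr.
destruct (pow_mul_poly_small K r (Rmin 1 (eps * D / (4 * (C0 + 1))))) as [L0 HL0]; [lra| |].
{ apply Rmin_glb_lt; [lra|apply Rdiv_lt_0_compat; [now apply Rmult_lt_0_compat|lra]]. }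
exists L0; intros L x b HL Hb.
(* [e] measures the end terms that arise from cutting the series at [L]. *)
specialize (HL0 L HL); set (e := r ^ L * (2 + INR L) ^ K) in *.
assert (He1 : e <= 1) by (eapply Rle_trans; [exact HL0|apply Rmin_l]).
assert (He2 : e <= eps * D / (4 * (C0 + 1))) by (eapply Rle_trans; [exact HL0|apply Rmin_r]).
assert (HLpos := pos_INR L).
assert (He0 : 0 <= e) by (apply Rmult_le_pos; apply pow_le; lra).
set (S0 := fun b : Z -> C =>
    csum (fun n => (r * expi (- x)) ^ (S n) * b (- Z.of_nat n - 1)%Z)%C L).
set (q := 2 / (1 + r)).
assert (Hq : 0 <= q) by (apply Rmult_le_pos; [lra|left; apply Rinv_0_lt_compat; lra]).
assert (Hqr : q * (1 + r) = 2) by (unfold q; field; lra).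
assert (Hqk : q * k <= (1 + k) / 2).
{ apply Rmult_le_reg_r with (1 + r); [lra|].
  replace (q * k * (1 + r)) with (q * (1 + r) * k) by ring; rewrite Hqr; nra. }
assert (HDq : / (1 - q * k) <= / D) by (apply Rinv_le_contravar; unfold D; lra).
assert (Hqk1 : q * k < 1) by lra.
assert (Hki : forall i, 0 <= C0 * k ^ i)
  by (intros; apply Rmult_le_pos; [assumption|apply pow_le; lra]).
assert (WL : forall n, (Z.abs n <= Z.of_nat L + 1)%Z -> wt K n <= (2 + INR L) ^ K).
{ intros n Hn; eapply Rle_trans; [apply wt_le, Hn|].
  rewrite plus_IZR, <- INR_IZR_INZ; right; f_equal; ring. }
assert (bL : forall i n, (Z.abs n <= Z.of_nat L + 1)%Z ->
   Cmod (Nat.iter i (twist x) b n) <= C0 * k ^ i * (2 + INR L) ^ K).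
{ intros i n Hn; eapply Rle_trans; [apply Hb|].
  apply Rmult_le_compat_l; [apply Hki|now apply WL]. }
assert (rp : forall n, 0 <= r ^ n <= 1).
{ intros n; split; [apply pow_le; lra|rewrite <- (pow1 n); apply pow_incr; lra]. }
assert (sumb : forall i (w : nat -> C) (f : nat -> Z),
  (forall n, Cmod (w n) <= 1) -> (forall n, (n < L)%nat -> (Z.abs (f n) <= Z.of_nat L + 1)%Z) ->
  Cmod (csum (fun n => w n * Nat.iter i (twist x) b (f n))%C L)
   <= INR L * (2 + INR L) ^ K * C0 * k ^ i).
{ intros i w f Hw Hf; eapply Rle_trans; [apply Cmod_csum|].
  apply Rle_trans with (rsum (fun _ => C0 * k ^ i * (2 + INR L) ^ K) L).
  - apply rsum_le; intros n Hn; rewrite Cmod_mult.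
    rewrite <- (Rmult_1_l (C0 * k ^ i * (2 + INR L) ^ K)).
    apply Rmult_le_compat; try apply Cmod_ge_0; auto.
  - rewrite rsum_const; right; ring. }
(* The term-by-term bound, of size L (2 + L)^K, serves as a priori bound only; the resulting [H0]
   depends neither on [L] nor on [r]. *)
assert (Sx : forall i, Cmod (S0 (Nat.iter i (twist x) b)) <= H0 * k ^ i).
{ assert (X : forall i, Cmod (S0 (Nat.iter i (twist x) b))
     <= (C0 * (2 ^ K + 1)) / (1 - q * k) * k ^ i).
  { apply (recursive_bound (fun i => Cmod (S0 (Nat.iter i (twist x) b))) q k
            (C0 * (2 ^ K + 1)) (INR L * (2 + INR L) ^ K * C0));
      [assumption|lra|assumption| |].
    - intros i.
      assert (R0 : ((1 + r) * S0 (Nat.iter i (twist x) b)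
         = 2 * r * S0 (Nat.iter (S i) (twist x) b)
           + r * expi (- x) * Nat.iter i (twist x) b (-1)%Z
           - (r * expi (- x)) ^ (S L) * Nat.iter i (twist x) b (- Z.of_nat L - 1)%Z)%C)
        by exact (neg_part_twist r _ L x).
      apply (f_equal Cmod) in R0.
      rewrite <- RtoC_plus, Cmod_mult, Cmod_R, Rabs_pos_eq in R0 by lra.
      assert (T : Cmod (2 * r * S0 (Nat.iter (S i) (twist x) b)) <= 2 * Cmod (S0 (Nat.iter (S i) (twist x) b))).
      { rewrite <- RtoC_mult, Cmod_mult, Cmod_R, Rabs_pos_eq by lra.
        apply Rmult_le_compat_r; [apply Cmod_ge_0|lra]. }
      assert (T2 : Cmod (r * expi (- x) * Nat.iter i (twist x) b (-1)%Z) <= C0 * k ^ i * 2 ^ K).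
      { rewrite Cmod_mult, Cmod_mult, Cmod_expi, Cmod_R, Rabs_pos_eq by lra.
        assert (B1 := Hb i (-1)%Z).
        replace (wt K (-1)) with (2 ^ K) in B1
          by (unfold wt; rewrite Rabs_left by lra; f_equal; lra).
        assert (B2 := Cmod_ge_0 (Nat.iter i (twist x) b (-1)%Z)); nra. }
      assert (T3 : Cmod ((r * expi (- x)) ^ S L * Nat.iter i (twist x) b (- Z.of_nat L - 1)%Z)
                   <= C0 * k ^ i).
      { rewrite Cmod_mult, Cmod_abel_pow by lra.
        apply Rle_trans with (r ^ L * (C0 * k ^ i * (2 + INR L) ^ K)).
        - apply Rmult_le_compat; [apply pow_le; lra|apply Cmod_ge_0| |apply bL; lia].
          simpl; assert (R1 := rp L); nra.
        - replace (r ^ L * (C0 * k ^ i * (2 + INR L) ^ K)) with (e * (C0 * k ^ i))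
            by (unfold e; ring).
          assert (X := Hki i); nra. }
      assert (T4 : (1 + r) * Cmod (S0 (Nat.iter i (twist x) b)) <=
         2 * Cmod (S0 (Nat.iter (S i) (twist x) b)) + C0 * (2 ^ K + 1) * k ^ i).
      { rewrite R0; eapply Rle_trans; [apply Cmod_minus_le|].
        eapply Rle_trans; [apply Rplus_le_compat_r, Cmod_triangle|]; lra. }
      assert (T5 : 0 <= C0 * (2 ^ K + 1) * k ^ i) by (assert (X := Hki i); nra).
      apply Rmult_le_reg_l with (1 + r); [lra|].
      replace ((1 + r) * (q * Cmod (S0 (Nat.iter (S i) (twist x) b)) + C0 * (2 ^ K + 1) * k ^ i))
        with (q * (1 + r) * Cmod (S0 (Nat.iter (S i) (twist x) b)) + (1 + r) * (C0 * (2 ^ K + 1) * k ^ i))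
        by ring.
      rewrite Hqr; nra.
    - intros i; apply sumb; [|lia].
      intros n; rewrite Cmod_abel_pow by lra; apply rp. }
  intros i; eapply Rle_trans; [apply X|].
  apply Rmult_le_compat_r; [apply pow_le; lra|].
  unfold H0, Rdiv; apply Rmult_le_compat_l; [nra|assumption]. }
(* The first summand is the mismatch between the halves, with 1/r <= 2 and the factor 1 + r divided
   out; the second stands for the two end terms. *)
set (e1 := 2 * (1 - r) * H0 + 2 * e * C0).
assert (Px : Cmod (trig (abel r b) L x) <= e1 / (1 - q * k) * k ^ 0).
{ apply (recursive_bound (fun i => Cmod (trig (abel r (Nat.iter i (twist x) b)) L x)) q k
            e1 (2 * (INR L * (2 + INR L) ^ K * C0))) with (i := 0%nat);
      [assumption|lra|assumption| |].
  - intros i.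
    set (P0 := trig (abel r (Nat.iter i (twist x) b)) L x).
    set (P1 := trig (abel r (Nat.iter (S i) (twist x) b)) L x).
    assert (R0 : ((1 + r) * P0 - 2 * P1 = (r - / r) * S0 (Nat.iter i (twist x) b)
       + (r * expi x) ^ L * expi (- x) * Nat.iter i (twist x) b (Z.of_nat L - 1)%Z
       - / r * (r * expi (- x)) ^ (S L) * Nat.iter i (twist x) b (- Z.of_nat L - 1)%Z)%C)
      by (apply (trig_abel_twist r (Nat.iter i (twist x) b) L x); lra).
    assert (T1 : Cmod ((r - / r) * S0 (Nat.iter i (twist x) b)) <= (1 + r) * (2 * (1 - r) * H0) * k ^ i).
    { rewrite <- RtoC_inv, <- RtoC_minus, Cmod_mult, Cmod_R by lra.
      replace (r - / r) with (- ((1 + r) * (1 - r) * / r)) by (field; lra).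
      assert (Hir : 0 < / r <= 2).
      { split; [apply Rinv_0_lt_compat; lra|].
        replace 2 with (/ (1 / 2)) by field; apply Rinv_le_contravar; lra. }
      assert (A0 : 0 <= (1 + r) * (1 - r)) by nra.
      rewrite Rabs_Ropp, Rabs_pos_eq by nra.
      assert (Sxi := Sx i); assert (S1 := Cmod_ge_0 (S0 (Nat.iter i (twist x) b))).
      apply Rle_trans with ((1 + r) * (1 - r) * 2 * (H0 * k ^ i)); [|right; ring].
      apply Rmult_le_compat; try assumption; nra. }
    assert (T2 : Cmod ((r * expi x) ^ L * expi (- x) * Nat.iter i (twist x) b (Z.of_nat L - 1)%Z)
       <= e * (C0 * k ^ i)).
    { rewrite Cmod_mult, Cmod_mult, Cmod_expi, Cmod_abel_pow by lra.
      replace (e * (C0 * k ^ i)) with (r ^ L * 1 * (C0 * k ^ i * (2 + INR L) ^ K))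
            by (unfold e; ring).
      apply Rmult_le_compat_l; [rewrite Rmult_1_r; apply rp|apply bL; lia]. }
    assert (T3 : Cmod (/ r * (r * expi (- x)) ^ S L * Nat.iter i (twist x) b (- Z.of_nat L - 1)%Z)
       <= e * (C0 * k ^ i)).
    { rewrite <- RtoC_inv, Cmod_mult, Cmod_mult, Cmod_abel_pow, Cmod_R by lra.
      rewrite Rabs_pos_eq by (left; apply Rinv_0_lt_compat; lra).
      replace (/ r * r ^ S L) with (r ^ L) by (simpl; field; lra).
      replace (e * (C0 * k ^ i)) with (r ^ L * (C0 * k ^ i * (2 + INR L) ^ K))
            by (unfold e; ring).
      apply Rmult_le_compat_l; [apply rp|apply bL; lia]. }
    assert (T4 : (1 + r) * Cmod P0 <= 2 * Cmod P1 + (1 + r) * (e1 * k ^ i)).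
    { replace ((1 + r) * Cmod P0) with (Cmod ((1 + r) * P0))
        by (rewrite <- RtoC_plus, Cmod_mult, Cmod_R, Rabs_pos_eq; lra).
      replace (2 * Cmod P1) with (Cmod (2 * P1))
        by (rewrite Cmod_mult, Cmod_R, Rabs_pos_eq; lra).
      replace ((1 + r) * P0)%C with (2 * P1 + ((1 + r) * P0 - 2 * P1))%C by ring.
      eapply Rle_trans; [apply Cmod_triangle|apply Rplus_le_compat_l].
      rewrite R0; eapply Rle_trans; [apply Cmod_minus_le|].
      eapply Rle_trans; [apply Rplus_le_compat_r, Cmod_triangle|].
      assert (X : 0 <= r * (2 * (e * (C0 * k ^ i)))).
      { apply Rmult_le_pos; [lra|]; apply Rmult_le_pos; [lra|].
        apply Rmult_le_pos; [assumption|apply Hki]. }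
      unfold e1; lra. }
    apply Rmult_le_reg_l with (1 + r); [lra|].
    replace ((1 + r) * (q * Cmod P1 + e1 * k ^ i))
        with (q * (1 + r) * Cmod P1 + (1 + r) * (e1 * k ^ i)) by ring.
    rewrite Hqr; exact T4.
  - intros i; rewrite trig_abel; eapply Rle_trans; [apply Cmod_triangle|].
    replace (2 * (INR L * (2 + INR L) ^ K * C0) * k ^ i)
      with (INR L * (2 + INR L) ^ K * C0 * k ^ i + INR L * (2 + INR L) ^ K * C0 * k ^ i) by ring.
    apply Rplus_le_compat; (apply sumb; [|lia]);
      intros n; rewrite Cmod_abel_pow by lra; apply rp. }
eapply Rle_trans; [exact Px|]; simpl; rewrite Rmult_1_r.
assert (HE : e1 <= eps * D).
{ unfold e1.
  assert (A1 : (1 - r) * H0 <= eps * D / 4).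
  { apply Rle_trans with (eps * D / (4 * (H0 + 1)) * H0).
    - apply Rmult_le_compat_r; lra.
    - apply Rmult_le_reg_r with (H0 + 1); [lra|].
      replace (eps * D / (4 * (H0 + 1)) * H0 * (H0 + 1)) with (eps * D / 4 * H0) by (field; lra).
      assert (0 < eps * D) by now apply Rmult_lt_0_compat. nra. }
  assert (A2 : e * C0 <= eps * D / 4).
  { apply Rle_trans with (eps * D / (4 * (C0 + 1)) * C0).
    - apply Rmult_le_compat_r; lra.
    - apply Rmult_le_reg_r with (C0 + 1); [lra|].
      replace (eps * D / (4 * (C0 + 1)) * C0 * (C0 + 1)) with (eps * D / 4 * C0) by (field; lra).
      assert (0 < eps * D) by now apply Rmult_lt_0_compat. nra. }
  lra. }
apply Rle_trans with (eps * D / (1 - q * k)).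
- apply Rmult_le_compat_r; [left; apply Rinv_0_lt_compat; lra|assumption].
- apply Rmult_le_reg_r with (1 - q * k); [lra|].
  replace (eps * D / (1 - q * k) * (1 - q * k)) with (eps * D) by (field; lra).
  apply Rmult_le_compat_l; unfold D; lra.
Qed.

(** * Box averages of Fourier series *)

(** The factor by which averaging over the [J] translates x + j h / J acts on the n-th Fourier
    coefficient: a discrete box average of width [h]. *)
Definition kern (J : nat) (h : R) (n : Z) : C :=
  (/ INR J * csum (fun j => expi (INR j * (IZR n * h / INR J))) J)%C.

Definition smooth (J : nat) (h : R) (t : Z -> C) : Z -> C := fun n => (kern J h n * t n)%C.

Lemma Zsum_scal (c : C) u L : Zsum (fun n => c * u n)%C L = (c * Zsum u L)%C.
Proof. unfold Zsum; rewrite !csum_scal; ring. Qed.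

Lemma Zsum_ext (u v : Z -> C) L : (forall n, u n = v n) -> Zsum u L = Zsum v L.
Proof. intros H; unfold Zsum; f_equal; apply csum_ext; auto. Qed.

Lemma Zsum_csum (u : nat -> Z -> C) J L :
  Zsum (fun n => csum (fun j => u j n) J) L = csum (fun j => Zsum (u j) L) J.
Proof.
unfold Zsum; rewrite csum_plus.
now rewrite (csum_switch (fun n j => u j (Z.of_nat n))),
  (csum_switch (fun n j => u j (- Z.of_nat n - 1)%Z)).
Qed.

Lemma trig_smooth J h t L x :
  trig (smooth J h t) L x
  = (/ INR J * csum (fun j => trig t L (x + INR j * h / INR J)) J)%C.
Proof.
unfold trig, smooth, kern; rewrite <- Zsum_csum, <- Zsum_scal.
apply Zsum_ext; intros n.
rewrite <- !Cmult_assoc; f_equal; rewrite Cmult_comm, <- csum_scal.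
apply csum_ext; intros j _.
rewrite Rmult_plus_distr_l, expi_add.
replace (INR j * (IZR n * h / INR J)) with (IZR n * (INR j * h / INR J)) by (unfold Rdiv; ring).
ring.
Qed.

Lemma Cmod_average_le (u : nat -> C) J e : (0 < J)%nat ->
  (forall j, (j < J)%nat -> Cmod (u j) <= e) -> Cmod (/ INR J * csum u J)%C <= e.
Proof.
intros HJ Hu; assert (HJ' : 0 < INR J) by now apply lt_0_INR.
assert (HI : 0 < / INR J) by now apply Rinv_0_lt_compat.
rewrite Cmod_mult, <- RtoC_inv, Cmod_R, Rabs_pos_eq by lra.
apply Rmult_le_reg_l with (INR J); [assumption|].
rewrite <- Rmult_assoc, Rinv_r, Rmult_1_l, <- rsum_const by lra.
eapply Rle_trans; [apply Cmod_csum|now apply rsum_le].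
Qed.

(** All translates go to the right, by at most [h], so only the right end of the interval has to
    give way. *)
Lemma smooth_sup J h t L a b e : (0 < J)%nat -> 0 < h ->
  (forall x, a <= x <= b -> Cmod (trig t L x) <= e) ->
  forall x, a <= x <= b - h -> Cmod (trig (smooth J h t) L x) <= e.
Proof.
intros HJ Hh H x Hx; rewrite trig_smooth; apply Cmod_average_le; [assumption|].
intros j Hj; apply H.
assert (0 < INR J) by now apply lt_0_INR.
assert (INR j <= INR J) by (apply le_INR; lia).
assert (0 <= INR j) by apply pos_INR.
assert (0 <= INR j * h / INR J <= h); [|lra].
split.
- apply Rmult_le_pos; [nra|left; now apply Rinv_0_lt_compat].
- apply Rmult_le_reg_r with (INR J); [assumption|].
  replace (INR j * h / INR J * INR J) with (INR j * h) by (field; lra); nra.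
Qed.

Lemma kern_le1 J h n : (0 < J)%nat -> Cmod (kern J h n) <= 1.
Proof.
intros HJ; apply Cmod_average_le; [assumption|].
intros; rewrite Cmod_expi; lra.
Qed.

Lemma kern_sub1 J h n : (0 < J)%nat -> 0 < h -> Cmod (kern J h n - 1)%C <= Rabs (IZR n) * h.
Proof.
intros HJ Hh; assert (HJ' : 0 < INR J) by now apply lt_0_INR.
assert (HC : RtoC (INR J) <> 0%C) by (intros H; apply RtoC_inj in H; lra).
replace (kern J h n - 1)%C
  with (/ INR J * csum (fun j => expi (INR j * (IZR n * h / INR J)) - 1) J)%C.
- apply Cmod_average_le; [assumption|]; intros j Hj.
  eapply Rle_trans; [apply Cmod_expi_sub1_le|].
  assert (INR j <= INR J) by (apply le_INR; lia).
  assert (0 <= INR j) by apply pos_INR.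
  replace (INR j * (IZR n * h / INR J)) with (IZR n * h * (INR j / INR J)) by (field; lra).
  rewrite !Rabs_mult, (Rabs_pos_eq h) by lra.
  rewrite <- (Rmult_1_r (Rabs (IZR n) * h)) at 2.
  apply Rmult_le_compat_l; [apply Rmult_le_pos; [apply Rabs_pos|lra]|].
  assert (0 <= INR j / INR J) by (apply Rmult_le_pos; [assumption|left; now apply Rinv_0_lt_compat]).
  rewrite Rabs_pos_eq by assumption.
  apply Rmult_le_reg_r with (INR J); [assumption|].
  unfold Rdiv; rewrite Rmult_assoc, Rinv_l; lra.
- rewrite csum_minus, csum_const; unfold kern; field; assumption.
Qed.

(** The geometric sum is at most 2 / |e^(ix) - 1| <= 4 / |x| with x = n h / J, where |x| <= 1
    because |n| <= J and h <= 1. Hence |n| h |kern| <= 4, and |kern| <= 1 contributes the remaining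
    1 of the constant 5. *)
Lemma kern_decay J h n : (0 < J)%nat -> 0 < h <= 1 -> (Z.abs n <= Z.of_nat J)%Z ->
  Cmod (kern J h n) <= 5 / h * / (1 + Rabs (IZR n)).
Proof.
intros HJ Hh Hn; assert (HJ' : 0 < INR J) by now apply lt_0_INR.
assert (HI : 0 < / INR J) by now apply Rinv_0_lt_compat.
assert (Hn0 := Rabs_pos (IZR n)).
assert (HnJ : Rabs (IZR n) <= INR J) by (rewrite <- abs_IZR, INR_IZR_INZ; now apply IZR_le).
set (x := IZR n * h / INR J).
assert (Hx : Rabs x = Rabs (IZR n) * h * / INR J).
{ unfold x, Rdiv; now rewrite !Rabs_mult, (Rabs_pos_eq h), (Rabs_pos_eq (/ INR J)) by lra. }
assert (Hx1 : Rabs x <= 1).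
{ rewrite Hx; apply Rmult_le_reg_r with (INR J); [assumption|].
  rewrite Rmult_assoc, Rinv_l by lra; nra. }
assert (G := expi_geom x J).
assert (G2 : Rabs x / 2 * Cmod (csum (fun j => expi (INR j * x)) J) <= 2).
{ apply Rle_trans with (Cmod (expi x - 1) * Cmod (csum (fun j => expi (INR j * x)) J)).
  - apply Rmult_le_compat_r; [apply Cmod_ge_0|now apply Cmod_expi_sub1_ge].
  - rewrite <- Cmod_mult, G; eapply Rle_trans; [apply Cmod_minus_le|].
    rewrite Cmod_expi, Cmod_1; lra. }
assert (E : Cmod (kern J h n) = / INR J * Cmod (csum (fun j => expi (INR j * x)) J)).
{ unfold kern; fold x; rewrite Cmod_mult, <- RtoC_inv, Cmod_R, Rabs_pos_eq by lra; reflexivity. }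
assert (K1 := kern_le1 J h n HJ).
assert (K2 : Rabs (IZR n) * h * Cmod (kern J h n) <= 4) by (rewrite E; rewrite Hx in G2; lra).
apply Rmult_le_reg_r with (h * (1 + Rabs (IZR n))); [apply Rmult_lt_0_compat; lra|].
replace (5 / h * / (1 + Rabs (IZR n)) * (h * (1 + Rabs (IZR n)))) with 5 by (field; lra).
assert (K0 := Cmod_ge_0 (kern J h n)); nra.
Qed.

Lemma iter_smooth m J h t n : Nat.iter m (smooth J h) t n = (kern J h n ^ m * t n)%C.
Proof.
induction m as [|m IH]; [simpl; ring|].
change (Nat.iter (S m) (smooth J h) t n) with (kern J h n * Nat.iter m (smooth J h) t n)%C.
rewrite IH; simpl; ring.
Qed.

Lemma iter_smooth_sup m J h t L a b e : (0 < J)%nat -> 0 < h ->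
  (forall x, a <= x <= b -> Cmod (trig t L x) <= e) ->
  forall x, a <= x <= b - INR m * h -> Cmod (trig (Nat.iter m (smooth J h) t) L x) <= e.
Proof.
intros HJ Hh H; induction m as [|m IH].
- intros x Hx; apply H; simpl in Hx; lra.
- intros x Hx; rewrite S_INR in Hx.
  apply (smooth_sup J h (Nat.iter m (smooth J h) t) L a (b - INR m * h)); auto; lra.
Qed.

Lemma Cmod_pow_sub1 (z : C) m : Cmod z <= 1 -> Cmod (z ^ m - 1)%C <= INR m * Cmod (z - 1)%C.
Proof.
intros Hz; induction m as [|m IH].
- replace (z ^ 0 - 1)%C with (RtoC 0) by (simpl; ring); rewrite Cmod_0; simpl; lra.
- rewrite S_INR, Cpow_S.
  replace (z * z ^ m - 1)%C with (z * (z ^ m - 1) + (z - 1))%C by ring.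
  eapply Rle_trans; [apply Cmod_triangle|]; rewrite Cmod_mult.
  assert (X := Cmod_ge_0 (z ^ m - 1)%C); nra.
Qed.

Lemma rsum_inv_sq L : rsum (fun n => / (1 + INR n) ^ 2) L <= 2.
Proof.
assert (H : rsum (fun n => / (1 + INR n) ^ 2) (S L) <= 2 - / (1 + INR L)).
{ induction L as [|L IH]; [simpl; lra|].
  assert (HL := pos_INR L); cbn [rsum] in *; rewrite S_INR.
  assert (X : / (1 + (INR L + 1)) ^ 2 <= / (1 + INR L) - / (1 + (INR L + 1))).
  { replace (/ (1 + INR L) - / (1 + (INR L + 1))) with (/ ((1 + INR L) * (1 + (INR L + 1))))
      by (field; lra).
    apply Rinv_le_contravar; [apply Rmult_lt_0_compat; lra|simpl; nra]. }
  lra. }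
cbn [rsum] in H.
assert (0 < / (1 + INR L) ^ 2) by (apply Rinv_0_lt_compat, pow_lt; assert (X := pos_INR L); lra).
assert (0 < / (1 + INR L)) by (apply Rinv_0_lt_compat; assert (X := pos_INR L); lra); lra.
Qed.

(** * Finite differences of Fourier coefficients *)

Lemma iter_diff_bound (b : Z -> C) e M : forall n,
  (forall m, (n - Z.of_nat M <= m <= n)%Z -> Cmod (b m) <= e) ->
  Cmod (Nat.iter M diff b n) <= 2 ^ M * e.
Proof.
induction M as [|M IH]; intros n H.
- simpl; rewrite Rmult_1_l; apply H; lia.
- change (Nat.iter (S M) diff b n) with (Nat.iter M diff b (n - 1)%Z - Nat.iter M diff b n)%C.
  eapply Rle_trans; [apply Cmod_minus_le|].
  assert (H1 := IH (n - 1)%Z ltac:(intros; apply H; lia)).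
  assert (H2 := IH n ltac:(intros; apply H; lia)).
  simpl; lra.
Qed.

Lemma iter_diff_minus (b c : Z -> C) M : forall n,
  Nat.iter M diff (fun n => b n - c n)%C n = (Nat.iter M diff b n - Nat.iter M diff c n)%C.
Proof.
induction M as [|M IH]; intros n; [reflexivity|].
change (Nat.iter (S M) diff ?b n) with (Nat.iter M diff b (n - 1)%Z - Nat.iter M diff b n)%C.
rewrite !IH; ring.
Qed.

Lemma Zsum_delta (t : Z -> C) n L : (- Z.of_nat L <= n < Z.of_nat L)%Z ->
  Zsum (fun k => t k * (if Z.eqb (k - n) 0 then 1 else 0))%C L = t n.
Proof.
intros Hn; unfold Zsum.
destruct (Z_lt_le_dec n 0) as [H|H].
- rewrite (csum_ext _ (fun _ => 0%C)), csum_zero.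
  + rewrite (csum_single _ _ (Z.to_nat (- n - 1))); [|lia|].
    * replace (- Z.of_nat (Z.to_nat (- n - 1)) - 1)%Z with n by lia.
      rewrite Z.sub_diag; simpl; ring.
    * intros i _ Hi; destruct (Z.eqb_spec (- Z.of_nat i - 1 - n) 0); [lia|ring].
  + intros i _; destruct (Z.eqb_spec (Z.of_nat i - n) 0); [lia|ring].
- rewrite (csum_ext (fun i => t (- Z.of_nat i - 1)%Z * _)%C (fun _ => 0%C)), csum_zero.
  + rewrite (csum_single _ _ (Z.to_nat n)); [|lia|].
    * rewrite Z2Nat.id, Z.sub_diag by lia; simpl; ring.
    * intros i _ Hi; destruct (Z.eqb_spec (Z.of_nat i - n) 0); [lia|ring].
  + intros i _; destruct (Z.eqb_spec (- Z.of_nat i - 1 - n) 0); [lia|ring].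
Qed.

(** For N > 2L the frequencies from -L to L-1 are distinct modulo N, so the mean extracts a
    coefficient without aliasing. *)
Lemma mean_trig N (t : Z -> C) L n :
  (- Z.of_nat L <= n < Z.of_nat L)%Z -> (2 * L < N)%nat ->
  mean N (fun x => expi (- IZR n * x) * trig t L x)%C = t n.
Proof.
intros Hn HN; rewrite <- (Zsum_delta t n L Hn).
assert (E : forall k, (Z.abs (k - n) < Z.of_nat N)%Z ->
   mean N (fun x => expi (- IZR n * x) * (t k * expi (IZR k * x)))%C
   = (t k * (if Z.eqb (k - n) 0 then 1 else 0))%C).
{ intros k Hk; rewrite <- mean_expi with (N := N), <- mean_scal by assumption.
  apply mean_ext; intros x; rewrite minus_IZR.
  replace ((IZR k - IZR n) * x) with (- IZR n * x + IZR k * x) by ring.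
  rewrite expi_add; ring. }
unfold trig, Zsum.
rewrite (mean_ext _ _ (fun x =>
   csum (fun k => expi (- IZR n * x) * (t (Z.of_nat k) * expi (IZR (Z.of_nat k) * x))) L
   + csum (fun k => expi (- IZR n * x) * (t (- Z.of_nat k - 1)%Z * expi (IZR (- Z.of_nat k - 1) * x))) L)%C).
- rewrite mean_plus, !mean_csum; f_equal; apply csum_ext; intros i Hi; apply E; lia.
- intros x; rewrite !csum_scal; ring.
Qed.

(** The lower bound on [n] keeps all indices from n - M to n, which the difference reads, inside the
    truncation. *)
Lemma mean_trig_diff N (t : Z -> C) L M : forall n,
  (- Z.of_nat L + Z.of_nat M <= n < Z.of_nat L)%Z -> (2 * L < N)%nat ->
  mean N (fun x => (expi x - 1) ^ M * (expi (- IZR n * x) * trig t L x))%C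
  = Nat.iter M diff t n.
Proof.
induction M as [|M IH]; intros n Hn HN.
- change (Nat.iter 0 diff t n) with (t n); rewrite <- (mean_trig N t L n) by lia; apply mean_ext; intros; simpl; ring.
- change (Nat.iter (S M) diff t n) with (Nat.iter M diff t (n - 1)%Z - Nat.iter M diff t n)%C.
  rewrite <- (IH n), <- (IH (n - 1)%Z), <- mean_minus by lia.
  apply mean_ext; intros x; rewrite minus_IZR.
  replace (- (IZR n - 1) * x) with (- IZR n * x + x) by ring.
  rewrite expi_add, Cpow_S; ring.
Qed.

(** The K + 2 kernel factors beat the growth of [b] by |n|^(-2), and L <= J keeps every frequency in
    the range of [kern_decay]. Each half of the sum contributes at most 2, hence the 4. The bound is
    independent of [r], [L] and [J]. *)
Lemma trig_abel_smooth_bound J h r b L x K C0 :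
  0 <= C0 -> 0 <= r < 1 -> 0 < h <= 1 -> (0 < J)%nat -> (L <= J)%nat ->
  (forall n, Cmod (b n) <= C0 * wt K n) ->
  Cmod (trig (Nat.iter (K + 2) (smooth J h) (abel r b)) L x) <= 4 * C0 * (5 / h) ^ (K + 2).
Proof.
intros HC Hr Hh HJ HL Hb.
set (B := C0 * (5 / h) ^ (K + 2)).
assert (H5 : 0 < 5 / h) by (apply Rdiv_lt_0_compat; lra).
assert (HB : 0 <= B) by (apply Rmult_le_pos; [assumption|apply pow_le; lra]).
assert (T : forall n, (Z.abs n <= Z.of_nat J)%Z ->
  Cmod (Nat.iter (K + 2) (smooth J h) (abel r b) n * expi (IZR n * x)) <= B * / (1 + Rabs (IZR n)) ^ 2).
{ intros n Hn; assert (Hp := Rabs_pos (IZR n)).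
  rewrite Cmod_mult, Cmod_expi, Rmult_1_r, iter_smooth, Cmod_mult, Cmod_pow.
  unfold abel; rewrite Cmod_mult, Cmod_R, Rabs_pos_eq by (apply pow_le; lra).
  assert (R1 : 0 <= r ^ Z.abs_nat n <= 1).
  { split; [apply pow_le; lra|].
    rewrite <- (pow1 (Z.abs_nat n)); apply pow_incr; lra. }
  assert (K0 : Cmod (kern J h n) ^ (K + 2) <= (5 / h) ^ (K + 2) * (/ (1 + Rabs (IZR n))) ^ (K + 2)).
  { rewrite <- Rpow_mult_distr; apply pow_incr; split; [apply Cmod_ge_0|now apply kern_decay]. }
  replace (B * / (1 + Rabs (IZR n)) ^ 2) with
    ((5 / h) ^ (K + 2) * (/ (1 + Rabs (IZR n))) ^ (K + 2) * (C0 * wt K n)).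
  - apply Rmult_le_compat; [apply pow_le, Cmod_ge_0| |assumption|].
    + apply Rmult_le_pos; [lra|apply Cmod_ge_0].
    + specialize (Hb n); assert (X := Cmod_ge_0 (b n)); nra.
  - unfold B, wt; rewrite (pow_add (/ _)), !pow_inv; field.
    split; [lra|apply pow_nonzero; lra]. }
unfold trig, Zsum; eapply Rle_trans; [apply Cmod_triangle|].
replace (4 * C0 * (5 / h) ^ (K + 2)) with (B * 2 + B * 2) by (unfold B; ring).
assert (Q := rsum_inv_sq L).
apply Rplus_le_compat; (eapply Rle_trans; [apply Cmod_csum|]);
  (apply Rle_trans with (B * rsum (fun n => / (1 + INR n) ^ 2) L);
   [rewrite <- rsum_scal; apply rsum_le; intros i Hi; eapply Rle_trans; [apply T; lia|]
   |now apply Rmult_le_compat_l]);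
  apply Rmult_le_compat_l; try assumption; assert (Hi0 := pos_INR i).
- rewrite <- INR_IZR_INZ, Rabs_pos_eq; lra.
- apply Rinv_le_contravar; [apply pow_lt; lra|apply pow_incr].
  rewrite minus_IZR, opp_IZR, <- INR_IZR_INZ, <- Rabs_Ropp, Rabs_pos_eq; lra.
Qed.

(** The order of the choices matters: first the box width [h], then the Abel radius [r], adapted to
    the contraction factor that [h] provides, then the truncation [L] and the number [J] of
    translates. Four errors of eps / 4 arise: near 0, away from 0, from the Abel weights and from
    the smoothing. *)
Theorem iter_diff_eq0 (b : Z -> C) (C0 : R) (K : nat) : 0 <= C0 ->
  (forall n, Cmod (b n) <= C0 * wt K n) ->
  (forall h, 0 < h -> exists k, 0 < k < 1 /\
     forall x, h <= x <= 2 * PI - h -> forall i n,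
     Cmod (Nat.iter i (twist x) b n) <= C0 * k ^ i * wt K n) ->
  forall n, Nat.iter (K + 3) diff b n = 0%C.
Proof.
intros HC Hb Hs n0; apply Cmod_eq_0, Rle_antisym; [|apply Cmod_ge_0].
apply le_epsilon; intros eps He; rewrite Rplus_0_l.
set (m := (K + 2)%nat); set (M := (K + 3)%nat).
(* The difference at [n0] reads the indices from n0 - M to n0; they have modulus at most [N0], and
   there |b| <= B. *)
set (N0 := (Z.abs_nat n0 + M)%nat); set (B := C0 * (1 + INR N0) ^ K).
assert (HN0 := pos_INR N0); assert (Hm0 := pos_INR m).
assert (HB : 0 <= B) by (apply Rmult_le_pos; [assumption|apply pow_le; lra]).
(* Near 0 the factor (e^(ix) - 1)^M is at most ((m+1) h)^M and the smoothed series at most 4 C0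
   (5/h)^m; as M = m + 1, their product is Q h. *)
set (Q := (INR m + 1) ^ M * (4 * C0 * 5 ^ m)).
assert (HQ : 0 <= Q).
{ apply Rmult_le_pos; [apply pow_le; lra|].
  apply Rmult_le_pos; [lra|apply pow_le; lra]. }
assert (H2M : 0 < 2 ^ M) by (apply pow_lt; lra).
set (V := 2 ^ M * B * INR m * INR N0); set (V' := 2 ^ M * B * INR N0).
assert (H2B : 0 <= 2 ^ M * B) by (apply Rmult_le_pos; lra).
assert (HV : 0 <= V) by (apply Rmult_le_pos; [apply Rmult_le_pos|]; assumption).
assert (HV' : 0 <= V') by (apply Rmult_le_pos; assumption).
assert (small : forall W, 0 <= W -> exists h, 0 < h <= 1 /\ forall h', 0 <= h' <= h -> W * h' <= eps / 4).
{ intros W HW; exists (Rmin 1 (eps / (4 * (W + 1)))).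
  assert (X : 0 < eps / (4 * (W + 1))) by (apply Rdiv_lt_0_compat; lra).
  split; [split; [apply Rmin_glb_lt; lra|apply Rmin_l]|].
  intros h' Hh'; apply Rle_trans with (W * (eps / (4 * (W + 1)))).
  - apply Rmult_le_compat_l; [assumption|eapply Rle_trans; [apply Hh'|apply Rmin_r]].
  - apply Rmult_le_reg_r with (W + 1); [lra|].
    replace (W * (eps / (4 * (W + 1))) * (W + 1)) with (W * (eps / 4)) by (field; lra); nra. }
destruct (small Q HQ) as [h1 [Hh1 HQ1]]; destruct (small V HV) as [h2 [Hh2 HV1]].
destruct (small V' HV') as [h3 [Hh3 HV2]]; clear small.
set (h := Rmin h1 h2).
assert (Hh : 0 < h) by (unfold h; apply Rmin_glb_lt; lra).
assert (Hhh1 : h <= h1) by apply Rmin_l; assert (Hhh2 : h <= h2) by apply Rmin_r.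
specialize (HQ1 h ltac:(lra)); specialize (HV1 h ltac:(lra)).
destruct (Hs h Hh) as [k [Hk Hs1]].
set (e1 := eps / (4 * 2 ^ M)).
assert (He1 : 0 < e1) by (apply Rdiv_lt_0_compat; lra).
destruct (abel_small C0 k e1 K HC Hk He1) as [d [Hd Hr]].
set (r := 1 - Rmin d h3).
assert (Hmin : 0 < Rmin d h3) by (apply Rmin_glb_lt; lra).
assert (Hmd : Rmin d h3 <= d) by apply Rmin_l; assert (Hmh : Rmin d h3 <= h3) by apply Rmin_r.
specialize (HV2 (1 - r) ltac:(unfold r; lra)).
destruct (Hr r ltac:(unfold r; lra)) as [L0 HL0]; clear Hr.
assert (Hr : 0 <= r < 1) by (unfold r; lra).
set (L := (L0 + N0 + 1)%nat); set (J := (L + 1)%nat).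
assert (HJ : (0 < J)%nat) by (unfold J; lia).
set (t := Nat.iter m (smooth J h) (abel r b)).
assert (T1 : Cmod (Nat.iter M diff t n0) <= Q * h + 2 ^ M * e1).
{ rewrite <- (mean_trig_diff (2 * L + 1) t L M n0) by (unfold L, N0; lia).
  apply Cmod_mean_le; [lia|]; intros x Hx.
  rewrite !Cmod_mult, Cmod_expi, Rmult_1_l, Cmod_pow.
  assert (P2 : Cmod (expi x - 1) <= 2).
  { eapply Rle_trans; [apply Cmod_minus_le|rewrite Cmod_expi, Cmod_1; lra]. }
  assert (P0 := Cmod_ge_0 (expi x - 1)%C); assert (P1 := Cmod_ge_0 (trig t L x)).
  (* The [m] averages to the right eat up a further m h before 2 pi; the points left over are within
     (m+1) h of 0 or of 2 pi. *)
  assert (far : h <= x <= 2 * PI - h - INR m * h \/ Cmod (expi x - 1) <= (INR m + 1) * h).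
  { destruct (Rle_lt_dec h x) as [Ha|Ha]; [destruct (Rle_lt_dec x (2 * PI - h - INR m * h)) as [Hb'|Hb']|].
    - now left.
    - right; assert (E : expi x = expi (x - 2 * PI)).
      { rewrite <- (expi_period (x - 2 * PI) 1); f_equal; simpl; ring. }
      rewrite E; eapply Rle_trans; [apply Cmod_expi_sub1_le|].
      rewrite Rabs_left1; nra.
    - right; eapply Rle_trans; [apply Cmod_expi_sub1_le|]; rewrite Rabs_pos_eq; nra. }
  assert (HQh : 0 <= Q * h) by (apply Rmult_le_pos; lra).
  destruct far as [far|near].
  - apply Rle_trans with (2 ^ M * e1); [|lra].
    apply Rmult_le_compat; [now apply pow_le|assumption|apply pow_incr; lra|].
    apply (iter_smooth_sup m J h (abel r b) L h (2 * PI - h) e1); try assumption.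
    intros y Hy; apply HL0; [unfold L; lia|]; now apply Hs1.
  - apply Rle_trans with (Q * h); [|assert (0 <= 2 ^ M * e1) by (apply Rmult_le_pos; lra); lra].
    apply Rle_trans with (((INR m + 1) * h) ^ M * (4 * C0 * (5 / h) ^ m)).
    + apply Rmult_le_compat; [now apply pow_le|assumption|apply pow_incr; lra|].
      apply trig_abel_smooth_bound; try assumption; [lra|unfold J; lia].
    + right; unfold Q; replace M with (S m) by (unfold M, m; lia).
      rewrite !Rpow_mult_distr; unfold Rdiv; rewrite Rpow_mult_distr, pow_inv.
      simpl; field; apply pow_nonzero; lra. }
assert (T2 : Cmod (Nat.iter M diff (fun n => b n - t n)%C n0)
   <= 2 ^ M * (B * (INR N0 * (1 - r) + INR m * (INR N0 * h)))).
{ apply iter_diff_bound; intros n Hn.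
  assert (HnN : Rabs (IZR n) <= INR N0).
  { rewrite <- abs_IZR, INR_IZR_INZ; apply IZR_le; unfold N0; lia. }
  assert (Hnb : Cmod (b n) <= B).
  { eapply Rle_trans; [apply Hb|apply Rmult_le_compat_l; [assumption|]].
    rewrite INR_IZR_INZ; apply wt_le; unfold N0; lia. }
  unfold t; rewrite iter_smooth; unfold abel.
  set (s := r ^ Z.abs_nat n); set (w := (kern J h n ^ m)%C).
  replace (b n - w * (s * b n))%C with (- (b n * (w * (s - 1) + (w - 1))))%C by ring.
  rewrite Cmod_opp, Cmod_mult; apply Rmult_le_compat; try apply Cmod_ge_0; [assumption|].
  assert (KL := kern_le1 J h n HJ).
  assert (W1 : Cmod w <= 1).
  { unfold w; rewrite Cmod_pow, <- (pow1 m); apply pow_incr; split; [apply Cmod_ge_0|assumption]. }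
  eapply Rle_trans; [apply Cmod_triangle|apply Rplus_le_compat].
  - rewrite Cmod_mult, <- RtoC_minus, Cmod_R, Rabs_minus_sym.
    assert (S1 : 0 <= 1 - s <= INR N0 * (1 - r)).
    { split.
      - assert (s <= 1) by (unfold s; rewrite <- (pow1 (Z.abs_nat n)); apply pow_incr; lra); lra.
      - apply Rle_trans with (INR (Z.abs_nat n) * (1 - r)).
        + unfold s; generalize (Z.abs_nat n); intros p; induction p as [|p IH]; [simpl; lra|].
          rewrite S_INR; simpl; assert (r ^ p <= 1) by (rewrite <- (pow1 p); apply pow_incr; lra).
          nra.
        + apply Rmult_le_compat_r; [lra|apply le_INR; unfold N0; lia]. }
    rewrite Rabs_pos_eq by lra; assert (X := Cmod_ge_0 w); nra.
  - unfold w; eapply Rle_trans; [now apply Cmod_pow_sub1|].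
    apply Rmult_le_compat_l; [assumption|].
    eapply Rle_trans; [now apply kern_sub1|apply Rmult_le_compat_r; lra]. }
rewrite iter_diff_minus in T2.
replace (Nat.iter M diff b n0)
  with (Nat.iter M diff b n0 - Nat.iter M diff t n0 + Nat.iter M diff t n0)%C by ring.
eapply Rle_trans; [apply Cmod_triangle|].
assert (E1 : 2 ^ M * e1 = eps / 4) by (unfold e1; field; lra).
unfold V, V' in *; lra.
Qed.

(** * Taylor series of bounded functions on the disk *)

Definition csums (u : nat -> C) (l : C) : Prop :=
  forall eps, 0 < eps -> exists N, forall n, (N <= n)%nat -> Cmod (csum u n - l)%C <= eps.

Definition peval (a : nat -> C) (N : nat) (z : C) : C := csum (fun n => a n * z ^ n)%C N.

Lemma sum_n_csum (u : nat -> C) n : sum_n u n = csum u (S n).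
Proof.
induction n as [|n IH]; [rewrite sum_O; simpl; ring|].
rewrite sum_Sn, IH; reflexivity.
Qed.

Lemma is_series_csums (u : nat -> C) (l : C) :
  @is_series C_AbsRing C_NormedModule u l <-> csums u l.
Proof.
split; intros H.
- intros eps He.
  assert (H' := proj1 (@filterlim_locally_ball_norm _ C_AbsRing C_NormedModule _ _ _ _) H
                  (mkposreal eps He)).
  destruct H' as [N HN]; exists (S N); intros [|n] Hn; [lia|].
  rewrite <- sum_n_csum; left; apply (HN n); lia.
- apply (proj2 (filterlim_locally_ball_norm (F := eventually) (U := C_NormedModule) (sum_n u) l)).
  intros eps; assert (He := cond_pos eps).
  destruct (H (eps / 2)) as [N HN]; [lra|].
  exists N; intros n Hn; unfold ball_norm.
  apply Rle_lt_trans with (eps / 2); [|lra].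
  change (Cmod (sum_n u n - l)%C <= eps / 2); rewrite sum_n_csum; apply HN; lia.
Qed.

Lemma pow_n_Cpow (z : C) n : @pow_n C_Ring z n = (z ^ n)%C.
Proof. induction n as [|n IH]; [reflexivity|simpl; now rewrite IH]. Qed.

Lemma taylorE (a : nat -> C) (F : C -> C) :
  taylor_on_disk a F <-> forall z, Cmod z < 1 -> csums (fun n => a n * z ^ n)%C (F z).
Proof.
unfold taylor_on_disk; split; intros H z Hz; specialize (H z Hz);
  assert (E : (fun n => a n * @pow_n C_Ring z n)%C = (fun n => a n * z ^ n)%C)
    by (apply functional_extensionality; intros n; now rewrite pow_n_Cpow).
- apply is_series_csums in H; rewrite <- E; exact H.
- apply is_series_csums; rewrite <- E in H; exact H.
Qed.

Lemma csums_ext u v l : (forall n, u n = v n) -> csums u l -> csums v l.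
Proof. intros E H; now rewrite <- (functional_extensionality _ _ E). Qed.

Lemma csums_plus u v l m : csums u l -> csums v m -> csums (fun n => u n + v n)%C (l + m)%C.
Proof.
intros Hu Hv eps He.
destruct (Hu (eps / 2)) as [N1 H1]; [lra|]; destruct (Hv (eps / 2)) as [N2 H2]; [lra|].
exists (N1 + N2)%nat; intros n Hn; rewrite csum_plus.
replace (csum u n + csum v n - (l + m))%C with ((csum u n - l) + (csum v n - m))%C by ring.
specialize (H1 n ltac:(lia)); specialize (H2 n ltac:(lia)).
eapply Rle_trans; [apply Cmod_triangle|lra].
Qed.

Lemma csums_scal c u l : csums u l -> csums (fun n => c * u n)%C (c * l)%C.
Proof.
intros Hu eps He; assert (Hc := Cmod_ge_0 c).
destruct (Hu (eps / (Cmod c + 1))) as [N H]; [apply Rdiv_lt_0_compat; lra|].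
exists N; intros n Hn; specialize (H n Hn); rewrite csum_scal.
replace (c * csum u n - c * l)%C with (c * (csum u n - l))%C by ring; rewrite Cmod_mult.
apply Rle_trans with ((Cmod c + 1) * (eps / (Cmod c + 1))); [|right; field; lra].
apply Rmult_le_compat; try apply Cmod_ge_0; lra.
Qed.

Lemma csums_bound u l B : csums u l -> (forall n, Cmod (csum u n) <= B) -> Cmod l <= B.
Proof.
intros Hu HB; apply le_epsilon; intros eps He.
destruct (Hu eps He) as [N HN]; specialize (HN N (Nat.le_refl N)); specialize (HB N).
rewrite Cmod_minus_sym in HN.
replace l with ((l - csum u N) + csum u N)%C by ring.
eapply Rle_trans; [apply Cmod_triangle|lra].
Qed.

Lemma csums_unique u l m : csums u l -> csums u m -> l = m.
Proof.
intros Hl Hm.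
assert (H : Cmod (l - m) <= 0).
{ apply (csums_bound (fun _ => 0%C)).
  - apply (csums_ext (fun n => u n + - (1) * u n)%C); [intros; ring|].
    replace (l - m)%C with (l + - (1) * m)%C by ring.
    apply csums_plus; [|apply csums_scal]; assumption.
  - intros n; rewrite csum_zero, Cmod_0; lra. }
apply Rle_antisym in H; [|apply Cmod_ge_0].
symmetry in H; apply Cmod_eq_0 in H.
replace l with (l - m + m)%C by ring; rewrite H; ring.
Qed.

Lemma taylor_plus a b F H : taylor_on_disk a F -> taylor_on_disk b H ->
  taylor_on_disk (fun n => a n + b n)%C (fun z => F z + H z)%C.
Proof.
rewrite !taylorE; intros Ha Hb z Hz.
apply (csums_ext (fun n => a n * z ^ n + b n * z ^ n)%C); [intros; ring|].
apply csums_plus; auto.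
Qed.

Lemma taylor_scal c a F : taylor_on_disk a F ->
  taylor_on_disk (fun n => c * a n)%C (fun z => c * F z)%C.
Proof.
rewrite !taylorE; intros Ha z Hz.
apply (csums_ext (fun n => c * (a n * z ^ n))%C); [intros; ring|].
apply csums_scal; auto.
Qed.

Definition delta0 (n : nat) : C := match n with O => 1%C | _ => 0%C end.

Lemma taylor_delta0 : taylor_on_disk delta0 (fun _ => 1%C).
Proof.
apply taylorE; intros z Hz eps He; exists 1%nat; intros n Hn.
rewrite (csum_single _ _ 0); [simpl; replace (1 * 1 - 1)%C with (RtoC 0) by ring; rewrite Cmod_0; lra|lia|].
intros [|i] _ Hi; [lia|simpl; ring].
Qed.

Lemma taylor_ext a F H : taylor_on_disk a F -> (forall z, Cmod z < 1 -> F z = H z) ->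
  taylor_on_disk a H.
Proof. intros Ha E z Hz; rewrite <- E; auto. Qed.

Lemma csums_terms_bounded u l : csums u l -> exists B, forall n, Cmod (u n) <= B.
Proof.
intros H; destruct (H 1 Rlt_0_1) as [N HN].
exists (2 + rsum (fun i => Cmod (u i)) N); intros n.
assert (P := rsum_ge0 (fun i => Cmod (u i)) N (fun i => Cmod_ge_0 _)).
destruct (le_lt_dec N n) as [Hn|Hn].
- replace (u n) with ((csum u (S n) - l) - (csum u n - l))%C by (simpl; ring).
  assert (H1 := HN (S n) ltac:(lia)); assert (H2 := HN n Hn).
  eapply Rle_trans; [apply Cmod_minus_le|lra].
- assert (T := rsum_term (fun i => Cmod (u i)) N n (fun i => Cmod_ge_0 _) Hn).
  simpl in T; lra.
Qed.

(** Convergence at a radius [s] between [rho] and 1 bounds the terms there, and the passage from [s]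
    to [rho] gains the ratio rho / s. *)
Lemma taylor_geometric a F rho : taylor_on_disk a F -> 0 < rho < 1 ->
  exists B q, 0 <= B /\ 0 < q < 1 /\ forall n, Cmod (a n) * rho ^ n <= B * q ^ n.
Proof.
intros Ha Hr; set (s := (1 + rho) / 2).
assert (Hs : 0 < s < 1) by (unfold s; lra).
assert (Hs' : Cmod (RtoC s) = s) by (rewrite Cmod_R, Rabs_pos_eq; lra).
destruct (csums_terms_bounded _ _ (proj1 (taylorE a F) Ha (RtoC s) ltac:(rewrite Hs'; lra))) as [B HB].
exists B, (rho / s); repeat split.
- eapply Rle_trans; [|apply (HB 0%nat)]; apply Cmod_ge_0.
- apply Rdiv_lt_0_compat; lra.
- apply Rmult_lt_reg_r with s; [lra|].
  unfold Rdiv; rewrite Rmult_assoc, Rinv_l, Rmult_1_r, Rmult_1_l by lra; unfold s; lra.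
- intros n; specialize (HB n).
  rewrite Cmod_mult, Cmod_pow, Hs' in HB.
  replace (Cmod (a n) * rho ^ n) with (Cmod (a n) * s ^ n * (rho / s) ^ n).
  + apply Rmult_le_compat_r; [apply pow_le; left; apply Rdiv_lt_0_compat; lra|assumption].
  + rewrite Rmult_assoc, <- Rpow_mult_distr; do 2 f_equal; field; lra.
Qed.

Lemma peval_tail a rho B q z : 0 <= B -> 0 < q < 1 -> 0 <= rho ->
  (forall n, Cmod (a n) * rho ^ n <= B * q ^ n) -> Cmod z <= rho ->
  forall N m, Cmod (peval a (N + m) z - peval a N z)%C <= B * q ^ N / (1 - q) .
Proof.
intros HB Hq Hr Ha Hz N m.
assert (H : Cmod (peval a (N + m) z - peval a N z)%C <= B * q ^ N * rsum (fun i => q ^ i) m).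
{ induction m as [|m IH].
  - rewrite Nat.add_0_r; replace (peval a N z - peval a N z)%C with (RtoC 0) by ring.
    rewrite Cmod_0; simpl; lra.
  - rewrite Nat.add_succ_r; unfold peval in *; cbn [csum rsum].
    match goal with |- Cmod (?X + ?Y - ?Z)%C <= _ =>
      replace (X + Y - Z)%C with ((X - Z) + Y)%C by ring end.
    eapply Rle_trans; [apply Cmod_triangle|].
    rewrite Rmult_plus_distr_l; apply Rplus_le_compat; [assumption|].
    rewrite Rmult_assoc, <- pow_add; eapply Rle_trans; [|apply Ha].
    rewrite Cmod_mult, Cmod_pow; apply Rmult_le_compat_l; [apply Cmod_ge_0|].
    apply pow_incr; split; [apply Cmod_ge_0|assumption]. }
eapply Rle_trans; [exact H|]; apply Rmult_le_compat_l.
- apply Rmult_le_pos; [assumption|apply pow_le; lra].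
- apply rsum_geom; lra.
Qed.

Lemma taylor_tail a F rho B q z : taylor_on_disk a F -> 0 <= B -> 0 < q < 1 -> 0 <= rho < 1 ->
  (forall n, Cmod (a n) * rho ^ n <= B * q ^ n) -> Cmod z <= rho ->
  forall N, Cmod (peval a N z - F z)%C <= B / (1 - q) * q ^ N.
Proof.
intros Hf HB Hq Hr Ha Hz N; apply le_epsilon; intros eps He.
destruct (proj1 (taylorE a F) Hf z ltac:(lra) eps He) as [M HM].
specialize (HM (N + M)%nat ltac:(lia)); fold (peval a (N + M) z) in HM.
assert (T := peval_tail a rho B q z HB Hq (proj1 Hr) Ha Hz N M).
rewrite Cmod_minus_sym in T.
eapply Rle_trans; [apply (Cmod_triangle_sub _ (peval a (N + M) z))|].
replace (B / (1 - q) * q ^ N) with (B * q ^ N / (1 - q)) by (field; lra); lra.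
Qed.

(** * Cauchy products *)

Lemma toeplitzE (a f : nat -> C) n :
  toeplitz_analytic a f n = csum (fun k => a k * f (n - k)%nat)%C (S n).
Proof. exact (sum_n_csum (fun k => a k * f (n - k)%nat)%C n). Qed.

(** The triangle k + l < N is summed over l first, so that column k contains a partial sum of [b] of
    length N - k. *)
Lemma peval_toeplitz a b N z :
  peval (toeplitz_analytic a b) N z
  = csum (fun k => a k * z ^ k * peval b (N - k) z)%C N.
Proof.
induction N as [|N IH]; [reflexivity|].
unfold peval at 1; cbn [csum]; fold (peval (toeplitz_analytic a b) N z); rewrite IH.
rewrite Nat.sub_succ_l, Nat.sub_diag, toeplitzE by lia; cbn [csum]; rewrite Nat.sub_diag.
rewrite Cmult_plus_distr_r, Cplus_assoc; f_equal; [|unfold peval; simpl; ring].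
rewrite (csum_ext (fun i => a i * z ^ i * peval b (S N - i) z)%C
          (fun i => a i * z ^ i * peval b (N - i) z + z ^ N * (a i * b (N - i)%nat))%C).
- rewrite csum_plus, csum_scal; ring.
- intros i Hi; rewrite Nat.sub_succ_l by lia; unfold peval; cbn [csum].
  replace (z ^ N)%C with (z ^ i * z ^ (N - i))%C; [ring|].
  rewrite <- Cpow_add_r; f_equal; lia.
Qed.

(** With a common geometric rate q, column k of the triangle misses its limit by a multiple of q^k
    q^(N-k) = q^N. The N columns together lose N q^N, which tends to 0. *)
Lemma taylor_toeplitz a b F H : taylor_on_disk a F -> taylor_on_disk b H ->
  taylor_on_disk (toeplitz_analytic a b) (fun z => F z * H z)%C.
Proof.
intros Ha Hb; apply taylorE; intros z Hz.
set (rho := (1 + Cmod z) / 2); assert (Hz0 := Cmod_ge_0 z).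
assert (Hr : 0 < rho < 1) by (unfold rho; lra).
destruct (taylor_geometric a F rho Ha Hr) as [B1 [q1 [HB1 [Hq1 G1]]]].
destruct (taylor_geometric b H rho Hb Hr) as [B2 [q2 [HB2 [Hq2 G2]]]].
set (q := Rmax q1 q2).
assert (Hq : 0 < q < 1) by (unfold q; apply Rmax_case; lra).
assert (P1 : forall n, q1 ^ n <= q ^ n) by (intros; apply pow_incr; split; [lra|apply Rmax_l]).
assert (P2 : forall n, q2 ^ n <= q ^ n) by (intros; apply pow_incr; split; [lra|apply Rmax_r]).
assert (G1' : forall n, Cmod (a n) * rho ^ n <= B1 * q ^ n)
  by (intros n; eapply Rle_trans; [apply G1|now apply Rmult_le_compat_l]).
assert (G2' : forall n, Cmod (b n) * rho ^ n <= B2 * q ^ n)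
  by (intros n; eapply Rle_trans; [apply G2|now apply Rmult_le_compat_l]).
clear G1 G2 P1 P2.
assert (T1 := taylor_tail a F rho B1 q z Ha HB1 Hq ltac:(lra) G1' ltac:(unfold rho; lra)).
assert (T2 := taylor_tail b H rho B2 q z Hb HB2 Hq ltac:(lra) G2' ltac:(unfold rho; lra)).
assert (HD : 0 < / (1 - q)) by (apply Rinv_0_lt_compat; lra).
set (E := B1 * (B2 / (1 - q)) + B1 / (1 - q) * Cmod (H z)).
assert (HE : 0 <= E).
{ assert (X := Cmod_ge_0 (H z)); apply Rplus_le_le_0_compat;
    repeat apply Rmult_le_pos; lra. }
intros eps He.
destruct (pow_mul_poly_small 1 q (eps / (E + 1)) Hq) as [L0 HL0];
  [apply Rdiv_lt_0_compat; lra|].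
exists L0; intros N HN; specialize (HL0 N HN).
assert (HNp := pos_INR N); rewrite pow_1 in HL0.
fold (peval (toeplitz_analytic a b) N z); rewrite peval_toeplitz.
replace (csum (fun k => a k * z ^ k * peval b (N - k) z) N - F z * H z)%C
  with (csum (fun k => a k * z ^ k * (peval b (N - k) z - H z)) N
        + (peval a N z - F z) * H z)%C.
- apply Rle_trans with (INR N * (B1 * (B2 / (1 - q)) * q ^ N) + B1 / (1 - q) * q ^ N * Cmod (H z)).
  + eapply Rle_trans; [apply Cmod_triangle|apply Rplus_le_compat].
    * rewrite <- rsum_const; eapply Rle_trans; [apply Cmod_csum|apply rsum_le].
      intros k Hk; rewrite Cmod_mult.
      apply Rle_trans with (B1 * q ^ k * (B2 / (1 - q) * q ^ (N - k))).
      -- apply Rmult_le_compat; try apply Cmod_ge_0; [|apply T2].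
         eapply Rle_trans; [|apply G1']; rewrite Cmod_mult, Cmod_pow.
         apply Rmult_le_compat_l; [apply Cmod_ge_0|].
         apply pow_incr; unfold rho; lra.
      -- right; replace N with (k + (N - k))%nat at 2 by lia; rewrite pow_add; ring.
    * rewrite Cmod_mult; apply Rmult_le_compat_r; [apply Cmod_ge_0|apply T1].
  + assert (Hqn : 0 < q ^ N) by (apply pow_lt; lra).
    apply Rle_trans with (q ^ N * (2 + INR N) * E).
    * assert (A1 : 0 <= B1 * (B2 / (1 - q))) by (repeat apply Rmult_le_pos; lra).
      assert (A2 : 0 <= B1 / (1 - q) * Cmod (H z))
        by (repeat apply Rmult_le_pos; try lra; apply Cmod_ge_0).
      unfold E; revert A1 A2; generalize (B1 * (B2 / (1 - q))); intros X A1.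
      replace (B1 / (1 - q) * q ^ N * Cmod (H z)) with (q ^ N * (B1 / (1 - q) * Cmod (H z))) by ring.
      generalize (B1 / (1 - q) * Cmod (H z)); intros Y A2.
      replace (INR N * (X * q ^ N) + q ^ N * Y) with (q ^ N * (INR N * X + Y)) by ring.
      rewrite Rmult_assoc; apply Rmult_le_compat_l; nra.
    * apply Rle_trans with (eps / (E + 1) * E); [now apply Rmult_le_compat_r|].
      apply Rmult_le_reg_r with (E + 1); [lra|].
      replace (eps / (E + 1) * E * (E + 1)) with (eps * E) by (field; lra); nra.
- unfold peval at 2.
  rewrite (csum_ext (fun k => a k * z ^ k * (peval b (N - k) z - H z))%C
    (fun k => a k * z ^ k * peval b (N - k) z - H z * (a k * z ^ k))%C) by (intros; ring).
  rewrite csum_minus, csum_scal; ring.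
Qed.

(** * Discrete Parseval identity and coefficient estimates *)

Definition rmean (N : nat) (u : R -> R) : R :=
  / INR N * rsum (fun j => u (2 * PI * INR j / INR N)) N.

Lemma mean_RtoC N (u : R -> R) : (0 < N)%nat ->
  mean N (fun x => RtoC (u x)) = RtoC (rmean N u).
Proof.
intros HN; assert (0 < INR N) by now apply lt_0_INR.
unfold mean, rmean; rewrite csum_RtoC, RtoC_mult, RtoC_inv; [reflexivity|lra].
Qed.

Lemma rmean_le N (u v : R -> R) : (forall x, u x <= v x) -> rmean N u <= rmean N v.
Proof.
intros H; unfold rmean; apply Rmult_le_compat_l.
- destruct N as [|N]; [simpl; rewrite Rinv_0; lra|].
  left; apply Rinv_0_lt_compat, lt_0_INR; lia.
- apply rsum_le; auto.
Qed.

Lemma rmean_affine N (u : R -> R) c d : (0 < N)%nat ->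
  rmean N (fun x => c * u x + d) = c * rmean N u + d.
Proof.
intros HN; assert (0 < INR N) by now apply lt_0_INR.
unfold rmean; rewrite rsum_plus, rsum_scal, rsum_const; field; lra.
Qed.

Lemma parseval N (c : nat -> C) n : (0 < N)%nat -> (n <= N)%nat ->
  rmean N (fun x => Cmod (csum (fun k => c k * expi (INR k * x))%C n) ^ 2)
  = rsum (fun k => Cmod (c k) ^ 2) n.
Proof.
intros HN Hn; apply RtoC_inj; rewrite <- mean_RtoC, <- csum_RtoC by assumption.
rewrite (mean_ext _ _ (fun x => csum (fun k => csum (fun l =>
   (c k * Cconj (c l)) * expi (IZR (Z.of_nat k - Z.of_nat l) * x)) n) n)%C).
- rewrite mean_csum; apply csum_ext; intros k Hk.
  rewrite mean_csum, (csum_single _ _ k Hk).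
  + rewrite mean_scal, mean_expi, Z.sub_diag by lia; simpl Z.eqb; cbv iota.
    rewrite Cmod2_conj; ring.
  + intros l Hl Hlk; rewrite mean_scal, mean_expi by lia.
    destruct (Z.eqb_spec (Z.of_nat k - Z.of_nat l) 0); [lia|ring].
- intros x; rewrite Cmod2_conj, csum_conj, <- csum_scal.
  rewrite (csum_ext _ (fun l => csum (fun k => (c k * Cconj (c l)) *
     expi (IZR (Z.of_nat k - Z.of_nat l) * x)) n)%C).
  + apply csum_switch.
  + intros l _; rewrite Cmult_comm, <- csum_scal; apply csum_ext; intros k _.
    rewrite Cmult_conj, expi_conj, minus_IZR, <- !INR_IZR_INZ.
    replace ((INR k - INR l) * x) with (INR k * x + - (INR l * x)) by ring.
    rewrite expi_add; ring.
Qed.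

(* Parseval on the circles of radius [rho < 1], then [rho -> 1]. *)
Lemma toeplitz_energy a F h H K S : taylor_on_disk a F -> taylor_on_disk h H ->
  0 <= K -> (forall z, Cmod z < 1 -> Cmod (F z) <= K) ->
  (forall n, rsum (fun k => Cmod (h k) ^ 2) n <= S) ->
  forall n, rsum (fun k => Cmod (toeplitz_analytic a h k) ^ 2) n <= K ^ 2 * S.
Proof.
intros Ha Hh HK HF HS J.
set (p := toeplitz_analytic a h).
assert (Hp := taylor_toeplitz a h F H Ha Hh); fold p in Hp.
(* The factor [rho ^ (2 * J)] lies below all the weights rho^(2k), k < J, that Parseval puts on the
   coefficients. *)
assert (main : forall rho, 0 < rho < 1 ->
  rho ^ (2 * J) * rsum (fun k => Cmod (p k) ^ 2) J <= K ^ 2 * S).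
{ intros rho Hr.
  destruct (taylor_geometric p _ rho Hp Hr) as [B1 [q1 [HB1 [Hq1 G1]]]].
  destruct (taylor_geometric h H rho Hh Hr) as [B2 [q2 [HB2 [Hq2 G2]]]].
  assert (T1 := fun z => taylor_tail p _ rho B1 q1 z Hp HB1 Hq1 ltac:(lra) G1).
  assert (T2 := fun z => taylor_tail h H rho B2 q2 z Hh HB2 Hq2 ltac:(lra) G2).
  set (D1 := B1 / (1 - q1)) in T1; set (D2 := B2 / (1 - q2)) in T2.
  assert (HD1 : 0 <= D1) by (apply Rmult_le_pos; [lra|left; apply Rinv_0_lt_compat; lra]).
  assert (HD2 : 0 <= D2) by (apply Rmult_le_pos; [lra|left; apply Rinv_0_lt_compat; lra]).
  assert (HX : forall z N, Cmod z <= rho -> Cmod (peval h N z) <= 2 * D2).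
  { intros z N Hz; assert (A1 := T2 z Hz N); assert (A2 := T2 z Hz 0%nat).
    change (peval h 0 z) with (RtoC 0) in A2; rewrite Cmod_minus_sym in A2.
    replace (H z - 0)%C with (H z) in A2 by ring; simpl in A2.
    assert (q2 ^ N <= 1) by (rewrite <- (pow1 N); apply pow_incr; lra).
    replace (peval h N z) with (peval h N z - H z + H z)%C by ring.
    eapply Rle_trans; [apply Cmod_triangle|nra]. }
  apply le_epsilon; intros eps He.
  (* [E * e] bounds the excess of (K (y + e) + e)^2 over K^2 y^2 for 0 <= y <= 2 D2 and e <= 1,
     where y is the modulus of a partial sum of [H] and e the truncation error. *)
  set (E := 2 * K * (2 * D2) * (K + 1) + (K + 1) ^ 2).
  assert (HE : 0 <= E).
  { apply Rplus_le_le_0_compat; [|apply pow_le; lra].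
    apply Rmult_le_pos; [apply Rmult_le_pos|]; lra. }
  set (e := Rmin 1 (eps / (E + 1))).
  assert (He1 : 0 < e) by (apply Rmin_glb_lt; [lra|apply Rdiv_lt_0_compat; lra]).
  assert (He2 : e <= 1) by apply Rmin_l.
  assert (He3 : E * e <= eps).
  { apply Rle_trans with (E * (eps / (E + 1))); [apply Rmult_le_compat_l; [assumption|apply Rmin_r]|].
    apply Rmult_le_reg_r with (E + 1); [lra|].
    replace (E * (eps / (E + 1)) * (E + 1)) with (E * eps) by (field; lra); nra. }
  destruct (pow_lt_1_zero q1) with (y := e / (D1 + 1)) as [N1 HN1];
    [rewrite Rabs_pos_eq; lra|apply Rdiv_lt_0_compat; lra|].
  destruct (pow_lt_1_zero q2) with (y := e / (D2 + 1)) as [N2 HN2];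
    [rewrite Rabs_pos_eq; lra|apply Rdiv_lt_0_compat; lra|].
  set (N := (N1 + N2 + J + 1)%nat).
  assert (small : forall D q N', 0 <= D -> Rabs (q ^ N') < e / (D + 1) -> D * q ^ N' <= e).
  { intros D q N' HD Hq; assert (Y := Rle_abs (q ^ N')).
    apply Rle_trans with (D * (e / (D + 1))); [apply Rmult_le_compat_l; lra|].
    apply Rmult_le_reg_r with (D + 1); [lra|].
    replace (D * (e / (D + 1)) * (D + 1)) with (D * e) by (field; lra); nra. }
  assert (S1 := small D1 q1 N HD1 (HN1 N ltac:(unfold N; lia))).
  assert (S2 := small D2 q2 N HD2 (HN2 N ltac:(unfold N; lia))).
  clear HN1 HN2 small.
  assert (conv : forall c : nat -> C, forall x,
    peval c N (rho * expi x) = csum (fun k => (c k * rho ^ k)%C * expi (INR k * x))%C N).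
  { intros c x; apply csum_ext; intros k _.
    rewrite Cpow_mult_l, expi_pow; ring. }
  assert (pars : forall c : nat -> C,
    rmean N (fun x => Cmod (peval c N (rho * expi x)) ^ 2)
    = rsum (fun k => rho ^ (2 * k) * Cmod (c k) ^ 2) N).
  { intros c.
    replace (fun x => Cmod (peval c N (rho * expi x)) ^ 2) with
      (fun x => Cmod (csum (fun k => (c k * rho ^ k)%C * expi (INR k * x))%C N) ^ 2)
      by (apply functional_extensionality; intros x; now rewrite conv).
    rewrite parseval by (unfold N; lia); apply rsum_ext; intros k _.
    rewrite Cmod_mult, Cmod_pow, Cmod_R, Rabs_pos_eq, Rpow_mult_distr by lra.
    rewrite <- pow_mult, (Nat.mul_comm k); ring. }
  assert (pw : forall x, Cmod (peval p N (rho * expi x)) ^ 2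
     <= K ^ 2 * Cmod (peval h N (rho * expi x)) ^ 2 + E * e).
  { intros x; set (z := (rho * expi x)%C).
    assert (Hz : Cmod z = rho)
      by (unfold z; rewrite Cmod_mult, Cmod_expi, Cmod_R, Rabs_pos_eq; lra).
    assert (X1 := T1 z ltac:(lra) N); assert (X2 := T2 z ltac:(lra) N).
    assert (X3 := HX z N ltac:(lra)); specialize (HF z ltac:(lra)).
    assert (X4 := Cmod_ge_0 (peval h N z)); set (y := Cmod (peval h N z)) in *.
    assert (Y1 : Cmod (H z) <= y + e).
    { replace (H z) with (peval h N z - (peval h N z - H z))%C by ring.
      eapply Rle_trans; [apply Cmod_minus_le|unfold y; lra]. }
    assert (Y2 : Cmod (peval p N z) <= K * (y + e) + e).
    { replace (peval p N z) with (F z * H z + (peval p N z - F z * H z))%C by ring.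
      eapply Rle_trans; [apply Cmod_triangle|]; rewrite Cmod_mult.
      assert (Cmod (F z) * Cmod (H z) <= K * (y + e))
        by (apply Rmult_le_compat; try apply Cmod_ge_0; assumption).
      lra. }
    assert (Y0 := Cmod_ge_0 (peval p N z)).
    apply Rle_trans with ((K * (y + e) + e) ^ 2); [apply pow_incr; lra|].
    replace ((K * (y + e) + e) ^ 2) with
      (K ^ 2 * y ^ 2 + (2 * K * y * (K + 1) + (K + 1) ^ 2 * e) * e) by ring.
    apply Rplus_le_compat_l, Rmult_le_compat_r; [lra|]; unfold E.
    apply Rplus_le_compat.
    - apply Rmult_le_compat_r; [lra|]; apply Rmult_le_compat_l; lra.
    - assert (0 <= (K + 1) ^ 2) by (apply pow_le; lra); nra. }
  apply (rmean_le N) in pw.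
  rewrite pars, rmean_affine, pars in pw by (unfold N; lia).
  assert (rp : forall k, 0 <= rho ^ k <= 1).
  { intros k; split; [apply pow_le; lra|rewrite <- (pow1 k); apply pow_incr; lra]. }
  assert (Z1 : rsum (fun k => rho ^ (2 * k) * Cmod (h k) ^ 2) N <= S).
  { eapply Rle_trans; [|apply (HS N)]; apply rsum_le; intros k _.
    assert (0 <= Cmod (h k) ^ 2) by (apply pow_le, Cmod_ge_0).
    assert (R1 := rp (2 * k)%nat); nra. }
  assert (Z2 : rho ^ (2 * J) * rsum (fun k => Cmod (p k) ^ 2) J
     <= rsum (fun k => rho ^ (2 * k) * Cmod (p k) ^ 2) N).
  { rewrite <- rsum_scal.
    apply Rle_trans with (rsum (fun k => rho ^ (2 * k) * Cmod (p k) ^ 2) J).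
    - apply rsum_le; intros k Hk.
      apply Rmult_le_compat_r; [apply pow_le, Cmod_ge_0|].
      replace (2 * J)%nat with (2 * k + 2 * (J - k))%nat by lia; rewrite pow_add.
      assert (R1 := rp (2 * k)%nat); assert (R2 := rp (2 * (J - k))%nat); nra.
    - apply rsum_incr; [|unfold N; lia].
      intros k; apply Rmult_le_pos; [apply rp|apply pow_le, Cmod_ge_0]. }
  assert (0 <= K ^ 2) by (apply pow_le; lra); nra. }
apply le_epsilon; intros eps He.
set (X := rsum (fun k => Cmod (p k) ^ 2) J).
assert (HX : 0 <= X) by (apply rsum_ge0; intros; apply pow_le, Cmod_ge_0).
set (W := INR (2 * J) * X).
assert (HW : 0 <= W) by (apply Rmult_le_pos; [apply pos_INR|assumption]).
set (d := Rmin (1 / 2) (eps / (W + 1))).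
assert (Hd : 0 < d) by (apply Rmin_glb_lt; [lra|apply Rdiv_lt_0_compat; lra]).
assert (Hd1 : d <= 1 / 2) by apply Rmin_l.
specialize (main (1 - d) ltac:(lra)); fold X in main.
(* Bernoulli's inequality: replacing rho = 1 - d by 1 costs at most 2 J X d = W d. *)
assert (Bern : 1 - INR (2 * J) * d <= (1 - d) ^ (2 * J)).
{ generalize (2 * J)%nat; intros n; induction n as [|n IH]; [simpl; lra|].
  rewrite S_INR; simpl; assert (0 <= INR n) by apply pos_INR; nra. }
assert (Wd : W * d <= eps).
{ apply Rle_trans with (W * (eps / (W + 1))); [apply Rmult_le_compat_l; [assumption|apply Rmin_r]|].
  apply Rmult_le_reg_r with (W + 1); [lra|].
  replace (W * (eps / (W + 1)) * (W + 1)) with (W * eps) by (field; lra); nra. }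
unfold W in Wd; nra.
Qed.

Lemma toeplitz_delta0 a : toeplitz_analytic a delta0 = a.
Proof.
apply functional_extensionality; intros n; rewrite toeplitzE.
rewrite (csum_single _ _ n); [rewrite Nat.sub_diag; simpl; ring|lia|].
intros i Hi Hin; replace (n - i)%nat with (S (n - i - 1)) by lia; simpl; ring.
Qed.

(** The energy estimate for multiplication by [F], applied to the constant function 1. *)
Lemma taylor_coef_energy a F K : taylor_on_disk a F -> 0 <= K ->
  (forall z, Cmod z < 1 -> Cmod (F z) <= K) ->
  forall n, rsum (fun k => Cmod (a k) ^ 2) n <= K ^ 2.
Proof.
intros Ha HK HF n.
assert (X := toeplitz_energy a F delta0 _ K 1 Ha taylor_delta0 HK HF).
rewrite toeplitz_delta0, Rmult_1_r in X; apply X.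
intros [|m]; [simpl; lra|].
right; clear; induction m as [|m IH]; [simpl; rewrite Cmod_1; ring|].
cbn [rsum] in *; rewrite IH; simpl; rewrite Cmod_0; ring.
Qed.

Lemma taylor_coef_le a F K : taylor_on_disk a F ->
  (forall z, Cmod z < 1 -> Cmod (F z) <= K) -> forall n, Cmod (a n) <= K.
Proof.
intros Ha HF n.
assert (HK : 0 <= K) by (eapply Rle_trans; [apply Cmod_ge_0|apply (HF 0%C); rewrite Cmod_0; lra]).
assert (X := taylor_coef_energy a F K Ha HK HF (S n)).
assert (Y := rsum_term (fun k => Cmod (a k) ^ 2) (S n) n
   (fun k => pow_le _ 2 (Cmod_ge_0 (a k))) ltac:(lia)); simpl in Y.
apply Rsqr_incr_0_var; [unfold Rsqr; simpl in X|assumption]; lra.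
Qed.

Lemma taylor_minus a b F H : taylor_on_disk a F -> taylor_on_disk b H ->
  taylor_on_disk (fun n => a n - b n)%C (fun z => F z - H z)%C.
Proof.
intros Ha Hb; assert (X := taylor_plus _ _ _ _ Ha (taylor_scal (- (1))%C _ _ Hb)).
apply taylorE; intros z Hz; assert (Y := proj1 (taylorE _ _) X z Hz); cbv beta in Y.
replace (F z - H z)%C with (F z + - (1) * H z)%C by ring.
revert Y; apply csums_ext; intros; ring.
Qed.

(** The difference is bounded by 0 on the disk, so the coefficient bound kills it. This reduces
    commutation rules for Cauchy products to pointwise identities between functions. *)
Lemma taylor_unique a b F H : taylor_on_disk a F -> taylor_on_disk b H ->
  (forall z, Cmod z < 1 -> F z = H z) -> a = b.
Proof.
intros Ha Hb E; apply functional_extensionality; intros n.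
assert (X := taylor_coef_le _ _ 0 (taylor_minus _ _ _ _ Ha Hb)); cbv beta in X.
assert (Y : Cmod (a n - b n) = 0).
{ apply Rle_antisym; [apply X|apply Cmod_ge_0].
  intros z Hz; rewrite E by assumption.
  replace (H z - H z)%C with (RtoC 0) by ring; rewrite Cmod_0; lra. }
apply Cmod_eq_0 in Y; replace (a n) with (a n - b n + b n)%C by ring; rewrite Y; ring.
Qed.

(** * Cauchy sequences and uniform limits *)

Lemma Cmod_le_Re_Im (z : C) e : Rabs (Re z) <= e -> Rabs (Im z) <= e -> Cmod z <= 2 * e.
Proof.
intros H1 H2; assert (He : 0 <= e) by (eapply Rle_trans; [apply Rabs_pos|exact H1]).
apply Rsqr_incr_0_var; [|lra]; unfold Rsqr.
replace (Cmod z * Cmod z) with (Cmod z ^ 2) by ring; rewrite Cmod2_alt.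
assert (Re z ^ 2 <= e ^ 2) by (rewrite <- (pow2_abs (Re z)); apply pow_incr; split; [apply Rabs_pos|assumption]).
assert (Im z ^ 2 <= e ^ 2) by (rewrite <- (pow2_abs (Im z)); apply pow_incr; split; [apply Rabs_pos|assumption]).
nra.
Qed.

Lemma im_le_Cmod (z : C) : Rabs (Im z) <= Cmod z.
Proof. eapply Rle_trans; [apply Rmax_r|apply Rmax_Cmod]. Qed.

(** The limit inherits the rate of the sequence: every Cauchy bound valid from N on also bounds the
    distance to the limit. [taylor_uniform_limit] needs this to have one rate for all coefficients
    at once. *)
Lemma real_Cauchy_limit (u : nat -> R) :
  (forall eps, 0 < eps -> exists N, forall n m, (N <= n)%nat -> (N <= m)%nat -> Rabs (u n - u m) <= eps) ->
  exists l, forall N eps, 0 <= eps ->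
    (forall n m, (N <= n)%nat -> (N <= m)%nat -> Rabs (u n - u m) <= eps) ->
    forall n, (N <= n)%nat -> Rabs (u n - l) <= eps.
Proof.
intros Hc.
assert (Hex : ex_finite_lim_seq u).
{ apply ex_lim_seq_cauchy_corr; intros eps; assert (He := cond_pos eps).
  destruct (Hc (eps / 2)) as [N HN]; [lra|].
  exists N; intros n m Hn Hm; eapply Rle_lt_trans; [apply HN; assumption|lra]. }
destruct Hex as [l Hl]; exists l; intros N eps He HN n Hn.
apply le_epsilon; intros d Hd.
apply is_lim_seq_spec in Hl; destruct (Hl (mkposreal d Hd)) as [M HM]; simpl in HM.
specialize (HM (N + M)%nat ltac:(lia)); specialize (HN n (N + M)%nat Hn ltac:(lia)).
replace (u n - l) with ((u n - u (N + M)%nat) + (u (N + M)%nat - l)) by ring.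
eapply Rle_trans; [apply Rabs_triang|lra].
Qed.

Lemma complex_Cauchy_limit (u : nat -> C) :
  (forall eps, 0 < eps -> exists N, forall n m, (N <= n)%nat -> (N <= m)%nat -> Cmod (u n - u m)%C <= eps) ->
  exists l, forall N eps, 0 <= eps ->
    (forall n m, (N <= n)%nat -> (N <= m)%nat -> Cmod (u n - u m)%C <= eps) ->
    forall n, (N <= n)%nat -> Cmod (u n - l)%C <= 2 * eps.
Proof.
intros Hc.
assert (HRe : forall n m, Rabs (Re (u n) - Re (u m)) <= Cmod (u n - u m)%C).
{ intros n m; eapply Rle_trans; [|apply re_le_Cmod]; right; reflexivity. }
assert (HIm : forall n m, Rabs (Im (u n) - Im (u m)) <= Cmod (u n - u m)%C).
{ intros n m; eapply Rle_trans; [|apply im_le_Cmod]; right; reflexivity. }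
destruct (real_Cauchy_limit (fun n => Re (u n))) as [l1 H1].
{ intros eps He; destruct (Hc eps He) as [N HN]; exists N; intros n m Hn Hm.
  eapply Rle_trans; [apply HRe|auto]. }
destruct (real_Cauchy_limit (fun n => Im (u n))) as [l2 H2].
{ intros eps He; destruct (Hc eps He) as [N HN]; exists N; intros n m Hn Hm.
  eapply Rle_trans; [apply HIm|auto]. }
exists (l1, l2); intros N eps He HN n Hn; apply Cmod_le_Re_Im.
- apply (H1 N eps He); [|assumption]; intros; eapply Rle_trans; [apply HRe|auto].
- apply (H2 N eps He); [|assumption]; intros; eapply Rle_trans; [apply HIm|auto].
Qed.

(** Coefficients are bounded by the sup norm, hence Cauchy uniformly in their index. The lemma
    replaces the composition of power series: the exponential below is a uniform limit of
    polynomials in [W]. *)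
Lemma taylor_uniform_limit (c : nat -> nat -> C) (P : nat -> C -> C) (V : C -> C) :
  (forall N, taylor_on_disk (c N) (P N)) ->
  (forall eps, 0 < eps -> exists N0, forall N, (N0 <= N)%nat ->
     forall z, Cmod z < 1 -> Cmod (P N z - V z)%C <= eps) ->
  exists v, taylor_on_disk v V.
Proof.
intros Hc HV.
assert (cau : forall eps, 0 < eps -> exists N0, forall N M, (N0 <= N)%nat -> (N0 <= M)%nat ->
   forall n, Cmod (c N n - c M n)%C <= eps).
{ intros eps He; destruct (HV (eps / 2)) as [N0 H0]; [lra|].
  exists N0; intros N M HN HM.
  apply (taylor_coef_le _ _ eps (taylor_minus _ _ _ _ (Hc N) (Hc M))).
  intros z Hz; eapply Rle_trans; [apply (Cmod_triangle_sub _ (V z))|].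
  assert (A1 := H0 N HN z Hz); assert (A2 := H0 M HM z Hz); rewrite Cmod_minus_sym in A2; lra. }
assert (lim : forall n, exists l, forall N eps, 0 <= eps ->
    (forall M M', (N <= M)%nat -> (N <= M')%nat -> Cmod (c M n - c M' n)%C <= eps) ->
    forall M, (N <= M)%nat -> Cmod (c M n - l)%C <= 2 * eps).
{ intros n; apply (complex_Cauchy_limit (fun N => c N n)).
  intros eps He; destruct (cau eps He) as [N0 H0]; exists N0; auto. }
set (v := fun n => proj1_sig (constructive_indefinite_description _ (lim n))).
assert (Hv := fun n => proj2_sig (constructive_indefinite_description _ (lim n))).
change (forall n, forall N eps, 0 <= eps ->
    (forall M M', (N <= M)%nat -> (N <= M')%nat -> Cmod (c M n - c M' n)%C <= eps) ->
    forall M, (N <= M)%nat -> Cmod (c M n - v n)%C <= 2 * eps) in Hv.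
exists v; apply taylorE; intros z Hz eps He.
assert (Hz0 := Cmod_ge_0 z).
(* Each coefficient errs by at most 2 e, which sums up to 2 e / (1 - |z|) = eps / 3. *)
set (e := eps * (1 - Cmod z) / 6).
assert (He' : 0 < e) by (unfold e; apply Rdiv_lt_0_compat; [apply Rmult_lt_0_compat; lra|lra]).
destruct (cau e He') as [N1 H1]; destruct (HV (eps / 3)) as [N2 H2]; [lra|].
set (N := (N1 + N2)%nat).
destruct (proj1 (taylorE _ _) (Hc N) z Hz (eps / 3)) as [J HJ]; [lra|].
exists J; intros j Hj; specialize (HJ j Hj); specialize (H2 N ltac:(unfold N; lia) z Hz).
assert (X : Cmod (csum (fun n => v n * z ^ n) j - csum (fun n => c N n * z ^ n) j)%C <= eps / 3).
{ rewrite <- csum_minus; eapply Rle_trans; [apply Cmod_csum|].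
  apply Rle_trans with (2 * e * rsum (fun n => Cmod z ^ n) j).
  - rewrite <- rsum_scal; apply rsum_le; intros n _.
    replace (v n * z ^ n - c N n * z ^ n)%C with ((v n - c N n) * z ^ n)%C by ring.
    rewrite Cmod_mult, Cmod_pow; apply Rmult_le_compat_r; [now apply pow_le|].
    rewrite Cmod_minus_sym; apply (Hv n N1 e); [lra| |unfold N; lia].
    intros; now apply H1.
  - apply Rle_trans with (2 * e * / (1 - Cmod z)).
    + apply Rmult_le_compat_l; [lra|apply rsum_geom; lra].
    + right; unfold e; field; lra. }
eapply Rle_trans; [apply (Cmod_triangle_sub _ (csum (fun n => c N n * z ^ n)%C j))|].
assert (Y := Cmod_triangle_sub (csum (fun n => c N n * z ^ n)%C j) (P N z) (V z)).
lra.
Qed.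

(** * The Hardy space *)

Lemma sum_n_rsum (u : nat -> R) n : sum_n u n = rsum u (S n).
Proof.
induction n as [|n IH]; [rewrite sum_O; simpl; ring|].
rewrite sum_Sn, IH; reflexivity.
Qed.

Lemma series_pos_bounded (u : nat -> R) S : (forall n, 0 <= u n) ->
  (forall n, rsum u n <= S) -> ex_series u /\ Series u <= S.
Proof.
intros Hu HS.
assert (Hinc : forall n, sum_n u n <= sum_n u (Datatypes.S n)).
{ intros n; rewrite !sum_n_rsum; apply rsum_incr; [assumption|lia]. }
assert (Hb : forall n, sum_n u n <= S) by (intros n; rewrite sum_n_rsum; apply HS).
destruct (ex_finite_lim_seq_incr _ S Hinc Hb) as [l Hl].
assert (Hs : is_series u l) by exact Hl.
split; [now exists l|rewrite (is_series_unique _ _ Hs)].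
exact (is_lim_seq_le _ _ _ _ Hb Hl (is_lim_seq_const S)).
Qed.

Lemma rsum_le_Series (u : nat -> R) n : (forall n, 0 <= u n) -> ex_series u ->
  rsum u n <= Series u.
Proof.
intros Hu He; apply Rle_trans with (rsum u (S n)); [apply rsum_incr; [assumption|lia]|].
rewrite <- sum_n_rsum.
apply (is_lim_seq_incr_compare (sum_n u) (Series u)); [exact (Series_correct _ He)|].
intros m; rewrite !sum_n_rsum; apply rsum_incr; [assumption|lia].
Qed.

Lemma Cmod_sq_ge0 (h : nat -> C) n : 0 <= Cmod (h n) ^ 2.
Proof. apply pow_le, Cmod_ge_0. Qed.

Lemma H2_norm_ge0 h : 0 <= H2_norm h.
Proof. apply sqrt_pos. Qed.

Lemma H2_norm_sq h : is_H2 h -> H2_norm h ^ 2 = Series (fun n => Cmod (h n) ^ 2).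
Proof.
intros H; unfold H2_norm; rewrite <- Rsqr_pow2; apply Rsqr_sqrt.
exact (rsum_le_Series _ 0 (Cmod_sq_ge0 h) H).
Qed.

Lemma H2_rsum h n : is_H2 h -> rsum (fun k => Cmod (h k) ^ 2) n <= H2_norm h ^ 2.
Proof.
intros H; rewrite H2_norm_sq by assumption.
exact (rsum_le_Series _ n (Cmod_sq_ge0 h) H).
Qed.

Lemma H2_intro h S : 0 <= S -> (forall n, rsum (fun k => Cmod (h k) ^ 2) n <= S ^ 2) ->
  is_H2 h /\ H2_norm h <= S.
Proof.
intros HS H; destruct (series_pos_bounded _ _ (Cmod_sq_ge0 h) H) as [H1 H2].
split; [exact H1|unfold H2_norm; rewrite <- (sqrt_pow2 S) by assumption].
now apply sqrt_le_1_alt.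
Qed.

Lemma H2_coef h n : is_H2 h -> Cmod (h n) <= H2_norm h.
Proof.
intros H; assert (X := H2_rsum h (S n) H).
assert (Y := rsum_term _ (S n) n (Cmod_sq_ge0 h) (Nat.lt_succ_diag_r n)); simpl in Y.
apply Rsqr_incr_0_var; [unfold Rsqr; simpl in X; lra|apply H2_norm_ge0].
Qed.

Lemma H2_taylor h : is_H2 h -> exists F, taylor_on_disk h F.
Proof.
intros Hh.
assert (ex : forall z, Cmod z < 1 -> exists l, @is_series C_AbsRing C_NormedModule
   (fun n => (h n * pow_n z n)%C) l).
{ intros z Hz; apply (@ex_series_le C_AbsRing C_CompleteNormedModule _
     (fun n => H2_norm h * Cmod z ^ n)).
  - intros n; change (Cmod (h n * @pow_n C_Ring z n)%C <= H2_norm h * Cmod z ^ n).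
    rewrite pow_n_Cpow, Cmod_mult, Cmod_pow.
    apply Rmult_le_compat_r; [apply pow_le, Cmod_ge_0|now apply H2_coef].
  - apply (ex_series_scal (H2_norm h) (fun n => Cmod z ^ n)), ex_series_geom.
    rewrite Rabs_pos_eq; [assumption|apply Cmod_ge_0]. }
assert (tot : forall z, exists l, Cmod z < 1 -> @is_series C_AbsRing C_NormedModule
   (fun n => (h n * pow_n z n)%C) l).
{ intros z; destruct (Rlt_le_dec (Cmod z) 1) as [Hz|Hz].
  - destruct (ex z Hz) as [l Hl]; now exists l.
  - exists (RtoC 0); lra. }
exists (fun z => proj1_sig (constructive_indefinite_description _ (tot z))).
intros z; exact (proj2_sig (constructive_indefinite_description _ (tot z))).
Qed.

(** * Multiplication operators *)

Definition multiplier (a : nat -> C) (K : R) : Prop :=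
  exists F, taylor_on_disk a F /\ forall z, Cmod z < 1 -> Cmod (F z) <= K.

Lemma multiplier_ge0 a K : multiplier a K -> 0 <= K.
Proof.
intros [F [_ H]]; eapply Rle_trans; [apply Cmod_ge_0|].
apply (H 0%C); rewrite Cmod_0; lra.
Qed.

Lemma toeplitz_H2 a K h : multiplier a K -> is_H2 h ->
  is_H2 (toeplitz_analytic a h) /\ H2_norm (toeplitz_analytic a h) <= K * H2_norm h.
Proof.
intros Ha Hh; assert (HK := multiplier_ge0 _ _ Ha); destruct Ha as [F [Ha HF]].
destruct (H2_taylor h Hh) as [H Hh'].
assert (X := toeplitz_energy a F h H K (H2_norm h ^ 2) Ha Hh' HK HF (fun n => H2_rsum h n Hh)).
apply H2_intro; [apply Rmult_le_pos; [assumption|apply H2_norm_ge0]|].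
intros n; rewrite Rpow_mult_distr; apply X.
Qed.

Lemma iter_toeplitz_H2 a K h n : multiplier a K -> is_H2 h ->
  is_H2 (Nat.iter n (toeplitz_analytic a) h)
  /\ H2_norm (Nat.iter n (toeplitz_analytic a) h) <= K ^ n * H2_norm h.
Proof.
intros Ha Hh; assert (HK := multiplier_ge0 _ _ Ha).
induction n as [|n [IH1 IH2]]; [simpl; split; [assumption|lra]|].
destruct (toeplitz_H2 a K _ Ha IH1) as [H1 H2]; split; [exact H1|].
eapply Rle_trans; [exact H2|].
simpl; rewrite Rmult_assoc; now apply Rmult_le_compat_l.
Qed.

Lemma toeplitz_comm a b K K' h : multiplier a K -> multiplier b K' -> is_H2 h ->
  toeplitz_analytic a (toeplitz_analytic b h) = toeplitz_analytic b (toeplitz_analytic a h).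
Proof.
intros [F [Ha _]] [H [Hb _]] Hh; destruct (H2_taylor h Hh) as [X Hx].
apply (taylor_unique _ _ (fun z => F z * (H z * X z))%C (fun z => H z * (F z * X z))%C).
- apply taylor_toeplitz; [assumption|now apply taylor_toeplitz].
- apply taylor_toeplitz; [assumption|now apply taylor_toeplitz].
- intros; ring.
Qed.

Lemma iter_toeplitz_comm a b K K' h n : multiplier a K -> multiplier b K' -> is_H2 h ->
  Nat.iter n (toeplitz_analytic a) (toeplitz_analytic b h)
  = toeplitz_analytic b (Nat.iter n (toeplitz_analytic a) h).
Proof.
intros Ha Hb Hh; induction n as [|n IH]; [reflexivity|].
simpl; rewrite IH; apply (toeplitz_comm a b K K'); try assumption.
now apply (iter_toeplitz_H2 a K).
Qed.

Lemma iter_iter_toeplitz_comm a b K K' h n m : multiplier a K -> multiplier b K' -> is_H2 h ->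
  Nat.iter n (toeplitz_analytic a) (Nat.iter m (toeplitz_analytic b) h)
  = Nat.iter m (toeplitz_analytic b) (Nat.iter n (toeplitz_analytic a) h).
Proof.
intros Ha Hb Hh; induction m as [|m IH]; [reflexivity|].
simpl; rewrite (iter_toeplitz_comm a b K K'), IH; try assumption; [reflexivity|].
now apply (iter_toeplitz_H2 b K').
Qed.

Lemma toeplitz_linear_l c d (a b h : nat -> C) n :
  toeplitz_analytic (fun n => c * a n + d * b n)%C h n
  = (c * toeplitz_analytic a h n + d * toeplitz_analytic b h n)%C.
Proof.
rewrite !toeplitzE, <- !csum_scal, <- csum_plus; apply csum_ext; intros; ring.
Qed.

Lemma toeplitz_comm_seq (a h : nat -> C) F H : taylor_on_disk a F -> taylor_on_disk h H ->
  toeplitz_analytic a h = toeplitz_analytic h a.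
Proof.
intros Ha Hh.
apply (taylor_unique _ _ _ _ (taylor_toeplitz _ _ _ _ Ha Hh) (taylor_toeplitz _ _ _ _ Hh Ha)).
intros; ring.
Qed.

Lemma toeplitz_id h : is_H2 h -> toeplitz_analytic delta0 h = h.
Proof.
intros Hh; destruct (H2_taylor h Hh) as [X Hx].
rewrite (toeplitz_comm_seq _ _ _ _ taylor_delta0 Hx); apply toeplitz_delta0.
Qed.

(** * The inner product *)

Lemma Cauchy_Schwarz_rsum (x y : nat -> R) n :
  rsum (fun i => x i * y i) n ^ 2 <= rsum (fun i => x i ^ 2) n * rsum (fun i => y i ^ 2) n.
Proof.
induction n as [|n IH]; [simpl; lra|]; cbn [rsum].
assert (Hp : 0 <= rsum (fun i => x i ^ 2) n) by (apply rsum_ge0; intros; apply pow2_ge_0).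
assert (Hq : 0 <= rsum (fun i => y i ^ 2) n) by (apply rsum_ge0; intros; apply pow2_ge_0).
revert Hp Hq IH; generalize (rsum (fun i => x i ^ 2) n) (rsum (fun i => y i ^ 2) n)
  (rsum (fun i => x i * y i) n) (x n) (y n); intros p q r s t Hp Hq H.
assert (X : 2 * r * (s * t) <= p * t ^ 2 + q * s ^ 2).
{ assert (Hs := pow2_ge_0 s); assert (Ht := pow2_ge_0 t).
  assert (0 <= p * t ^ 2) by now apply Rmult_le_pos.
  assert (0 <= q * s ^ 2) by now apply Rmult_le_pos.
  apply Rsqr_incr_0_var; [|lra]; rewrite !Rsqr_pow2.
  assert (Y : (s * t) ^ 2 * r ^ 2 <= (s * t) ^ 2 * (p * q))
    by (apply Rmult_le_compat_l; [apply pow2_ge_0|assumption]).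
  assert (Z := pow2_ge_0 (p * t ^ 2 - q * s ^ 2)); nra. }
nra.
Qed.

Lemma rsum_mul_le (x y : nat -> R) n A B : 0 <= A -> 0 <= B ->
  rsum (fun i => x i ^ 2) n <= A ^ 2 -> rsum (fun i => y i ^ 2) n <= B ^ 2 ->
  rsum (fun i => x i * y i) n <= A * B.
Proof.
intros HA HB Hx Hy; apply Rsqr_incr_0_var; [|now apply Rmult_le_pos].
rewrite !Rsqr_pow2, Rpow_mult_distr; eapply Rle_trans; [apply Cauchy_Schwarz_rsum|].
apply Rmult_le_compat; try assumption; apply rsum_ge0; intros; apply pow2_ge_0.
Qed.

Lemma Cmod_csum_inner_le (h f : nat -> C) n A B : 0 <= A -> 0 <= B ->
  rsum (fun i => Cmod (h i) ^ 2) n <= A ^ 2 -> rsum (fun i => Cmod (f i) ^ 2) n <= B ^ 2 ->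
  Cmod (csum (fun i => h i * Cconj (f i))%C n) <= A * B.
Proof.
intros HA HB Hh Hf; eapply Rle_trans; [apply Cmod_csum|].
rewrite (rsum_ext _ (fun i => Cmod (h i) * Cmod (f i)))
  by (intros; now rewrite Cmod_mult, Cmod_conj).
now apply rsum_mul_le.
Qed.

Lemma is_series_rsum (u : nat -> R) l : is_series u l ->
  forall eps, 0 < eps -> exists N, forall n, (N <= n)%nat -> Rabs (rsum u n - l) <= eps.
Proof.
intros H eps He; change (is_lim_seq (sum_n u) l) in H; apply is_lim_seq_spec in H.
destruct (H (mkposreal eps He)) as [N HN]; exists (S N); intros [|n] Hn; [lia|].
rewrite <- sum_n_rsum; left; apply HN; lia.
Qed.

Lemma csum_Re (u : nat -> C) n : Re (csum u n) = rsum (fun i => Re (u i)) n.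
Proof. induction n as [|n IH]; [reflexivity|simpl; rewrite <- IH; reflexivity]. Qed.

Lemma csum_Im (u : nat -> C) n : Im (csum u n) = rsum (fun i => Im (u i)) n.
Proof. induction n as [|n IH]; [reflexivity|simpl; rewrite <- IH; reflexivity]. Qed.

Lemma H2_inner_csums h f : is_H2 h -> is_H2 f ->
  csums (fun n => h n * Cconj (f n))%C (H2_inner h f).
Proof.
intros Hh Hf.
assert (dom : forall n, Cmod (h n * Cconj (f n))%C <= Cmod (h n) ^ 2 + Cmod (f n) ^ 2).
{ intros n; rewrite Cmod_mult, Cmod_conj.
  assert (X := pow2_ge_0 (Cmod (h n) - Cmod (f n))).
  assert (Y := Cmod_ge_0 (h n)); assert (Z := Cmod_ge_0 (f n)); nra. }
assert (exs : ex_series (fun n => Cmod (h n) ^ 2 + Cmod (f n) ^ 2)) by now apply (ex_series_plus (V := R_NormedModule)).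
assert (eR : ex_series (fun n => Re (h n * Cconj (f n))%C)).
{ apply (ex_series_le (V := R_CompleteNormedModule) _ (fun n => Cmod (h n) ^ 2 + Cmod (f n) ^ 2)); [|assumption].
  intros n; eapply Rle_trans; [apply re_le_Cmod|apply dom]. }
assert (eI : ex_series (fun n => Im (h n * Cconj (f n))%C)).
{ apply (ex_series_le (V := R_CompleteNormedModule) _ (fun n => Cmod (h n) ^ 2 + Cmod (f n) ^ 2)); [|assumption].
  intros n; eapply Rle_trans; [apply im_le_Cmod|apply dom]. }
intros eps He.
destruct (is_series_rsum _ _ (Series_correct _ eR) (eps / 2)) as [N1 H1]; [lra|].
destruct (is_series_rsum _ _ (Series_correct _ eI) (eps / 2)) as [N2 H2]; [lra|].
exists (N1 + N2)%nat; intros n Hn.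
replace eps with (2 * (eps / 2)) by field; apply Cmod_le_Re_Im.
- specialize (H1 n ltac:(lia)); rewrite <- csum_Re in H1; exact H1.
- specialize (H2 n ltac:(lia)); rewrite <- csum_Im in H2; exact H2.
Qed.

Lemma H2_inner_le h f : is_H2 h -> is_H2 f -> Cmod (H2_inner h f) <= H2_norm h * H2_norm f.
Proof.
intros Hh Hf; apply (csums_bound _ _ _ (H2_inner_csums h f Hh Hf)).
intros n; apply Cmod_csum_inner_le; try apply H2_norm_ge0; now apply H2_rsum.
Qed.

Lemma H2_inner_linear c d (h k : nat -> C) f : is_H2 h -> is_H2 k ->
  is_H2 (fun n => c * h n + d * k n)%C -> is_H2 f ->
  H2_inner (fun n => c * h n + d * k n)%C f = (c * H2_inner h f + d * H2_inner k f)%C.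
Proof.
intros Hh Hk Hhk Hf; apply (csums_unique _ _ _ (H2_inner_csums _ _ Hhk Hf)).
apply (csums_ext (fun n => c * (h n * Cconj (f n)) + d * (k n * Cconj (f n)))%C);
  [intros; ring|].
apply csums_plus; apply csums_scal; now apply H2_inner_csums.
Qed.

Lemma H2_inner_scal c (h : nat -> C) f : is_H2 h -> is_H2 (fun n => c * h n)%C -> is_H2 f ->
  H2_inner (fun n => c * h n)%C f = (c * H2_inner h f)%C.
Proof.
intros Hh Hc Hf; apply (csums_unique _ _ _ (H2_inner_csums _ _ Hc Hf)).
apply (csums_ext (fun n => c * (h n * Cconj (f n)))%C); [intros; ring|].
apply csums_scal; now apply H2_inner_csums.
Qed.

Lemma H2_scal c h : is_H2 h -> is_H2 (fun n => c * h n)%C.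
Proof.
intros Hh; apply (H2_intro _ (Cmod c * H2_norm h));
  [apply Rmult_le_pos; [apply Cmod_ge_0|apply H2_norm_ge0]|].
intros n; rewrite (rsum_ext _ (fun k => Cmod c ^ 2 * Cmod (h k) ^ 2))
  by (intros; rewrite Cmod_mult; ring).
rewrite rsum_scal, Rpow_mult_distr; apply Rmult_le_compat_l; [apply pow2_ge_0|now apply H2_rsum].
Qed.

Lemma H2_inner_self f : is_H2 f -> H2_inner f f = 0%C -> f = (fun _ => RtoC 0).
Proof.
intros Hf H; apply functional_extensionality; intros n; apply Cmod_eq_0.
assert (X : rsum (fun k => Cmod (f k) ^ 2) (S n) <= 0).
{ apply (f_equal Re) in H; simpl in H.
  replace 0 with (Series (fun k => Cmod (f k) ^ 2)).
  - apply rsum_le_Series; [apply Cmod_sq_ge0|assumption].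
  - rewrite <- H; apply Series_ext; intros k.
    rewrite Cmod2_alt; simpl; unfold Re, Im; ring. }
assert (Y := rsum_term _ (S n) n (Cmod_sq_ge0 f) (Nat.lt_succ_diag_r n)); simpl in Y, X.
assert (Z := Cmod_ge_0 (f n)); nra.
Qed.

(** Cutting [f] at some N leaves a tail of small norm, paired with sequences of norm at most [B],
    and finitely many coordinates, each of which contributes a null sequence. *)
Lemma H2_inner_weak_null (c : nat -> nat -> C) B f : is_H2 f -> 0 <= B ->
  (forall j n, rsum (fun k => Cmod (c j k) ^ 2) n <= B ^ 2) ->
  (forall n eps, 0 < eps -> exists J, forall j, (J <= j)%nat -> Cmod (c j n) <= eps) ->
  forall eps, 0 < eps -> exists J, forall j, (J <= j)%nat -> Cmod (H2_inner (c j) f) <= eps.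
Proof.
intros Hf HB Hc Hn eps He.
set (d := eps / (2 * (B + 1))).
assert (Hd : 0 < d) by (apply Rdiv_lt_0_compat; lra).
destruct (is_series_rsum _ _ (Series_correct _ Hf) (d ^ 2)) as [N HN]; [now apply pow_lt|].
specialize (HN N (Nat.le_refl N)).
set (f' := fun n => if le_lt_dec N n then f n else RtoC 0).
assert (Hf' : is_H2 f' /\ H2_norm f' <= d).
{ apply H2_intro; [lra|]; intros n.
  apply Rle_trans with (rsum (fun k => Cmod (f k) ^ 2) (N + n) - rsum (fun k => Cmod (f k) ^ 2) N).
  - apply Rle_trans with (rsum (fun k => Cmod (f' k) ^ 2) (N + n)).
    + apply rsum_incr; [intros; apply Cmod_sq_ge0|lia].
    + induction n as [|n IH].
      * rewrite Nat.add_0_r, Rminus_diag.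
        rewrite (rsum_ext _ (fun _ => 0)), rsum_const; [lra|].
        intros i Hi; unfold f'; destruct (le_lt_dec N i); [lia|].
        rewrite Cmod_0; ring.
      * rewrite Nat.add_succ_r; cbn [rsum].
        unfold f' at 2; destruct (le_lt_dec N (N + n)); [lra|lia].
  - assert (X := rsum_le_Series _ (N + n) (Cmod_sq_ge0 f) Hf).
    apply Rabs_le_between in HN; lra. }
destruct Hf' as [Hf' Hnf'].
assert (head : exists J, forall j, (J <= j)%nat ->
   Cmod (csum (fun n => c j n * Cconj (f n))%C N) <= eps / 2).
{ assert (HP : forall P eps', 0 < eps' -> exists J, forall j, (J <= j)%nat ->
   Cmod (csum (fun n => c j n * Cconj (f n))%C P) <= eps').
  { induction P as [|P IH]; intros e' He'.
    - exists 0%nat; intros; simpl; rewrite Cmod_0; lra.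
    - destruct (IH (e' / 2)) as [J1 H1]; [lra|].
      assert (X := Cmod_ge_0 (f P)).
      destruct (Hn P (e' / (2 * (Cmod (f P) + 1)))) as [J2 H2]; [apply Rdiv_lt_0_compat; lra|].
      exists (J1 + J2)%nat; intros j Hj; cbn [csum].
      specialize (H1 j ltac:(lia)); specialize (H2 j ltac:(lia)).
      eapply Rle_trans; [apply Cmod_triangle|]; rewrite Cmod_mult, Cmod_conj.
      assert (Y : Cmod (c j P) * Cmod (f P) <= e' / 2).
      { apply Rle_trans with (e' / (2 * (Cmod (f P) + 1)) * (Cmod (f P) + 1)).
        - apply Rmult_le_compat; try apply Cmod_ge_0; lra.
        - right; field; lra. }
      lra. }
  apply HP; lra. }
destruct head as [J HJ]; exists J; intros j Hj; specialize (HJ j Hj).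
assert (Hcj : is_H2 (c j) /\ H2_norm (c j) <= B) by (apply H2_intro; auto).
destruct Hcj as [Hcj HcB].
assert (E : H2_inner (c j) f = (csum (fun n => c j n * Cconj (f n)) N + H2_inner (c j) f')%C).
{ apply (csums_unique _ _ _ (H2_inner_csums _ _ Hcj Hf)).
  intros e' He'; destruct (H2_inner_csums _ _ Hcj Hf' e' He') as [M HM].
  exists (N + M)%nat; intros n Hnn; specialize (HM n ltac:(lia)).
  replace (csum (fun k => c j k * Cconj (f k)) n)%C
    with (csum (fun k => c j k * Cconj (f k)) N + csum (fun k => c j k * Cconj (f' k)) n)%C.
  - replace (csum (fun k => c j k * Cconj (f k)) N + csum (fun k => c j k * Cconj (f' k)) n
      - (csum (fun n0 => c j n0 * Cconj (f n0)) N + H2_inner (c j) f'))%C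
      with (csum (fun k => c j k * Cconj (f' k)) n - H2_inner (c j) f')%C by ring; assumption.
  - replace n with (N + (n - N))%nat by lia; generalize (n - N)%nat; intros p.
    assert (Cc0 : Cconj (RtoC 0) = RtoC 0) by (apply injective_projections; simpl; ring).
    induction p as [|p IH].
    + rewrite Nat.add_0_r, (csum_ext (fun k => c j k * Cconj (f' k))%C (fun _ => 0%C)), csum_zero; [ring|].
      intros i Hi; unfold f'; destruct (le_lt_dec N i); [lia|rewrite Cc0; ring].
    + rewrite Nat.add_succ_r; cbn [csum]; rewrite <- IH.
      unfold f' at 2; destruct (le_lt_dec N (N + p)); [ring|lia]. }
rewrite E; eapply Rle_trans; [apply Cmod_triangle|].
assert (Y : Cmod (H2_inner (c j) f') <= eps / 2).
{ eapply Rle_trans; [now apply H2_inner_le|].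
  apply Rle_trans with ((B + 1) * d); [|right; unfold d; field; lra].
  apply Rmult_le_compat; try apply H2_norm_ge0; lra. }
lra.
Qed.

(** * The exponential *)

Lemma cexp_add x y : cexp (x + y)%C = (cexp x * cexp y)%C.
Proof.
unfold cexp; destruct x as [a b], y as [c d]; unfold Re, Im; cbn [fst snd Cplus].
rewrite exp_plus, cos_plus, sin_plus; apply injective_projections; simpl; ring.
Qed.

Lemma cexp_0 : cexp 0%C = 1%C.
Proof.
unfold cexp, Re, Im, RtoC; cbn [fst snd]; rewrite exp_0, cos_0, sin_0.
apply injective_projections; simpl; ring.
Qed.

Lemma cexp_mul_nat n x : cexp (INR n * x)%C = (cexp x ^ n)%C.
Proof.
induction n as [|n IH].
- replace (INR 0 * x)%C with (RtoC 0) by (simpl; ring); apply cexp_0.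
- rewrite S_INR, RtoC_plus, Cpow_S, <- IH, <- cexp_add; f_equal; ring.
Qed.

Lemma Cmod_cexp x : Cmod (cexp x) = exp (Re x).
Proof.
replace (cexp x) with (exp (Re x) * expi (Im x))%C.
- rewrite Cmod_mult, Cmod_expi, Cmod_R, Rabs_pos_eq; [ring|left; apply exp_pos].
- unfold cexp, expi; apply injective_projections; simpl; ring.
Qed.

Lemma exp_monotone x y : x <= y -> exp x <= exp y.
Proof. intros [H| ->]; [left; now apply exp_increasing|right; reflexivity]. Qed.

Lemma exp_pow_nat x n : exp x ^ n = exp (INR n * x).
Proof.
induction n as [|n IH]; [simpl; now rewrite Rmult_0_l, exp_0|].
rewrite S_INR; simpl; rewrite IH, <- exp_plus; f_equal; ring.
Qed.

(** The upper bound is 1 + t <= e^t at t = -x, inverted: e^x <= 1 / (1 - x). *)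
Lemma exp_quadratic x : Rabs x <= 1 / 2 -> 0 <= exp x - 1 - x <= 2 * x ^ 2.
Proof.
intros Hx; apply Rabs_le_between in Hx; assert (H := exp_ineq1_le x); split; [lra|].
assert (H' := exp_ineq1_le (- x)); rewrite exp_Ropp in H'.
assert (P := exp_pos x).
assert (Y : exp x * (1 + - x) <= 1).
{ apply Rle_trans with (exp x * / exp x); [apply Rmult_le_compat_l; lra|right; field; lra]. }
assert (Q := pow2_ge_0 x).
assert (Z : 1 <= (1 + x + 2 * x ^ 2) * (1 + - x)) by nra.
assert (exp x <= 1 + x + 2 * x ^ 2); [|lra].
apply Rmult_le_reg_r with (1 + - x); lra.
Qed.

Lemma sin_quadratic y : Rabs y <= 1 / 2 -> Rabs (sin y - y) <= y ^ 2.
Proof.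
assert (P : forall y, 0 <= y <= 1 / 2 -> Rabs (sin y - y) <= y ^ 2).
{ intros x Hx; assert (B := PI2_1).
  destruct (SIN x) as [H _]; [lra|lra|].
  unfold sin_lb, sin_approx, sin_term in H; simpl in H.
  assert (U := Rabs_sin_le x); rewrite (Rabs_pos_eq x) in U by lra.
  assert (V := Rle_abs (sin x)).
  assert (0 <= x ^ 2 <= 1 / 4) by (simpl; nra).
  assert (0 <= x ^ 3 <= x ^ 2) by (simpl; nra).
  assert (0 <= x ^ 5) by (apply pow_le; lra).
  assert (0 <= x ^ 7 <= x ^ 5) by (replace (x ^ 7) with (x ^ 5 * x ^ 2) by ring; nra).
  apply Rabs_le; simpl in *; nra. }
intros Hy; apply Rabs_le_between in Hy; destruct (Rle_lt_dec 0 y) as [H|H]; [apply P; lra|].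
rewrite <- Rabs_Ropp.
replace (- (sin y - y)) with (sin (- y) - - y) by (rewrite sin_neg; ring).
replace (y ^ 2) with ((- y) ^ 2) by ring; apply P; lra.
Qed.

Lemma cexp_quadratic (h : C) : Cmod h <= 1 / 2 -> Cmod (cexp h - 1 - h)%C <= 6 * Cmod h ^ 2.
Proof.
intros Hh; assert (Hx := re_le_Cmod h); assert (Hy := im_le_Cmod h).
assert (E := Cmod2_alt h); rewrite E.
replace (6 * (Re h ^ 2 + Im h ^ 2)) with (2 * (3 * (Re h ^ 2 + Im h ^ 2))) by ring.
assert (Hx' : Rabs (Re h) <= 1 / 2) by lra; assert (Hy' : Rabs (Im h) <= 1 / 2) by lra.
destruct h as [x y]; unfold Re, Im in *; cbn [fst snd] in *; clear E Hh Hx Hy.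
assert (X := exp_quadratic x Hx'); assert (Y := sin_quadratic y Hy').
assert (X2 := pow2_ge_0 x); assert (Y2 := pow2_ge_0 y).
assert (ex2 : 0 < exp x <= 2).
{ apply Rabs_le_between in Hx'; split; [apply exp_pos|nra]. }
assert (cosb : 0 <= 1 - cos y <= y ^ 2).
{ assert (H3 := cos_2a_sin (y / 2)); replace (2 * (y / 2)) with y in H3 by field.
  assert (S1 := Rabs_sin_le (y / 2)).
  assert (S2 : sin (y / 2) ^ 2 <= (y / 2) ^ 2).
  { rewrite <- (pow2_abs (sin (y / 2))), <- (pow2_abs (y / 2)); apply pow_incr; split; [apply Rabs_pos|assumption]. }
  assert (S3 := pow2_ge_0 (sin (y / 2))); simpl in S2, S3; simpl; lra. }
apply Cmod_le_Re_Im.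
- change (Rabs (exp x * cos y + - (1) + - x) <= 3 * (x ^ 2 + y ^ 2)).
  replace (exp x * cos y + - (1) + - x) with ((exp x - 1 - x) - exp x * (1 - cos y)) by ring.
  assert (0 <= exp x * (1 - cos y) <= 2 * y ^ 2) by nra.
  apply Rabs_le; lra.
- change (Rabs (exp x * sin y + - 0 + - y) <= 3 * (x ^ 2 + y ^ 2)).
  replace (exp x * sin y + - 0 + - y) with ((exp x - 1) * sin y + (sin y - y)) by ring.
  eapply Rle_trans; [apply Rabs_triang|]; rewrite Rabs_mult.
  assert (S1 := Rabs_sin_le y).
  assert (E1 : Rabs (exp x - 1) <= 2 * Rabs x).
  { assert (Hab := pow2_abs x); assert (Habs := Rabs_pos x).
    assert (x ^ 2 <= Rabs x / 2) by (rewrite <- Hab; simpl; nra).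
    replace (exp x - 1) with ((exp x - 1 - x) + x) by ring.
    eapply Rle_trans; [apply Rabs_triang|].
    rewrite (Rabs_pos_eq (exp x - 1 - x)) by lra; lra. }
  assert (Rabs (exp x - 1) * Rabs (sin y) <= 2 * Rabs x * Rabs y)
    by (apply Rmult_le_compat; try apply Rabs_pos; assumption).
  assert (AG := pow2_ge_0 (Rabs x - Rabs y)).
  rewrite <- (pow2_abs x), <- (pow2_abs y) in *; simpl in *; lra.
Qed.

Lemma Cmod_pow_diff (x y : C) r N : 1 <= r -> Cmod x <= r -> Cmod y <= r ->
  Cmod (x ^ N - y ^ N)%C <= INR N * r ^ N * Cmod (x - y)%C.
Proof.
intros Hr Hx Hy; induction N as [|N IH].
- replace (x ^ 0 - y ^ 0)%C with (RtoC 0) by (simpl; ring); rewrite Cmod_0; simpl; lra.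
- rewrite !Cpow_S, S_INR.
  replace (x * x ^ N - y * y ^ N)%C with (x * (x ^ N - y ^ N) + (x - y) * y ^ N)%C by ring.
  eapply Rle_trans; [apply Cmod_triangle|]; rewrite !Cmod_mult, Cmod_pow.
  assert (D := Cmod_ge_0 (x - y)%C).
  assert (R0 : 1 <= r ^ N) by now apply pow_R1_Rle.
  assert (Yp : Cmod y ^ N <= r ^ N) by (apply pow_incr; split; [apply Cmod_ge_0|assumption]).
  assert (T1 : Cmod x * Cmod (x ^ N - y ^ N)%C <= r * (INR N * r ^ N * Cmod (x - y)%C))
    by (apply Rmult_le_compat; try apply Cmod_ge_0; assumption).
  assert (T2 : Cmod (x - y)%C * Cmod y ^ N <= Cmod (x - y)%C * (r * r ^ N))
    by (apply Rmult_le_compat_l; nra).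
  simpl; lra.
Qed.

(** With h = -W / N the two terms are N-th powers of 1 + h and e^h, which differ by at most 6 |h|^2.
    Telescoping the powers costs N (1 + M/N)^N <= N e^M; the sign of [Re W] gives |e^h| <= 1, and 2M
    <= N gives |h| <= 1/2. *)
Lemma cexp_Euler (W : C) M N : Cmod W <= M -> 0 <= Re W -> (0 < N)%nat -> 2 * M <= INR N ->
  Cmod ((1 - / INR N * W) ^ N - cexp (- W))%C <= 6 * M ^ 2 * exp M * / INR N.
Proof.
intros HW HR HN HMN; assert (HN' : 0 < INR N) by now apply lt_0_INR.
assert (HI : 0 < / INR N) by now apply Rinv_0_lt_compat.
assert (HM : 0 <= M) by (eapply Rle_trans; [apply Cmod_ge_0|exact HW]).
assert (HC : RtoC (INR N) <> 0%C) by (intros H; apply RtoC_inj in H; lra).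
set (h := (- (/ INR N * W))%C).
assert (Hh : Cmod h = / INR N * Cmod W).
{ unfold h; rewrite Cmod_opp, Cmod_mult, <- RtoC_inv, Cmod_R, Rabs_pos_eq; lra. }
assert (Hh2 : Cmod h <= / INR N * M) by (rewrite Hh; apply Rmult_le_compat_l; lra).
assert (Hh3 : / INR N * M <= 1 / 2).
{ apply Rmult_le_reg_l with (INR N); [assumption|].
  rewrite <- Rmult_assoc, Rinv_r; lra. }
assert (E : cexp (- W)%C = (cexp h ^ N)%C).
{ rewrite <- cexp_mul_nat; f_equal; unfold h; field; assumption. }
replace (1 - / INR N * W)%C with (1 + h)%C by (unfold h; ring).
assert (Hr : 1 <= 1 + / INR N * M) by (assert (0 <= / INR N * M) by (apply Rmult_le_pos; lra); lra).
assert (Q : Cmod (1 + h - cexp h)%C <= 6 * (/ INR N * M) ^ 2).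
{ rewrite Cmod_minus_sym.
  replace (cexp h - (1 + h))%C with (cexp h - 1 - h)%C by ring.
  eapply Rle_trans; [apply cexp_quadratic; lra|].
  apply Rmult_le_compat_l; [lra|apply pow_incr; split; [apply Cmod_ge_0|assumption]]. }
rewrite E; eapply Rle_trans; [apply (Cmod_pow_diff _ _ (1 + / INR N * M)); [assumption| |]|].
- eapply Rle_trans; [apply Cmod_triangle|rewrite Cmod_1; lra].
- rewrite Cmod_cexp; apply Rle_trans with 1; [|assumption].
  rewrite <- exp_0; apply exp_monotone; unfold h.
  rewrite <- RtoC_inv by lra; simpl.
  unfold Re in HR; assert (0 <= / INR N * fst W) by (apply Rmult_le_pos; lra).
  replace (- (/ INR N * fst W - 0 * snd W)) with (- (/ INR N * fst W)) by ring; lra.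
- assert (Pe : (1 + / INR N * M) ^ N <= exp M).
  { apply Rle_trans with (exp (/ INR N * M) ^ N).
    - apply pow_incr; split; [lra|apply exp_ineq1_le].
    - rewrite exp_pow_nat; right; f_equal; field; lra. }
  apply Rle_trans with (INR N * exp M * (6 * (/ INR N * M) ^ 2)); [|right; field; lra].
  apply Rmult_le_compat; try apply Cmod_ge_0; try assumption.
  + apply Rmult_le_pos; [lra|apply pow_le; lra].
  + apply Rmult_le_compat_l; lra.
Qed.

Lemma taylor_pow a F n : taylor_on_disk a F ->
  taylor_on_disk (Nat.iter n (toeplitz_analytic a) delta0) (fun z => F z ^ n)%C.
Proof.
intros Ha; induction n as [|n IH]; [exact taylor_delta0|].
apply (taylor_toeplitz _ _ _ _ Ha IH).
Qed.

Lemma taylor_exp_opp w W M : taylor_on_disk w W ->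
  (forall z, Cmod z < 1 -> Cmod (W z) <= M /\ 0 <= Re (W z)) ->
  exists v, taylor_on_disk v (fun z => cexp (- W z)%C).
Proof.
intros Hw HW.
assert (HM : 0 <= M).
{ eapply Rle_trans; [apply Cmod_ge_0|apply (HW 0%C); rewrite Cmod_0; lra]. }
apply (taylor_uniform_limit
  (fun N => Nat.iter N (toeplitz_analytic (fun n => delta0 n + (- / INR N) * w n)%C) delta0)
  (fun N z => (1 + (- / INR N) * W z) ^ N)%C).
- intros N; apply taylor_pow, taylor_plus; [exact taylor_delta0|now apply taylor_scal].
- intros eps He.
  set (E := 6 * M ^ 2 * exp M).
  assert (HE : 0 <= E).
  { unfold E; apply Rmult_le_pos; [apply Rmult_le_pos; [lra|apply pow_le; lra]|left; apply exp_pos]. }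
  destruct (archimed_cor1 (eps / (E + 1))) as [N1 [H1 H1']]; [apply Rdiv_lt_0_compat; lra|].
  destruct (INR_unbounded (2 * M)) as [N2 H2].
  exists (N1 + N2)%nat; intros N HN z Hz.
  assert (HN1 : 0 < INR N1) by now apply lt_0_INR.
  assert (HNN : INR N1 <= INR N) by (apply le_INR; lia).
  assert (HNN2 : INR N2 <= INR N) by (apply le_INR; lia).
  replace (1 + (- / INR N) * W z)%C with (1 - / INR N * W z)%C by ring.
  eapply Rle_trans; [apply (cexp_Euler (W z) M N); [apply HW, Hz|apply HW, Hz|lia|lra]|].
  fold E; apply Rle_trans with (E * (eps / (E + 1))).
  + apply Rmult_le_compat_l; [assumption|].
    apply Rle_trans with (/ INR N1); [now apply Rinv_le_contravar|lra].
  + apply Rmult_le_reg_r with (E + 1); [lra|].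
    replace (E * (eps / (E + 1)) * (E + 1)) with (E * eps) by (field; lra); nra.
Qed.

(** * Functionals of polynomial growth under a multiplier *)

Local Notation T := toeplitz_analytic.

(** The functions g^n h for all integers n, with [v] in the role of 1/g. *)
Definition orbit (g v h : nat -> C) (n : Z) : nat -> C :=
  if Z_lt_le_dec n 0 then Nat.iter (Z.to_nat (- n)) (T v) h
  else Nat.iter (Z.to_nat n) (T g) h.

Definition affine (al be : C) (v : nat -> C) : nat -> C :=
  fun n => (al * delta0 n + be * v n)%C.

Lemma affine_multiplier al be v V K : taylor_on_disk v V ->
  (forall z, Cmod z < 1 -> Cmod (al + be * V z)%C <= K) -> multiplier (affine al be v) K.
Proof.
intros Hv HV; exists (fun z => al * 1 + be * V z)%C; split.
- apply taylor_plus; apply taylor_scal; [apply taylor_delta0|assumption].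
- intros z Hz; rewrite Cmult_1_r; auto.
Qed.

Lemma toeplitz_affine al be v h : is_H2 h ->
  T (affine al be v) h = (fun n => al * h n + be * T v h n)%C.
Proof.
intros Hh; apply functional_extensionality; intros n; unfold affine.
rewrite toeplitz_linear_l, toeplitz_id; auto.
Qed.

Section Vanishing.

Variables (g v : nat -> C) (G V : C -> C) (Kg : R).
Hypotheses (Hg : taylor_on_disk g G) (Hv : taylor_on_disk v V).
Hypotheses (HG : forall z, Cmod z < 1 -> Cmod (G z) <= Kg)
  (HV : forall z, Cmod z < 1 -> Cmod (V z) <= 1)
  (HGV : forall z, Cmod z < 1 -> (V z * G z)%C = 1%C).

Let Mg : multiplier g Kg := ex_intro _ G (conj Hg HG).
Let Mv : multiplier v 1 := ex_intro _ V (conj Hv HV).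

Lemma affine_bounded al be : exists K, multiplier (affine al be v) K.
Proof.
exists (Cmod al + Cmod be); apply (affine_multiplier _ _ _ V); [assumption|].
intros z Hz; eapply Rle_trans; [apply Cmod_triangle|]; rewrite Cmod_mult.
assert (X := HV z Hz); assert (Y := Cmod_ge_0 be); nra.
Qed.

Lemma toeplitz_inverse h : is_H2 h -> T v (T g h) = h.
Proof.
intros Hh; destruct (H2_taylor h Hh) as [X Hx].
apply (taylor_unique _ _ (fun z => V z * (G z * X z))%C X).
- apply taylor_toeplitz; [assumption|now apply taylor_toeplitz].
- assumption.
- intros z Hz; rewrite Cmult_assoc, HGV by assumption; ring.
Qed.

Lemma orbit_H2 h n : is_H2 h -> is_H2 (orbit g v h n).
Proof.
intros Hh; unfold orbit; destruct (Z_lt_le_dec n 0).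
- now apply (iter_toeplitz_H2 v 1).
- now apply (iter_toeplitz_H2 g Kg).
Qed.

Lemma orbit_pred h n : is_H2 h -> orbit g v h (n - 1)%Z = T v (orbit g v h n).
Proof.
intros Hh; unfold orbit; destruct (Z_lt_le_dec (n - 1) 0) as [H1|H1];
  destruct (Z_lt_le_dec n 0) as [H2|H2]; try lia.
- replace (Z.to_nat (- (n - 1))) with (S (Z.to_nat (- n))) by lia; reflexivity.
- replace n with 0%Z by lia; reflexivity.
- replace (Z.to_nat n) with (S (Z.to_nat (n - 1))) by lia; simpl.
  symmetry; apply toeplitz_inverse; now apply (iter_toeplitz_H2 g Kg).
Qed.

Variables (f : nat -> C).
Hypothesis Hf : is_H2 f.

(** Multiplication by [v] lowers the index of the orbit by one, so a combination of identity and
    shift on the sequence is a multiplier inside the inner product. The pair (1/2, e^(-ix)/2) gives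
    [twist x], the pair (-1, 1) gives [diff]. *)
Lemma iter_affine_inner al be (op : (Z -> C) -> Z -> C) h : is_H2 h ->
  (forall b n, op b n = (al * b n + be * b (n - 1)%Z)%C) ->
  forall i n, Nat.iter i op (fun n => H2_inner (orbit g v h n) f) n
  = H2_inner (Nat.iter i (T (affine al be v)) (orbit g v h n)) f.
Proof.
intros Hh Hop; destruct (affine_bounded al be) as [K Ma].
induction i as [|i IH]; intros n; [reflexivity|].
change (Nat.iter (S i) op ?b n) with (op (Nat.iter i op b) n).
rewrite Hop, !IH, orbit_pred by assumption.
rewrite (iter_toeplitz_comm _ v K 1) by (try assumption; now apply orbit_H2).
set (Z := Nat.iter i (T (affine al be v)) (orbit g v h n)).
assert (HZ : is_H2 Z) by (apply (iter_toeplitz_H2 _ K); [assumption|now apply orbit_H2]).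
change (Nat.iter (S i) (T (affine al be v)) (orbit g v h n)) with (T (affine al be v) Z).
assert (HT := proj1 (toeplitz_H2 _ _ Z Ma HZ)).
rewrite toeplitz_affine in * by assumption.
symmetry; apply H2_inner_linear; try assumption; now apply (toeplitz_H2 v 1).
Qed.

Variables (K : nat) (C0 : R).
Hypotheses (HC0 : 0 <= C0)
  (growth : forall n h, is_H2 h ->
     Cmod (H2_inner (Nat.iter n (T g) h) f) <= C0 * (1 + INR n) ^ K * H2_norm h)
  (contr : forall e, 0 < e -> exists k, 0 < k < 1 /\ forall x, e <= x <= 2 * PI - e ->
     forall z, Cmod z < 1 -> Cmod (1 + expi (- x) * V z)%C <= 2 * k).

Let d := affine (- (1))%C 1%C v.

Lemma iter_sub1_annihilated h : is_H2 h ->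
  H2_inner (Nat.iter (K + 3) (T d) h) f = 0%C.
Proof.
intros Hh; set (b := fun n => H2_inner (orbit g v h n) f).
assert (X : Nat.iter (K + 3) diff b 0%Z = 0%C);
  [|unfold b, d in *; rewrite (iter_affine_inner (- (1))%C 1%C diff) in X; try assumption;
    intros; unfold diff; ring].
set (C1 := (C0 + H2_norm f) * H2_norm h).
assert (Nh := H2_norm_ge0 h); assert (Nf := H2_norm_ge0 f).
(* The multiplier commutes with the orbit. For n < 0 powers of [v] do not increase the norm and
   Cauchy-Schwarz is enough; for n >= 0 the growth hypothesis is applied to a^i h in place of h,
   which produces the factor k^i. *)
assert (main : forall a k i n, 0 <= k -> multiplier a k ->
   Cmod (H2_inner (Nat.iter i (T a) (orbit g v h n)) f) <= C1 * k ^ i * wt K n).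
{ intros a k i n Hk Ma.
  assert (Hki : 0 <= k ^ i) by now apply pow_le.
  assert (Hw : 1 <= wt K n) by (apply pow_R1_Rle; assert (X := Rabs_pos (IZR n)); lra).
  destruct (iter_toeplitz_H2 a k h i Ma Hh) as [HY1 HY2].
  unfold orbit; destruct (Z_lt_le_dec n 0) as [Hn|Hn].
  - rewrite (iter_iter_toeplitz_comm _ v k 1) by assumption.
    destruct (iter_toeplitz_H2 v 1 _ (Z.to_nat (- n)) Mv HY1) as [H1 H2].
    rewrite pow1, Rmult_1_l in H2.
    eapply Rle_trans; [now apply H2_inner_le|].
    apply Rle_trans with (k ^ i * H2_norm h * H2_norm f).
    + apply Rmult_le_compat_r; [assumption|lra].
    + assert (A0 : 0 <= k ^ i * H2_norm h) by now apply Rmult_le_pos.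
      assert (A1 : 0 <= k ^ i * H2_norm h * H2_norm f) by now apply Rmult_le_pos.
      assert (A2 : 0 <= k ^ i * H2_norm h * C0) by now apply Rmult_le_pos.
      replace (C1 * k ^ i * wt K n) with
        ((k ^ i * H2_norm h * H2_norm f + k ^ i * H2_norm h * C0) * wt K n) by (unfold C1; ring).
      nra.
  - rewrite (iter_iter_toeplitz_comm _ g k Kg) by assumption.
    eapply Rle_trans; [now apply growth|].
    assert (Ew : wt K n = (1 + INR (Z.to_nat n)) ^ K).
    { unfold wt; rewrite INR_IZR_INZ, Z2Nat.id, Rabs_pos_eq by (try apply IZR_le; assumption); reflexivity. }
    rewrite <- Ew.
    apply Rle_trans with (C0 * wt K n * (k ^ i * H2_norm h)).
    + apply Rmult_le_compat_l; [|assumption]; apply Rmult_le_pos; lra.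
    + assert (A0 : 0 <= k ^ i * H2_norm h) by now apply Rmult_le_pos.
      assert (A1 : 0 <= wt K n * (k ^ i * H2_norm h)) by (apply Rmult_le_pos; lra).
      replace (C1 * k ^ i * wt K n) with ((C0 + H2_norm f) * (wt K n * (k ^ i * H2_norm h)))
        by (unfold C1; ring).
      rewrite Rmult_assoc; apply Rmult_le_compat_r; lra. }
apply (iter_diff_eq0 b C1 K).
- apply Rmult_le_pos; lra.
- intros n; assert (Y := main v 1 0%nat n Rle_0_1 Mv); simpl in Y; unfold b; lra.
- intros e He; destruct (contr e He) as [k [Hk Hc]]; exists k; split; [assumption|].
  intros x Hx i n; unfold b.
  rewrite (iter_affine_inner (/ 2)%C (/ 2 * expi (- x))%C (twist x)); try assumption;
    [|intros; unfold twist; field; exact two_neq0].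
  apply main; [lra|]; apply (affine_multiplier _ _ _ V); [assumption|].
  intros z Hz; replace (/ 2 + / 2 * expi (- x) * V z)%C with (/ 2 * (1 + expi (- x) * V z))%C by ring.
  rewrite <- RtoC_inv, Cmod_mult, Cmod_R, Rabs_pos_eq by lra.
  specialize (Hc x Hx z Hz); lra.
Qed.

Hypothesis HV0 : V 0%C <> 1%C.

Lemma csum_shift (u : nat -> C) n : csum u (S n) = (u 0%nat + csum (fun i => u (S i)) n)%C.
Proof.
induction n as [|n IH]; [simpl; ring|].
change (csum u (S (S n))) with (csum u (S n) + u (S n))%C; rewrite IH; simpl; ring.
Qed.

Lemma taylor_near0 a F B : taylor_on_disk a F -> (forall n, Cmod (a n) <= B) ->
  forall z, Cmod z <= 1 / 2 -> Cmod (F z - a 0%nat)%C <= 2 * B * Cmod z.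
Proof.
intros Ha HB z Hz; assert (Hz0 := Cmod_ge_0 z).
assert (HB0 : 0 <= B) by (eapply Rle_trans; [apply Cmod_ge_0|apply (HB 0%nat)]).
assert (HS : csums (fun n => a (S n) * z ^ S n)%C (F z - a 0%nat)%C).
{ intros e He; destruct (proj1 (taylorE a F) Ha z ltac:(lra) e He) as [N HN].
  exists N; intros n Hn; specialize (HN (S n) ltac:(lia)).
  rewrite csum_shift in HN; eapply Rle_trans; [|exact HN]; right; f_equal; simpl; ring. }
apply (csums_bound _ _ _ HS); intros n.
eapply Rle_trans; [apply Cmod_csum|].
apply Rle_trans with (B * Cmod z * rsum (fun i => Cmod z ^ i) n).
- rewrite <- rsum_scal; apply rsum_le; intros i _.
  rewrite Cmod_mult, Cmod_pow; simpl; rewrite Rmult_assoc.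
  apply Rmult_le_compat_r; [apply Rmult_le_pos; [assumption|now apply pow_le]|apply HB].
- assert (X := rsum_geom (Cmod z) n ltac:(lra)).
  assert (Y : / (1 - Cmod z) <= / (1 / 2)) by (apply Rinv_le_contravar; lra).
  replace (/ (1 / 2)) with 2 in Y by field.
  assert (0 <= B * Cmod z) by now apply Rmult_le_pos. nra.
Qed.

Lemma taylor_dilate a F rho : 0 <= rho <= 1 -> taylor_on_disk a F ->
  taylor_on_disk (fun n => rho ^ n * a n)%C (fun z => F (rho * z)%C).
Proof.
intros Hr Ha; apply taylorE; intros z Hz; assert (Hz0 := Cmod_ge_0 z).
apply (csums_ext (fun n => a n * (rho * z) ^ n)%C); [intros n; rewrite Cpow_mult_l; ring|].
apply (proj1 (taylorE a F) Ha).
rewrite Cmod_mult, Cmod_R, Rabs_pos_eq by lra; nra.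
Qed.

(** Strict convexity of the disk: the expression is the midpoint of 1 and [w]. *)
Lemma Cmod_half_add1_lt (w : C) : Cmod w <= 1 -> w <> 1%C -> Cmod (/ 2 + / 2 * w)%C < 1.
Proof.
intros Hw Hn; destruct (Rlt_le_dec (Cmod (/ 2 + / 2 * w)%C) 1) as [H|H]; [assumption|exfalso].
apply Hn; rewrite <- RtoC_inv in H by lra.
assert (H2 := Cmod2_alt (RtoC (/ 2) + RtoC (/ 2) * w)%C); assert (W2 := Cmod2_alt w).
assert (W3 : Cmod w ^ 2 <= 1) by (rewrite <- (pow1 2); apply pow_incr; split; [apply Cmod_ge_0|assumption]).
assert (H3 : 1 <= Cmod (RtoC (/ 2) + RtoC (/ 2) * w)%C ^ 2) by (rewrite <- (pow1 2); apply pow_incr; lra).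
destruct w as [x y]; unfold Re, Im in *; simpl in *.
assert (x = 1) by nra; subst x.
assert (y = 0) by nra; subst y; reflexivity.
Qed.

(* With [y = (1 + v)/2], the relation [phi((v - 1) Z) = 0] gives [phi(Z) = phi(y^j Z)],
   and [y^j Z] tends weakly to [0] since [|y| < 1] on the disk. *)
Lemma annihilated_descent M :
  (forall h, is_H2 h -> H2_inner (Nat.iter (S M) (T d) h) f = 0%C) ->
  forall h, is_H2 h -> H2_inner (Nat.iter M (T d) h) f = 0%C.
Proof.
intros HM h0 Hh0.
destruct (affine_bounded (- (1))%C 1%C) as [Kd Md]; fold d in Md.
set (y := affine (/ 2)%C (/ 2)%C v).
assert (h2 : Cmod (/ 2)%C = / 2) by (rewrite <- RtoC_inv, Cmod_R, Rabs_pos_eq; lra).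
assert (My : multiplier y 1).
{ apply (affine_multiplier _ _ _ V); [assumption|]; intros z Hz.
  eapply Rle_trans; [apply Cmod_triangle|]; rewrite Cmod_mult, h2.
  assert (X := HV z Hz); lra. }
set (Z0 := Nat.iter M (T d) h0).
assert (HZ0 : is_H2 Z0) by now apply (iter_toeplitz_H2 d Kd).
assert (HdZ : forall h, is_H2 h -> H2_inner (T d (Nat.iter M (T d) h)) f = 0%C) by exact HM.
(* Since y = 1 + (v - 1)/2 and y^j Z0 = (v - 1)^M y^j h0, one more factor y adds half of (v -
   1)^(M+1) y^j h0, which the hypothesis annihilates. *)
assert (step : forall j, H2_inner (Nat.iter j (T y) Z0) f = H2_inner Z0 f).
{ induction j as [|j IH]; [reflexivity|rewrite <- IH].
  destruct (iter_toeplitz_H2 y 1 h0 j My Hh0) as [Hj _].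
  set (W := Nat.iter M (T d) (Nat.iter j (T y) h0)).
  assert (HW : is_H2 W) by now apply (iter_toeplitz_H2 d Kd).
  assert (E : Nat.iter (S j) (T y) (Nat.iter M (T d) h0) = T y W).
  { unfold W; rewrite <- (iter_iter_toeplitz_comm y d 1 Kd) by assumption; reflexivity. }
  unfold Z0; rewrite E, (iter_iter_toeplitz_comm y d 1 Kd) by assumption; fold W.
  assert (HTW := proj1 (toeplitz_H2 d Kd W Md HW)).
  assert (HyW := proj1 (toeplitz_H2 y 1 W My HW)).
  assert (E2 : T y W = (fun n => 1 * W n + / 2 * T d W n)%C).
  { unfold y, d; rewrite !toeplitz_affine by assumption.
    apply functional_extensionality; intros n; field; exact two_neq0. }
  rewrite E2 in *; rewrite H2_inner_linear by assumption.
  unfold W at 2; rewrite HdZ by assumption; ring. }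
destruct (H2_taylor Z0 HZ0) as [FZ HFZ].
set (Y := fun z => (/ 2 * 1 + / 2 * V z)%C).
assert (Hy : taylor_on_disk y Y)
  by (apply taylor_plus; apply taylor_scal; [apply taylor_delta0|assumption]).
assert (Hyj : forall j, taylor_on_disk (Nat.iter j (T y) Z0) (fun z => Y z ^ j * FZ z)%C).
{ induction j as [|j IH].
  - apply (taylor_ext _ _ _ HFZ); intros; simpl; ring.
  - apply (taylor_ext _ _ _ (taylor_toeplitz _ _ _ _ Hy IH)); intros; rewrite Cpow_S; ring. }
assert (Hv1 := taylor_coef_le v V 1 Hv HV).
assert (Hv0 : v 0%nat = V 0%C).
{ assert (X := taylor_near0 v V 1 Hv Hv1 0%C); rewrite Cmod_0 in X.
  assert (X0 : Cmod (V 0%C - v 0%nat)%C = 0) by (apply Rle_antisym; [lra|apply Cmod_ge_0]).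
  apply Cmod_eq_0 in X0; replace (V 0%C) with (V 0%C - v 0%nat + v 0%nat)%C by ring; rewrite X0; ring. }
assert (Hz0' : Cmod (RtoC 0) < 1) by (rewrite Cmod_0; lra).
assert (q0 := Cmod_half_add1_lt (V 0%C) (HV _ Hz0') HV0).
(* The coefficients of V are at most 1, so |V z - V 0| <= 2 |z| near 0 and |Y z| <= |Y 0| + rho = q
   < 1 for |z| <= rho. *)
set (q := (1 + Cmod (/ 2 + / 2 * V 0%C)%C) / 2).
set (rho := (1 - Cmod (/ 2 + / 2 * V 0%C)%C) / 2).
assert (P0 := Cmod_ge_0 (/ 2 + / 2 * V 0%C)%C).
assert (Hrho : 0 < rho <= 1 / 2) by (unfold rho; lra).
assert (HY : forall z, Cmod z <= rho -> Cmod (Y z) <= q).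
{ intros z Hz; assert (X := taylor_near0 v V 1 Hv Hv1 z ltac:(lra)); rewrite Hv0 in X.
  replace (Y z) with ((/ 2 + / 2 * V 0%C) + / 2 * (V z - V 0%C))%C by (unfold Y; ring).
  eapply Rle_trans; [apply Cmod_triangle|]; rewrite (Cmod_mult (/ 2)), h2.
  unfold q, rho in *; lra. }
set (B := H2_norm Z0); assert (HB : 0 <= B) by apply H2_norm_ge0.
assert (HFZb : forall z, Cmod z <= rho -> Cmod (FZ z) <= 2 * B).
{ intros z Hz; assert (Hz0 := Cmod_ge_0 z).
  assert (X := taylor_near0 Z0 FZ B HFZ (fun n => H2_coef Z0 n HZ0) z ltac:(lra)).
  assert (X0 := H2_coef Z0 0 HZ0); fold B in X0.
  replace (FZ z) with (FZ z - Z0 0%nat + Z0 0%nat)%C by ring.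
  eapply Rle_trans; [apply Cmod_triangle|nra]. }
apply Cmod_eq_0, Rle_antisym; [|apply Cmod_ge_0].
apply le_epsilon; intros eps He; rewrite Rplus_0_l.
destruct (H2_inner_weak_null (fun j => Nat.iter j (T y) Z0) B f Hf HB) with (eps := eps) as [J HJ];
  [| |assumption|rewrite <- (step J); now apply HJ].
- intros j n; destruct (iter_toeplitz_H2 y 1 Z0 j My HZ0) as [H1 H2].
  rewrite pow1, Rmult_1_l in H2; eapply Rle_trans; [now apply H2_rsum|].
  apply pow_incr; split; [apply H2_norm_ge0|assumption].
- intros n e He'.
  assert (Hrn : 0 < rho ^ n) by now apply pow_lt.
  assert (Hq1 : 0 <= q < 1) by (unfold q; lra).
  destruct (pow_lt_1_zero q) with (y := e * rho ^ n / (2 * B + 1)) as [J HJ];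
    [rewrite Rabs_pos_eq; lra|apply Rdiv_lt_0_compat; [now apply Rmult_lt_0_compat|lra]|].
  exists J; intros j Hj; specialize (HJ j Hj).
  assert (Hqj : 0 <= q ^ j) by (apply pow_le; lra); rewrite Rabs_pos_eq in HJ by assumption.
  (* Decay on a small disk around 0 controls every coefficient: the loss is rho^(-n), fixed while j
     grows. *)
  assert (X := taylor_coef_le _ _ (q ^ j * (2 * B)) (taylor_dilate _ _ rho ltac:(lra) (Hyj j))).
  cbv beta in X; specialize (X ltac:(
    intros z Hz; assert (Hz' : Cmod (rho * z)%C <= rho) by
      (rewrite Cmod_mult, Cmod_R, Rabs_pos_eq by lra; nra);
    rewrite Cmod_mult, Cmod_pow; apply Rmult_le_compat;
      [apply pow_le, Cmod_ge_0|apply Cmod_ge_0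
      |apply pow_incr; split; [apply Cmod_ge_0|now apply HY]|now apply HFZb]) n).
  rewrite Cmod_mult, <- RtoC_pow, Cmod_R, Rabs_pos_eq in X by lra.
  apply Rmult_le_reg_l with (rho ^ n); [assumption|].
  eapply Rle_trans; [exact X|].
  apply Rle_trans with (e * rho ^ n / (2 * B + 1) * (2 * B)).
  + apply Rmult_le_compat_r; lra.
  + apply Rmult_le_reg_r with (2 * B + 1); [lra|].
    replace (e * rho ^ n / (2 * B + 1) * (2 * B) * (2 * B + 1)) with (rho ^ n * e * (2 * B)) by (field; lra).
    apply Rmult_le_compat_l; [apply Rmult_le_pos|]; lra.
Qed.

(** The factors v - 1 are removed one at a time; when none is left, h = f gives <f, f> = 0. *)
Theorem growth_implies_zero : f = (fun _ => RtoC 0).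
Proof.
assert (X : forall M h, is_H2 h -> H2_inner (Nat.iter (K + 3 - M) (T d) h) f = 0%C).
{ induction M as [|M IH]; intros h Hh.
  - rewrite Nat.sub_0_r; now apply iter_sub1_annihilated.
  - destruct (le_lt_dec (K + 3) M) as [HM|HM].
    + replace (K + 3 - S M)%nat with (K + 3 - M)%nat by lia; auto.
    + apply annihilated_descent; [|assumption].
      replace (S (K + 3 - S M)) with (K + 3 - M)%nat by lia; exact IH. }
apply H2_inner_self; [assumption|].
specialize (X (K + 3)%nat f Hf); now rewrite Nat.sub_diag in X.
Qed.

End Vanishing.

(** * Rigidity and the range of the logarithm *)

Lemma taylor_at0 a F : taylor_on_disk a F -> F 0%C = a 0%nat.
Proof.
intros Ha; assert (H0 : Cmod (RtoC 0) < 1) by (rewrite Cmod_0; lra).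
apply (csums_unique _ _ _ (proj1 (taylorE a F) Ha _ H0)).
intros eps He; exists 1%nat; intros n Hn.
rewrite (csum_single _ _ 0%nat); [|lia|].
- replace (a 0%nat * 0 ^ 0 - a 0%nat)%C with (RtoC 0) by (simpl; ring); rewrite Cmod_0; lra.
- intros [|i] _ Hi; [lia|rewrite Cpow_S; ring].
Qed.

(** The squared moduli of the coefficients sum to at most 1, and the constant term alone accounts
    for 1. *)
Lemma Schwarz_rigidity v V : taylor_on_disk v V ->
  (forall z, Cmod z < 1 -> Cmod (V z) <= 1) -> V 0%C = 1%C ->
  forall z, Cmod z < 1 -> V z = 1%C.
Proof.
intros Hv HV H0; rewrite (taylor_at0 v V Hv) in H0.
assert (E := taylor_coef_energy v V 1 Hv Rle_0_1 HV).
assert (Hn : forall n, v (S n) = 0%C).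
{ intros n; apply Cmod_eq_0; specialize (E (S (S n))).
  assert (X : Cmod (v (S n)) ^ 2 <= 0); [|assert (Y := Cmod_ge_0 (v (S n))); simpl in X; nra].
  cbn [rsum] in E.
  assert (Y : 1 <= rsum (fun k => Cmod (v k) ^ 2) n + Cmod (v n) ^ 2).
  { replace 1 with (Cmod (v 0%nat) ^ 2) by (rewrite H0, Cmod_1; ring).
    exact (rsum_term (fun k => Cmod (v k) ^ 2) (S n) 0 (Cmod_sq_ge0 v) (Nat.lt_0_succ n)). }
  lra. }
assert (Ev : delta0 = v).
{ apply functional_extensionality; intros [|n]; [now rewrite H0|now rewrite Hn]. }
intros z Hz; apply (csums_unique _ _ _ (proj1 (taylorE v V) Hv z Hz)).
rewrite <- Ev; exact (proj1 (taylorE _ _) taylor_delta0 z Hz).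
Qed.

(** Compactness of the segment i[-M, M]: each point it on it is either close to i y0 or the centre
    of a disk of radius 2 [del t] that misses the range of [U]. If Im (U z) is within [del t] of t
    in the second case, the distance bound Re (U z) + |Im (U z) - t| forces Re (U z) to be at least
    [del t]. *)
Lemma real_part_gap (U : C -> C) M y0 :
  (forall z, Cmod z < 1 -> Cmod (U z) <= M /\ 0 <= Re (U z)) ->
  (forall y, in_closure_of_image U (0, y) -> y = y0) ->
  forall e, 0 < e -> exists d, 0 < d /\
    forall z, Cmod z < 1 -> e <= Rabs (Im (U z) - y0) -> d <= Re (U z).
Proof.
intros HU Hcl e He.
assert (loc : forall y, exists del : posreal,
  (Rabs (y - y0) < e / 2 /\ del <= e / 2) \/
  (forall z, Cmod z < 1 -> 2 * del <= Cmod (U z - (0, y))%C)).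
{ intros y; destruct (Rlt_le_dec (Rabs (y - y0)) (e / 2)) as [H|H].
  - assert (He2 : 0 < e / 2) by lra.
    exists (mkposreal _ He2); left; simpl; lra.
  - assert (Hy : ~ in_closure_of_image U (0, y)).
    { intros Hc; apply Hcl in Hc; subst y; rewrite Rminus_diag, Rabs_R0 in H; lra. }
    apply not_all_ex_not in Hy; destruct Hy as [del Hy]; apply imply_to_and in Hy.
    destruct Hy as [Hd Hy].
    assert (Hd2 : 0 < del / 2) by lra.
    exists (mkposreal _ Hd2); right; intros z Hz; simpl.
    apply Rnot_lt_le; intros Hlt; apply Hy; exists z; split; [assumption|lra]. }
set (del := fun y => proj1_sig (constructive_indefinite_description _ (loc y))).
assert (Hdel : forall y, (Rabs (y - y0) < e / 2 /\ del y <= e / 2) \/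
  (forall z, Cmod z < 1 -> 2 * del y <= Cmod (U z - (0, y))%C))
  by exact (fun y => proj2_sig (constructive_indefinite_description _ (loc y))).
destruct (compactness_value_1d (- M) M del) as [d Hd].
exists d; split; [apply cond_pos|]; intros z Hz Hez.
destruct (HU z Hz) as [HM HR].
assert (HI := im_le_Cmod (U z)); assert (HIM : Rabs (Im (U z)) <= M) by lra.
apply Rabs_le_between in HIM.
destruct (NNPP _ (Hd (Im (U z)) HIM)) as [t [Ht [Hxt Hdt]]].
destruct (Hdel t) as [[H1 H2]|H].
- exfalso.
  assert (X := Rabs_triang (Im (U z) - t) (t - y0)).
  replace (Im (U z) - t + (t - y0)) with (Im (U z) - y0) in X by ring; lra.
- specialize (H z Hz).
  assert (X : Cmod (U z - (0, t))%C <= Re (U z) + Rabs (Im (U z) - t)).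
  { replace (U z - (0, t))%C with (RtoC (Re (U z)) + (0, (Im (U z) - t)%R))%C.
    - eapply Rle_trans; [apply Cmod_triangle|].
      rewrite Cmod_R, Rabs_pos_eq by assumption; apply Rplus_le_compat_l.
      right; unfold Cmod; simpl fst; simpl snd.
      replace (0 ^ 2 + (Im (U z) - t) ^ 2) with (Rsqr (Im (U z) - t)) by (unfold Rsqr; ring).
      apply sqrt_Rsqr_abs.
    - destruct (U z) as [a b]; apply injective_projections; simpl; ring. }
  lra.
Qed.

Lemma cos_le_away e t : 0 <= e <= PI -> e <= t <= 2 * PI - e -> cos t <= cos e.
Proof.
intros He Ht; destruct (Rle_lt_dec t PI) as [H|H].
- apply cos_decr_1; lra.
- replace (cos t) with (cos (2 * PI - t)).
  + apply cos_decr_1; lra.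
  + rewrite <- cos_neg; replace (- (2 * PI - t)) with (t - 2 * PI) by ring.
    rewrite <- (cos_period (t - 2 * PI) 1); f_equal; simpl; ring.
Qed.

(** There are two regimes. Where [Im W] is not small, [Re W >= d] and |e^(-W)| <= e^(-d). Where it
    is small, the angle x + Im W stays away from 0 and 2 pi, so e^(-ix) e^(-W) cannot line up with
    1. *)
Lemma half_disk_contraction (W : C -> C) :
  (forall z, Cmod z < 1 -> 0 <= Re (W z)) ->
  (forall e, 0 < e -> exists d, 0 < d /\
    forall z, Cmod z < 1 -> e <= Rabs (Im (W z)) -> d <= Re (W z)) ->
  forall e, 0 < e -> exists k, 0 < k < 1 /\ forall x, e <= x <= 2 * PI - e ->
     forall z, Cmod z < 1 -> Cmod (1 + expi (- x) * cexp (- W z))%C <= 2 * k.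
Proof.
intros HR Hgap e He.
(* At most e / 2, so that |Im W| < e1 moves an angle from [e, 2 pi - e] into [e1, 2 pi - e1]; at
   most 1/2, so that cos e1 > 0. *)
set (e1 := Rmin e 1 / 2).
assert (He1 : 0 < e1 <= 1 / 2 /\ 2 * e1 <= e).
{ unfold e1; assert (A1 := Rmin_l e 1); assert (A2 := Rmin_r e 1).
  assert (0 < Rmin e 1) by (apply Rmin_glb_lt; lra); lra. }
destruct (Hgap e1) as [d [Hd Hdz]]; [lra|].
assert (Hpi := PI2_1).
assert (Hc : 0 < cos e1 < 1).
{ split; [apply cos_gt_0; lra|].
  rewrite <- cos_0; apply cos_decreasing_1; lra. }
assert (Hed : exp (- d) < 1) by (rewrite <- exp_0; apply exp_increasing; lra).
assert (Hed0 := exp_pos (- d)).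
exists (Rmax ((1 + exp (- d)) / 2) ((3 + cos e1) / 4)); split.
{ split; [eapply Rlt_le_trans; [|apply Rmax_l]; lra|apply Rmax_lub_lt; lra]. }
intros x Hx z Hz.
set (s := exp (- Re (W z))).
assert (Hs : Cmod (expi (- x) * cexp (- W z)) = s).
{ rewrite Cmod_mult, Cmod_expi, Cmod_cexp, Rmult_1_l; reflexivity. }
assert (Hs0 : 0 < s) by apply exp_pos.
assert (Hs1 : s <= 1) by (unfold s; rewrite <- exp_0; apply exp_monotone; specialize (HR z Hz); lra).
destruct (Rle_lt_dec e1 (Rabs (Im (W z)))) as [H|H].
- eapply Rle_trans; [apply Cmod_triangle|]; rewrite Cmod_1, Hs.
  assert (s <= exp (- d)) by (unfold s; apply exp_monotone; specialize (Hdz z Hz H); lra).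
  assert (X := Rmax_l ((1 + exp (- d)) / 2) ((3 + cos e1) / 4)); lra.
- apply Rle_trans with (2 * ((3 + cos e1) / 4));
    [|assert (X := Rmax_r ((1 + exp (- d)) / 2) ((3 + cos e1) / 4)); lra].
  apply Rabs_lt_between in H.
  assert (Ht := cos_le_away e1 (x + Im (W z)) ltac:(lra) ltac:(lra)).
  apply Rsqr_incr_0_var; [|lra]; rewrite !Rsqr_pow2, Cmod2_alt.
  assert (E : (expi (- x) * cexp (- W z))%C = (s * cos (x + Im (W z)), - (s * sin (x + Im (W z))))).
  { rewrite cos_plus, sin_plus; unfold s, expi, cexp; apply injective_projections; simpl;
      unfold Re, Im; rewrite ?cos_neg, ?sin_neg; ring. }
  rewrite E; clear E Hs; clearbody s; revert Ht; generalize (x + Im (W z)); intros t Ht.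
  assert (Et := sin2_cos2 t); unfold Rsqr in Et.
  change (Re (1 + (s * cos t, - (s * sin t)))) with (1 + s * cos t).
  change (Im (1 + (s * cos t, - (s * sin t)))) with (0 + - (s * sin t)).
  replace ((1 + s * cos t) ^ 2 + (0 + - (s * sin t)) ^ 2)
    with (1 + 2 * (s * cos t) + s ^ 2 * (sin t * sin t + cos t * cos t)) by ring.
  rewrite Et.
  (* The squared modulus is at most 2 + 2 cos e1, which falls short of ((3 + cos e1) / 2)^2 by ((1 -
     cos e1) / 2)^2. *)
  assert (A1 : s * cos t <= cos e1).
  { apply Rle_trans with (s * cos e1); [apply Rmult_le_compat_l; lra|nra]. }
  nra.
Qed.

(** * Growth of the adjoint iterates *)

(** Each factor moved across replaces f by A f, hence an induction over all f. *)
Lemma adjoint_iter T0 A h f n : is_H2_adjoint T0 A ->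
  (forall m, is_H2 (Nat.iter m T0 h)) -> is_H2 f ->
  is_H2 (Nat.iter n A f) /\ H2_inner (Nat.iter n T0 h) f = H2_inner h (Nat.iter n A f).
Proof.
intros HA Hh; revert f; induction n as [|n IH]; intros f Hf; [split; [assumption|reflexivity]|].
destruct (HA (Nat.iter n T0 h) f (Hh n) Hf) as [H1 H2].
destruct (IH (A f) H1) as [H3 H4].
rewrite Nat.iter_succ_r; split; [assumption|].
rewrite <- H4; exact H2.
Qed.

Lemma limsup_bounded (u : nat -> R) : LimSup_seq u <> p_infty ->
  exists B N, forall n, (N <= n)%nat -> u n <= B.
Proof.
unfold LimSup_seq; destruct (ex_LimSup_seq u) as [l Hl]; simpl; intros Hn.
destruct l as [l| |]; [|contradiction|].
- destruct (Hl (mkposreal 1 Rlt_0_1)) as [_ [N HN]]; simpl in HN.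
  exists (l + 1), N; intros n Hn'; left; auto.
- destruct (Hl 0) as [N HN]; exists 0, N; intros n Hn'; left; auto.
Qed.

(** A limsup other than +infinity bounds the tail, an integer K > k absorbs n^k, and the finitely
    many first terms go into the constant as a sum. *)
Lemma polynomial_growth (x : nat -> R) k : (forall n, 0 <= x n) -> 0 < k ->
  LimSup_seq (fun n => Rpower (INR n) (- k) * x n) <> p_infty ->
  exists C0 K, 0 <= C0 /\ forall n, x n <= C0 * (1 + INR n) ^ K.
Proof.
intros Hx Hk HL; destruct (limsup_bounded _ HL) as [B [N HN]].
destruct (INR_unbounded k) as [K HK].
assert (HS := rsum_ge0 x (S N) Hx).
assert (HB := Rabs_pos B).
exists (Rabs B + rsum x (S N)), K; split; [lra|]; intros n.
assert (Hn0 := pos_INR n).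
assert (HP : 1 <= (1 + INR n) ^ K) by (apply pow_R1_Rle; lra).
destruct (le_lt_dec n N) as [Hn|Hn].
- assert (X := rsum_term x (S N) n Hx ltac:(lia)); simpl in X, HS |- *; nra.
(* Here n > N, hence n >= 1, and [Rpower] is not evaluated at 0, where its value is a mere
   convention. *)
- assert (Hn1 : 1 <= INR n) by (apply (le_INR 1); lia).
  specialize (HN n ltac:(lia)).
  assert (Hp : 0 < Rpower (INR n) k) by apply exp_pos.
  assert (X : x n <= B * Rpower (INR n) k).
  { rewrite Rpower_Ropp in HN.
    apply Rmult_le_reg_l with (/ Rpower (INR n) k); [now apply Rinv_0_lt_compat|].
    eapply Rle_trans; [exact HN|right; field; lra]. }
  assert (Y : Rpower (INR n) k <= (1 + INR n) ^ K).
  { rewrite <- Rpower_pow by lra.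
    apply Rle_trans with (Rpower (INR n) (INR K)).
    - apply Rle_Rpower; lra.
    - apply Rle_Rpower_l; lra. }
  eapply Rle_trans; [exact X|].
  apply Rle_trans with (Rabs B * (1 + INR n) ^ K).
  + assert (Z := Rle_abs B); apply Rle_trans with (Rabs B * Rpower (INR n) k);
      [apply Rmult_le_compat_r; lra|apply Rmult_le_compat_l; lra].
  + apply Rmult_le_compat_r; lra.
Qed.

Lemma iter_toeplitz_scal c (g h : nat -> C) n :
  Nat.iter n (T (fun k => c * g k)%C) h = (fun k => c ^ n * Nat.iter n (T g) h k)%C.
Proof.
induction n as [|n IH]; apply functional_extensionality; intros k.
- simpl; ring.
- change (Nat.iter (S n) (T ?a) h) with (T a (Nat.iter n (T a) h)); rewrite IH.
  rewrite !toeplitzE, <- csum_scal; apply csum_ext; intros i _; rewrite Cpow_S; ring.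
Qed.

Lemma polynomial_orbit_zero (G U : C -> C) (g u : nat -> C) y0 Kg M :
  taylor_on_disk g G -> (forall z, Cmod z < 1 -> Cmod (G z) <= Kg) ->
  (forall z, Cmod z < 1 -> 1 <= Cmod (G z)) ->
  (exists z, Cmod z < 1 /\ Cmod (G z) <> 1) ->
  taylor_on_disk u U -> (forall z, Cmod z < 1 -> Cmod (U z) <= M) ->
  (forall z, Cmod z < 1 -> G z = cexp (U z)) ->
  (forall y, in_closure_of_image U (0, y) -> y = y0) ->
  forall A, is_H2_adjoint (T g) A -> forall f, is_H2 f ->
  forall C0 K, 0 <= C0 -> (forall n, H2_norm (Nat.iter n A f) <= C0 * (1 + INR n) ^ K) ->
  f = (fun _ => RtoC 0).
Proof.
intros Hg HGb HG1 Hnc Hu HUb HGU Hcl A HA f Hf C0 K HC0 Hgr.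
assert (HRe : forall z, Cmod z < 1 -> 0 <= Re (U z)).
{ intros z Hz; specialize (HG1 z Hz); rewrite HGU, Cmod_cexp in HG1 by assumption.
  apply Rnot_lt_le; intros Hlt; apply exp_increasing in Hlt; rewrite exp_0 in Hlt; lra. }
(* The rotation by [c] moves the contact point i y0 of the range with the imaginary axis to 0: W = U
   - i y0 and V = e^(-W) = 1 / (c G). *)
set (iy := (0, y0) : C); set (c := cexp (- iy)%C).
assert (Hc : Cmod c = 1).
{ unfold c; rewrite Cmod_cexp; simpl; rewrite Ropp_0; apply exp_0. }
set (W := fun z => (U z + - iy * 1)%C).
assert (HW : taylor_on_disk (fun n => u n + - iy * delta0 n)%C W)
  by (apply taylor_plus; [assumption|apply taylor_scal, taylor_delta0]).
assert (HReW : forall z, Re (W z) = Re (U z)) by (intros z; unfold W, iy; simpl; unfold Re; ring).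
assert (HImW : forall z, Im (W z) = Im (U z) - y0) by (intros z; unfold W, iy; simpl; unfold Im; ring).
destruct (taylor_exp_opp _ W (M + Cmod iy) HW) as [v Hv].
{ intros z Hz; split; [|rewrite HReW; now apply HRe].
  unfold W; rewrite Cmult_1_r; eapply Rle_trans; [apply Cmod_triangle|].
  rewrite Cmod_opp; specialize (HUb z Hz); lra. }
set (V := fun z => cexp (- W z)%C) in Hv.
assert (HV1 : forall z, Cmod z < 1 -> Cmod (V z) <= 1).
{ intros z Hz; unfold V; rewrite Cmod_cexp, <- exp_0; apply exp_monotone.
  change (- Re (W z) <= 0); rewrite HReW; specialize (HRe z Hz); lra. }
assert (HVG : forall z, Cmod z < 1 -> (V z * (c * G z))%C = 1%C).
{ intros z Hz; unfold V, c; rewrite HGU, <- !cexp_add, <- cexp_0 by assumption.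
  f_equal; unfold W; ring. }
apply (growth_implies_zero (fun n => c * g n)%C v (fun z => c * G z)%C V Kg
   (taylor_scal c g G Hg) Hv) with (K := K) (C0 := C0); try assumption.
- intros z Hz; rewrite Cmod_mult, Hc, Rmult_1_l; auto.
- intros n h Hh.
  assert (Mg : multiplier g Kg) by now exists G.
  assert (HT : forall m, is_H2 (Nat.iter m (T g) h)) by (intros m; now apply (iter_toeplitz_H2 g Kg)).
  destruct (adjoint_iter (T g) A h f n HA HT Hf) as [H1 H2].
  rewrite iter_toeplitz_scal, H2_inner_scal by (try apply H2_scal; auto).
  rewrite H2, Cmod_mult, Cmod_pow, Hc, pow1, Rmult_1_l.
  eapply Rle_trans; [now apply H2_inner_le|].
  rewrite Rmult_comm; apply Rmult_le_compat_r; [apply H2_norm_ge0|apply Hgr].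
- apply half_disk_contraction.
  + intros z Hz; rewrite HReW; auto.
  + intros e He; destruct (real_part_gap U M y0) with (e := e) as [d [Hd Hdz]]; auto.
    exists d; split; [assumption|]; intros z Hz; rewrite HReW, HImW; auto.
(* If V 0 = 1, rigidity makes V the constant 1, and then c G = 1 gives |G| = 1 on the whole disk. *)
- intros HV0; destruct Hnc as [z [Hz Hn]]; apply Hn.
  assert (E := HVG z Hz); rewrite (Schwarz_rigidity v V Hv HV1 HV0 z Hz), Cmult_1_l in E.
  apply (f_equal Cmod) in E; rewrite Cmod_mult, Hc, Rmult_1_l, Cmod_1 in E; exact E.
Qed.

Lemma radial_limit_le (F : C -> C) t L B :
  (forall z, Cmod z < 1 -> Cmod (F z) <= B) -> radial_limit F t L -> Cmod L <= B.
Proof.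
intros HF HL; apply le_epsilon; intros eps He.
assert (H := proj1 (filterlim_locally_ball_norm (F := at_left 1) (U := C_NormedModule) _ L) HL
                 (mkposreal eps He)).
destruct H as [d Hd].
set (r := 1 - Rmin d 1 / 2).
assert (Hm : 0 < Rmin d 1) by (apply Rmin_glb_lt; [apply cond_pos|lra]).
assert (Hm1 := Rmin_l d 1); assert (Hm2 := Rmin_r d 1).
assert (Hr : ball 1 d r).
{ change (Rabs (r - 1) < d); unfold r; rewrite Rabs_left; lra. }
specialize (Hd r Hr ltac:(unfold r; lra)).
set (z := (r * Rtrigo_def.cos t, r * Rtrigo_def.sin t) : C) in Hd.
assert (Hz : Cmod z < 1).
{ replace z with (RtoC r * expi t)%C by (unfold z, expi; apply injective_projections; simpl; ring).
  rewrite Cmod_mult, Cmod_expi, Cmod_R, Rabs_pos_eq; unfold r; lra. }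
assert (Hd' : Cmod (F z - L)%C < eps) by exact Hd.
specialize (HF z Hz); rewrite Cmod_minus_sym in Hd'.
replace L with (L - F z + F z)%C by ring.
eapply Rle_trans; [apply Cmod_triangle|lra].
Qed.

Theorem theorem6p6 (G : C -> C) (ghat : nat -> C) :
  taylor_on_disk ghat G ->
  bounded_on_disk G ->
  (forall z : C, Cmod z < 1 -> 1 <= Cmod (G z)) ->
  leb_negligible (fun t : R => 0 <= t <= 2 * PI /\
                    ~ (exists L : C, radial_limit G t L /\ 1 < Cmod L)) ->
  (exists (U : C -> C) (uhat : nat -> C),
      taylor_on_disk uhat U /\ bounded_on_disk U /\
      (forall z : C, Cmod z < 1 -> G z = cexp (U z)) /\
      (exists y0 : R, forall y : R, in_closure_of_image U (0, y) <-> y = y0)) ->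
  forall A : (nat -> C) -> (nat -> C),
  is_H2_adjoint (toeplitz_analytic ghat) A ->
  forall f : nat -> C, is_H2 f -> f <> (fun _ => RtoC 0) ->
  forall k : R, 0 < k ->
  LimSup_seq (fun n : nat => Rpower (INR n) (- k) * H2_norm (Nat.iter n A f)) = p_infty.
Proof.
intros Hg [Kg HGb] HG1 Hneg [U [u [Hu [[M HUb] [HGU [y0 Hy0]]]]]] A HA f Hf Hf0 k Hk.
apply NNPP; intros HL; apply Hf0.
destruct (polynomial_growth (fun n => H2_norm (Nat.iter n A f)) k) as [C0 [K [HC0 HK]]];
  [intros; apply H2_norm_ge0|assumption|assumption|].
apply (polynomial_orbit_zero G U ghat u y0 Kg M) with (A := A) (C0 := C0) (K := K);
  try assumption; [|intros y; apply Hy0].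
(* If |G| were 1 on the whole disk, every radial limit would have modulus at most 1 and the
   exceptional set would be all of [0, 2 pi]. *)
apply NNPP; intros Hc; revert Hneg; apply LebesgueInterval.interval_not_negligible.
intros t Ht0 Ht1; assert (Hpi := PI2_1); split; [lra|].
intros [L [HL1 HL2]]; apply (radial_limit_le G t L 1) in HL1; [lra|].
intros z Hz; right; apply NNPP; intros Hn; apply Hc; exists z; auto.
Qed.
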